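(* Let $\mathcal{G}$ be a topologically principal, amenable, \'etale groupoid. If $M$ is a $C^*$-subalgebra of $C_r^*(\mathcal{G})$ containing $C_0(\mathcal{G}^{(0)})$, then $C_0(\mathcal{G}^{(0)})$ is a Cartan subalgebra of $M$ if and only if there exists a unique open wide subgroupoid $\mathcal{H}$ of $\mathcal{G}$ such that $M=C_r^*(\mathcal{H})$. In this case, $\mathcal{H}=\sigma(M)$, and $M$ is spectral as a diagonal bimodule. Consequently, the map $\mathcal{H}\mapsto A(\mathcal{H})$ gives a one-to-one correspondence between the open wide subgroupoids of $\mathcal{G}$ and the $C^*$-subalgebras of $C_r^*(\mathcal{G})$ containing $C_0(\mathcal{G}^{(0)})$ as a Cartan subalgebra.
   Context: An \'etale groupoid means a second countable, locally compact, Hausdorff topological groupoid $\mathcal{G}$ whose range and source maps $r,s:\mathcal{G}\to\mathcal{G}^{(0)}$ are local homeomorphisms; $\mathcal{G}^{(0)}$ is the unit space and $\mathcal{G}_u=s^{-1}(u)$. $\mathcal{G}$ is topologically principal if $\{u\in\mathcal{G}^{(0)}: \mathcal{G}_u\cap r^{-1}(u)=\{u\}\}$ is dense in $\mathcal{G}^{(0)}$. Amenability is (topological) amenability. A subgroupoid $\mathcal{H}$ of $\mathcal{G}$ is wide if $\mathcal{G}^{(0)}\subseteq\mathcal{H}$. $C_c(\mathcal{G})$ is a $*$-algebra with $f^*(\gamma)=\overline{f(\gamma^{-1})}$ and $(fg)(\gamma)=\sum_{\gamma'\in\mathcal{G}_{s(\gamma)}}f(\gamma\gamma'^{-1})g(\gamma')$;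 $C_r^*(\mathcal{G})$ is its completion in the norm $\|f\|_{\mathrm{red}}=\sup_{u\in\mathcal{G}^{(0)}}\|\mathrm{Ind}_u(f)\|$, where $\mathrm{Ind}_u(f)\xi(\gamma)=\sum_{\gamma'\in\mathcal{G}_u}f(\gamma\gamma'^{-1})\xi(\gamma')$ on $\ell^2(\mathcal{G}_u)$. For an open subgroupoid $\mathcal{H}$, $C_r^*(\mathcal{H})$ is identified with the closure of $C_c(\mathcal{H})$ in $C_r^*(\mathcal{G})$. The inclusion $C_c(\mathcal{G})\subseteq C_0(\mathcal{G})$ extends to a norm-decreasing injective linear map $j:C_r^*(\mathcal{G})\to C_0(\mathcal{G})$, and each $a\in C_r^*(\mathcal{G})$ is identified with the function $j(a)$; write $a(\gamma)=j(a)(\gamma)$. $C_0(\mathcal{G}^{(0)})$ is regarded as a $C^*$-subalgebra of $C_r^*(\mathcal{G})$. A diagonal bimodule of $C_r^*(\mathcal{G})$ is a norm closed subspace $M$ such that $ab,ba\in M$ for all $a\in M$, $b\in C_0(\mathcal{G}^{(0)})$. Its spectrum is $\sigma(M)=\{\gamma\in\mathcal{G}:a(\gamma)\ne0\text{ for some }a\in M\}$. For open $P\subseteq\mathcal{G}$, $A(P)=\{a\in C_r^*(\mathcal{G}):a(\gamma)=0\text{ for all }\gamma\notin P\}$. $M$ is spectral if $M=A(\sigma(M))$. An abelian $C^*$-subalgebra $B$ of a $C^*$-algebra $A$ is a Cartan subalgebra (in Renault's sense) if $B$ contains an approximate unit of $A$, $B$ is maximal abelian in $A$, the normalizer $N(B,A)=\{n\in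 A: nBn^*\subseteq B,\ n^*Bn\subseteq B\}$ generates $A$ as a $C^*$-algebra, and there is a faithful conditional expectation of $A$ onto $B$. *)

(* Defs.v *)
From HB Require Import structures.
From mathcomp Require Import all_boot all_order all_algebra.
From mathcomp Require Import complex.
From mathcomp Require Import all_classical all_reals all_analysis.
Set Implicit Arguments.
Unset Strict Implicit.
Unset Printing Implicit Defensive.
Import Order.TTheory GRing.Theory Num.Theory.
Import numFieldNormedType.Exports.
Local Open Scope classical_set_scope.
Local Open Scope complex_scope.
Local Open Scope ring_scope.

(* [f] restricts, near every point, to a homeomorphism onto a relatively open
   subset of [Y] (with the subspace topology); [f] is meant to map into [Y]. *)
Definition local_homeo (X : topologicalType) (f : X -> X) (Y : set X) : Prop :=
  forall x, exists U : set X,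
    [/\ open U, U x, {in U &, injective f}, {within U, continuous f} &
      forall W, open W -> W `<=` U ->
        exists2 V, open V & f @` W = V `&` Y].

(* The unit space is the subset [range eg_r] of the arrows.  The total function
   [eg_mul] is a product only on pairs [(x, y)] with [eg_s x = eg_r y]; its other
   values are never used. *)
Record etale_groupoid := EtaleGroupoid {
  eg_space :> topologicalType;
  eg_r : eg_space -> eg_space;
  eg_s : eg_space -> eg_space;
  eg_mul : eg_space -> eg_space -> eg_space;
  eg_inv : eg_space -> eg_space;
  eg_rr : forall x, eg_r (eg_r x) = eg_r x;
  eg_sr : forall x, eg_s (eg_r x) = eg_r x;
  eg_rs : forall x, eg_r (eg_s x) = eg_s x;
  eg_ss : forall x, eg_s (eg_s x) = eg_s x;
  eg_r_mul : forall x y, eg_s x = eg_r y -> eg_r (eg_mul x y) = eg_r x;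
  eg_s_mul : forall x y, eg_s x = eg_r y -> eg_s (eg_mul x y) = eg_s y;
  eg_mulA : forall x y z, eg_s x = eg_r y -> eg_s y = eg_r z ->
    eg_mul x (eg_mul y z) = eg_mul (eg_mul x y) z;
  eg_mul_r : forall x, eg_mul (eg_r x) x = x;
  eg_mul_s : forall x, eg_mul x (eg_s x) = x;
  eg_r_inv : forall x, eg_r (eg_inv x) = eg_s x;
  eg_s_inv : forall x, eg_s (eg_inv x) = eg_r x;
  eg_mul_inv : forall x, eg_mul x (eg_inv x) = eg_r x;
  eg_inv_mul : forall x, eg_mul (eg_inv x) x = eg_s x;
  eg_inv_continuous : continuous eg_inv;
  eg_mul_continuous :
    {within [set p : eg_space * eg_space | eg_s p.1 = eg_r p.2],
      continuous (fun p => eg_mul p.1 p.2)};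
  eg_second_countable : @second_countable eg_space;
  eg_locally_compact : locally_compact [set: eg_space];
  eg_hausdorff : hausdorff_space eg_space;
  eg_r_local_homeo : local_homeo eg_r (range eg_r);
  eg_s_local_homeo : local_homeo eg_s (range eg_r)
}.

Section groupoid.
Variable G : etale_groupoid.

Definition units : set G := range (@eg_r G).

Definition s_fiber (u : G) : set G := [set g | eg_s g = u].

Definition r_fiber (u : G) : set G := [set g | eg_r g = u].

Definition topologically_principal : Prop :=
  units `<=` closure [set u | units u /\ s_fiber u `&` r_fiber u = [set u]].

Definition subgroupoid (H : set G) : Prop :=
  (forall x y, H x -> H y -> eg_s x = eg_r y -> H (eg_mul x y)) /\
  (forall x, H x -> H (eg_inv x)).

Definition open_wide_subgroupoid (H : set G) : Prop :=
  [/\ open H, subgroupoid H & units `<=` H].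

(* Continuous functions on [G] whose support is compact and contained in [P].
   For open [P], this is C_c(P) extended by zero to [G]. *)
Definition Cc (K : numFieldType) (P : set G) : set (G -> K) :=
  [set f | [/\ continuous f,
               compact (closure [set x | f x != 0]) &
               closure [set x | f x != 0] `<=` P]].

Definition C0 (K : numFieldType) : set (G -> K) :=
  [set f | continuous f /\
           forall e : K, 0 < e -> compact [set x | e <= `|f x|]].

(* Topological amenability in the sense of Anantharaman-Delaroche and Renault:
   a topological approximate invariant mean given by nonnegative functions in
   C_c(G), the net being indexed by pairs (compact set, tolerance).  The sums
   over range fibres have finite support. *)
Definition amenable (R : realType) : Prop :=
  forall (K : set G) (e : R), compact K -> 0 < e ->
    exists f : G -> R,
      [/\ Cc setT f,
          (forall g, 0 <= f g),
          (forall u, units u -> \sum_(g \in r_fiber u) f g <= 1),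
          (forall u, units u -> K u ->
             1 - \sum_(g \in r_fiber u) f g < e) &
          (forall g, K g ->
             \sum_(h \in r_fiber (eg_r g))
               `|f (eg_mul (eg_inv g) h) - f h| < e)].

End groupoid.

Arguments units G : clear implicits.

Section convolution.
Variables (R : realType) (G : etale_groupoid).
Implicit Types (f g xi : G -> R[i]) (u : G).

Definition involution f : G -> R[i] := fun x => (f (eg_inv x))^*.

Definition convolution f g : G -> R[i] := fun x =>
  \sum_(y \in s_fiber (eg_s x)) f (eg_mul x (eg_inv y)) * g y.

(* For [f] in C_c(G) the sum has finite support, whatever [xi] is. *)
Definition Ind u f xi : G -> R[i] := fun x =>
  \sum_(y \in s_fiber u) f (eg_mul x (eg_inv y)) * xi y.

(* The norm of l^2(G_u); functions on G_u are represented by functions on [G],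
   of which only the values on G_u matter. *)
Definition l2norm u xi : \bar R :=
  sqrte (\esum_(x in s_fiber u) ((complex.Re `|xi x|) ^+ 2)%:E)%E.

Definition Ind_norm u f : \bar R :=
  ereal_sup [set l2norm u (Ind u f xi) | xi in [set xi | (l2norm u xi <= 1)%E]].

Definition reduced_norm f : \bar R :=
  ereal_sup [set Ind_norm u f | u in units G].

End convolution.

Record cstar_algebra (R : realType) := CstarAlgebra {
  cstar_sort :> completeNormedModType R[i];
  cmul : cstar_sort -> cstar_sort -> cstar_sort;
  cstar : cstar_sort -> cstar_sort;
  cmulA : forall a b c, cmul a (cmul b c) = cmul (cmul a b) c;
  cmulDl : forall a b c, cmul (a + b) c = cmul a c + cmul b c;
  cmulDr : forall a b c, cmul a (b + c) = cmul a b + cmul a c;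
  cmulZl : forall (k : R[i]) a b, cmul (k *: a) b = k *: cmul a b;
  cmulZr : forall (k : R[i]) a b, cmul a (k *: b) = k *: cmul a b;
  cmul_norm : forall a b, `|cmul a b| <= `|a| * `|b|;
  cstarK : forall a, cstar (cstar a) = a;
  cstarD : forall a b, cstar (a + b) = cstar a + cstar b;
  cstarZ : forall (k : R[i]) a, cstar (k *: a) = k^* *: cstar a;
  cstarM : forall a b, cstar (cmul a b) = cmul (cstar b) (cstar a);
  cstar_norm : forall a, `|cmul (cstar a) a| = `|a| ^+ 2
}.

Section cstar.
Variables (R : realType) (A : cstar_algebra R).
Implicit Types (M B N D : set A) (a b : A).

Definition closed_subspace M : Prop :=
  [/\ closed M, M 0, (forall a b, M a -> M b -> M (a + b)) &
      forall (k : R[i]) a, M a -> M (k *: a)].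

Definition cstar_subalgebra M : Prop :=
  [/\ closed_subspace M, (forall a b, M a -> M b -> M (cmul a b)) &
      forall a, M a -> M (cstar a)].

Definition abelian_cstar_subalgebra B : Prop :=
  cstar_subalgebra B /\ forall a b, B a -> B b -> cmul a b = cmul b a.

Definition cpositive a : Prop := exists x, a = cmul (cstar x) x.

(* [e] is an increasing net of positive contractions in [M], indexed by the
   directed preorder [(I, le)], with e_i a -> a and a e_i -> a for [a] in [M]. *)
Definition approximate_unit M (I : Type) (le : I -> I -> Prop) (e : I -> A) :
    Prop :=
  [/\ [/\ inhabited I, (forall i, le i i),
          (forall i j k, le i j -> le j k -> le i k) &
          forall i j, exists2 k, le i k & le j k],
      (forall i, [/\ M (e i), cpositive (e i) & `|e i| <= 1]),
      (forall i j, le i j -> cpositive (e j - e i)) &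
      forall a (d : R[i]), M a -> 0 < d -> exists i0, forall i, le i0 i ->
        `|cmul (e i) a - a| < d /\ `|cmul a (e i) - a| < d].

Definition contains_approximate_unit M B : Prop :=
  exists (I : Type) (le : I -> I -> Prop) (e : I -> A),
    approximate_unit M le e /\ forall i, B (e i).

Definition maximal_abelian M B : Prop :=
  [/\ abelian_cstar_subalgebra B, B `<=` M &
      forall D, abelian_cstar_subalgebra D -> B `<=` D -> D `<=` M -> D = B].

Definition normalizer M B : set A :=
  [set n | M n /\ forall b, B b ->
     B (cmul (cmul n b) (cstar n)) /\ B (cmul (cmul (cstar n) b) n)].

Definition generated_cstar (N : set A) : set A :=
  [set a | forall D, cstar_subalgebra D -> N `<=` D -> D a].

(* Only the values of [E] on [M] matter. *)
Definition faithful_conditional_expectation M B (E : A -> A) : Prop :=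
  [/\ [/\ (forall a, M a -> B (E a)),
          (forall a b, M a -> M b -> E (a + b) = E a + E b) &
          (forall (k : R[i]) a, M a -> E (k *: a) = k *: E a)],
      (forall b, B b -> E b = b),
      (forall a, M a -> `|E a| <= `|a| /\ cpositive (E (cmul (cstar a) a))),
      (forall a b, M a -> B b ->
         E (cmul a b) = cmul (E a) b /\ E (cmul b a) = cmul b (E a)) &
      (forall a, M a -> E (cmul (cstar a) a) = 0 -> a = 0)].

(* [B] is a Cartan subalgebra of the C*-algebra [M], both sitting in [A]. *)
Definition cartan_subalgebra M B : Prop :=
  [/\ abelian_cstar_subalgebra B /\ B `<=` M,
      contains_approximate_unit M B,
      maximal_abelian M B,
      generated_cstar (normalizer M B) = M &
      exists E, faithful_conditional_expectation M B E].

End cstar.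

(* The completion of the *-algebra C_c(G) in the reduced norm: a C*-algebra with
   an isometric *-homomorphism of dense range from C_c(G).  Only the values of
   [rc_in] on C_c(G) matter.  On C_c(G) the reduced norm is finite ([fine] is
   also correct for the empty groupoid, where it is a supremum over the empty
   set). *)
Record reduced_cstar_algebra (R : realType) (G : etale_groupoid) :=
  ReducedCstarAlgebra {
  rc_algebra :> cstar_algebra R;
  rc_in : (G -> R[i]) -> rc_algebra;
  rc_inD : forall f g, Cc setT f -> Cc setT g ->
    rc_in (fun x => f x + g x) = rc_in f + rc_in g;
  rc_inZ : forall (k : R[i]) f, Cc setT f ->
    rc_in (fun x => k * f x) = k *: rc_in f;
  rc_inM : forall f g, Cc setT f -> Cc setT g ->
    rc_in (convolution f g) = cmul (rc_in f) (rc_in g);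
  rc_in_star : forall f, Cc setT f ->
    rc_in (involution f) = cstar (rc_in f);
  rc_in_norm : forall f, Cc setT f ->
    `|rc_in f| = (fine (reduced_norm f))%:C;
  rc_in_dense : closure (rc_in @` Cc setT) = setT
}.

Section reduced.
Variables (R : realType) (G : etale_groupoid) (A : reduced_cstar_algebra R G).
Implicit Types (a b : A) (M : set A) (P H : set G).

(* The filter of functions [f] in C_c(G) tending to [a] in norm. *)
Definition Cc_near a : set_system (G -> R[i]) :=
  filter_from [set e : R[i] | 0 < e]
    (fun e => [set f | Cc setT f /\ `|a - rc_in A f| < e]).

(* The continuous extension j of the inclusion of C_c(G) in C_0(G):
   [jmap a] is the (pointwise) limit of f as f -> a in norm, f in C_c(G). *)
Definition jmap a : G -> R[i] :=
  fun x => lim ((f x : (R[i])^o) @[f --> Cc_near a]).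

(* C_0 of the unit space, its elements being extended by zero to [G]. *)
Definition C0_units : set A :=
  [set a | C0 (jmap a) /\ forall x, ~ units G x -> jmap a x = 0].

(* For an open subgroupoid [H]: the closure of C_c(H). *)
Definition Cr H : set A := closure (rc_in A @` Cc H).

Definition diagonal_bimodule M : Prop :=
  closed_subspace M /\
  forall a b, M a -> C0_units b -> M (cmul a b) /\ M (cmul b a).

Definition spectrum M : set G :=
  [set x | exists2 a, M a & jmap a x != 0].

Definition Aset P : set A := [set a | forall x, ~ P x -> jmap a x = 0].

Definition spectral M : Prop := M = Aset (spectrum M).

End reduced.

Arguments C0_units {R G} A.
Arguments Cr {R G} A H.
Arguments Aset {R G} A P.

(* Main.v *)
Require Import Defs.
From mathcomp Require Import all_boot all_order all_algebra.
From mathcomp Require Import complex finmap.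
From mathcomp Require Import ring lra.
From mathcomp Require Import all_classical all_reals all_analysis.
Set Implicit Arguments.
Unset Strict Implicit.
Unset Printing Implicit Defensive.
Import Order.TTheory GRing.Theory Num.Theory.
Import numFieldNormedType.Exports.
Local Open Scope classical_set_scope.
Local Open Scope complex_scope.
Local Open Scope ring_scope.

(** An element [a] of the reduced algebra is determined by its function
[jmap a], and its norm is the supremum over the units [u] of the norms of the
matrices [jmap a (x y^-1)], [x] and [y] in the source fibre of [u].  Everything
is expressed through the finite sections of these matrices, by the predicate
[op_bound]: [norm_le_op_bound] and [jmap_op_bound] say that [op_bound (jmap a) C]
holds exactly when the norm of [a] is at most [C], for nonnegative [C].  A
function on a bisection gives a matrix with at most one entry in each row and each column, so that its
norm is its supremum norm; hence, for a bisection [S], an element that vanishes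
off [S] is a limit of functions of C_c(S) ([Aset_bisection]).

From a Cartan inclusion to a groupoid ([cartan_groupoid]).  In a topologically
principal groupoid the support of a normalizer [n] of C_0 of the unit space is
an open bisection: if [x] and [y] are distinct points of the support with the
same source [u], and [u] has trivial isotropy, a function [b] peaking at [u]
makes [n b n^*] nonzero at [x y^-1], which is not a unit
([normalizer_free_fibre]); density of such units does the rest.  If [f] is in
C_c of the support of [n], then [f = n b] with [b] in the diagonal, so that [f]
is a normalizer in [M] as well ([factor_bisection]).  The supports of the
normalizers in [M] therefore cover an open wide subgroupoid [H], a partition of
unity gives that C_r(H) lies in [M], and [M], being generated by normalizers,
lies in C_r(H).

From a groupoid to a Cartan inclusion ([cartan_Cr]).  An element commuting with
the diagonal is supported on the isotropy, whose interior is the unit space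
([commutant_C0_units]); functions on bisections are normalizers and generate
([bisection_normalizer], [Cr_sub_cover]); compactly supported functions between
0 and 1 on the unit space form an approximate unit; restriction of functions to
the unit space is a faithful conditional expectation.

The groupoid is recovered as the spectrum ([spectrum_Cr]), whence uniqueness.
Amenability gives A(P) = closure of C_c(P) for every open [P]
([amenable_Aset]): square roots of the functions of an approximate invariant
mean produce compactly supported Schur multipliers of norm at most 1 that tend
to 1 uniformly on compact sets.  This yields spectrality and turns the
correspondence [H |-> C_r(H)] into [H |-> A(H)]. *)

(** * Real-valued norms over the complex numbers *)

Section real_norm.
Variables (R : realType).

(** Norms over [R[i]] take values in [R[i]], whose order is partial; their real
    values give access to linear arithmetic. *)
Definition nrm (V : normedZmodType R[i]) (v : V) : R := complex.Re `|v|.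

Lemma nrmE (V : normedZmodType R[i]) (v : V) : `|v| = (nrm v)%:C.
Proof. by rewrite /nrm RRe_real // ger0_real. Qed.

Lemma nrm_ge0 (V : normedZmodType R[i]) (v : V) : 0 <= nrm v.
Proof. by rewrite -lecR -nrmE normr_ge0. Qed.

Lemma nrm0 (V : normedZmodType R[i]) : nrm (0 : V) = 0.
Proof. by apply: (@complexI R); rewrite -nrmE normr0. Qed.

Lemma nrm_eq0 (V : normedZmodType R[i]) (v : V) : nrm v = 0 -> v = 0.
Proof. by move=> v0; apply/eqP; rewrite -normr_eq0 nrmE v0. Qed.

Lemma nrmN (V : normedZmodType R[i]) (v : V) : nrm (- v) = nrm v.
Proof. by rewrite /nrm normrN. Qed.

Lemma nrmBC (V : normedZmodType R[i]) (v w : V) : nrm (v - w) = nrm (w - v).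
Proof. by rewrite -nrmN opprB. Qed.

Lemma nrmD (V : normedZmodType R[i]) (v w : V) : nrm (v + w) <= nrm v + nrm w.
Proof. by rewrite -lecR rmorphD /= -!nrmE ler_normD. Qed.

Lemma nrm_dist_triangle (V : normedZmodType R[i]) (u v w : V) :
  nrm (v - w) <= nrm (v - u) + nrm (u - w).
Proof. by rewrite -[v in v - w](subrK u) -addrA nrmD. Qed.

Lemma nrm_sum (V : normedZmodType R[i]) I (r : seq I) (P : pred I) (F : I -> V) :
  nrm (\sum_(i <- r | P i) F i) <= \sum_(i <- r | P i) nrm (F i).
Proof.
elim/big_ind2 : _ => //; first by rewrite nrm0.
by move=> a b c d ab cd; apply: le_trans (nrmD _ _) _; apply: lerD.
Qed.

Lemma nrmZ (V : normedModType R[i]) (k : R[i]) (v : V) :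
  nrm (k *: v) = nrm k * nrm v.
Proof. by apply: (@complexI R); rewrite rmorphM /= -!nrmE normrZ. Qed.

Lemma nrmM (z w : R[i]) : nrm (z * w) = nrm z * nrm w.
Proof. by apply: (@complexI R); rewrite rmorphM /= -!nrmE normrM. Qed.

Lemma nrm_real (x : R) : nrm x%:C = `|x|.
Proof. by apply: (@complexI R); rewrite -nrmE normc_def /= expr0n addr0 sqrtr_sqr. Qed.

Lemma nrm1 : nrm (1 : R[i]) = 1.
Proof. by rewrite -[1 : R[i]]/(1%:C) nrm_real normr1. Qed.

Lemma nrm_conj (z : R[i]) : nrm z^* = nrm z.
Proof. by rewrite /nrm normcJ. Qed.

Lemma mul_conj (z : R[i]) : z^* * z = (nrm z ^+ 2)%:C.
Proof. by rewrite rmorphXn /= -nrmE sqr_normc mulrC. Qed.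

Lemma Re_le_nrm (z : R[i]) : `|complex.Re z| <= nrm z.
Proof. by rewrite -lecR -nrmE normc_ge_Re. Qed.

Lemma nrm_le_ReIm (z : R[i]) : nrm z <= `|complex.Re z| + `|complex.Im z|.
Proof.
rewrite [z in nrm z]complexE; apply: le_trans (nrmD _ _) _.
rewrite nrmM !nrm_real lerD2l -[leRHS]mul1r ler_wpM2r //.
by rewrite /nrm normc_def /= expr0n expr1n add0r sqrtr1.
Qed.

Lemma Im_le_nrm (z : R[i]) : `|complex.Im z| <= nrm z.
Proof.
rewrite -normrN -ReiNIm; apply: le_trans (Re_le_nrm _) _; rewrite nrmM.
suff -> : nrm ('i : R[i]) = 1 by rewrite mulr1.
by rewrite /nrm normc_def /= expr0n expr1n add0r sqrtr1.
Qed.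

(** Positive elements of [R[i]] are real, so that the tolerances in the
    definitions of limits and of the structure may be taken in [R]. *)
Lemma positive_complex (e : R[i]) : 0 < e -> exists2 d : R, 0 < d & e = d%:C.
Proof.
move=> e0; exists (complex.Re e); last by rewrite RRe_real // gtr0_real.
by rewrite -ltcR RRe_real // gtr0_real.
Qed.

Lemma cvg_nrmP (V : pseudoMetricNormedZmodType R[i]) (F : set_system V)
    (FF : Filter F) (v : V) :
  F --> v <-> forall e : R, 0 < e -> \forall w \near F, nrm (v - w) < e.
Proof.
split=> [/cvgrPdist_lt Fv e e0|Fv].
  have e0C : 0 < e%:C :> R[i] by rewrite ltcR.
  by apply: filterS (Fv _ e0C) => w; rewrite nrmE ltcR.
apply/cvgrPdist_lt => _ /positive_complex[e e0 ->].
by apply: filterS (Fv _ e0) => w; rewrite nrmE ltcR.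
Qed.

Lemma continuous_nrmP (T : topologicalType) (V : pseudoMetricNormedZmodType R[i])
    (f : T -> V) (x : T) :
  {for x, continuous f} <->
  forall e : R, 0 < e -> \forall y \near x, nrm (f x - f y) < e.
Proof.
rewrite /continuous_at; split=> [/cvg_nrmP h e e0|h]; first exact: (h e e0).
by apply/cvg_nrmP => e e0; exact: (h e e0).
Qed.

Lemma closure_nrmP (V : pseudoMetricNormedZmodType R[i]) (M : set V) (v : V) :
  closure M v <-> forall e : R, 0 < e -> exists2 w, M w & nrm (v - w) < e.
Proof.
split=> [Mv e e0|Mv].
  have e0C : 0 < e%:C :> R[i] by rewrite ltcR.
  have [w [Mw]] := Mv _ (nbhsx_ballx v _ e0C).
  by rewrite -ball_normE /= nrmE ltcR; exists w.
move=> B /nbhs_ballP[_ /positive_complex[e e0 ->] eB].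
have [w Mw vw] := Mv e e0; exists w; split => //; apply: eB.
by rewrite -ball_normE /= nrmE ltcR.
Qed.

Lemma closed_nrmP (V : pseudoMetricNormedZmodType R[i]) (M : set V) (v : V) :
  closed M -> (forall e : R, 0 < e -> exists2 w, M w & nrm (v - w) < e) -> M v.
Proof. by move=> cM h; apply: cM; apply/closure_nrmP. Qed.

(** Completeness of [R[i]], through real and imaginary parts.  It is stated for
    an image filter because the filter of approximations of an element of the
    algebra lives on functions. *)
Lemma complex_cauchy (I : Type) (F : set_system I) (FF : ProperFilter F)
    (f : I -> (R[i])^o) :
  (forall e : R, 0 < e -> exists z, \forall i \near F, nrm (z - f i) < e) ->
  exists l : (R[i])^o, f @ F --> l.
Proof.
move=> hf.
have cR (p : R[i] -> R) : (forall z w, `|p z - p w| <= nrm (z - w)) ->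
    cvg ((p \o f) @ F).
  move=> hp; apply: cauchy_cvg; apply: cauchy_exP => e e0.
  have [z hz] := hf e e0; exists (p z).
  rewrite /fmap /=; apply: filterS hz => i /=; rewrite -ball_normE /=.
  by apply: le_lt_trans; exact: hp.
have hRe z w : `|complex.Re z - complex.Re w| <= nrm (z - w).
  apply: le_trans (Re_le_nrm (z - w)); by case: z w => [? ?] [? ?].
have hIm z w : `|complex.Im z - complex.Im w| <= nrm (z - w).
  apply: le_trans (Im_le_nrm (z - w)); by case: z w => [? ?] [? ?].
have /cvg_ex[/= a ha] := cR _ hRe; have /cvg_ex[/= b hb] := cR _ hIm.
exists (a +i* b); apply/cvg_nrmP => e e0.
have e20 : 0 < e / 2 by rewrite divr_gt0.
move/cvgrPdist_lt : ha => /(_ _ e20) ha; move/cvgrPdist_lt : hb => /(_ _ e20) hb.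
change (\forall i \near F, nrm ((a +i* b) - f i) < e).
apply: filterS2 ha hb => i /= ha hb.
apply: le_lt_trans (nrm_le_ReIm _) _; rewrite [e]splitr.
have -> : complex.Re (a +i* b - f i) = a - complex.Re (f i) by case: (f i).
have -> : complex.Im (a +i* b - f i) = b - complex.Im (f i) by case: (f i).
exact: ltrD.
Qed.

End real_norm.

(** * Algebra in a groupoid *)

Section groupoid_algebra.
Variable G : etale_groupoid.
Implicit Types x y z u : G.
Local Notation r := (@eg_r G).
Local Notation s := (@eg_s G).
Local Notation inv := (@eg_inv G).
Local Notation "x ** y" := (@eg_mul G x y) (at level 40, left associativity).

Lemma unit_r u : units G u -> r u = u.
Proof. by case=> x _ <-; rewrite eg_rr. Qed.

Lemma unit_s u : units G u -> s u = u.
Proof. by case=> x _ <-; rewrite eg_sr. Qed.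

Lemma units_r x : units G (r x). Proof. by exists x. Qed.

Lemma units_s x : units G (s x). Proof. by rewrite -eg_rs; exact: units_r. Qed.

Lemma inv_invK x : inv (inv x) = x.
Proof.
rewrite -[LHS]eg_mul_s eg_s_inv eg_r_inv -eg_inv_mul.
by rewrite eg_mulA ?eg_s_inv ?eg_r_inv// eg_inv_mul eg_s_inv eg_mul_r.
Qed.

Lemma mulVK x y : s x = r y -> inv x ** (x ** y) = y.
Proof.
by move=> xy; rewrite eg_mulA ?eg_s_inv// eg_inv_mul xy eg_mul_r.
Qed.

Lemma mulKV x y : r x = r y -> x ** (inv x ** y) = y.
Proof.
by move=> xy; rewrite eg_mulA ?eg_r_inv ?eg_s_inv// eg_mul_inv xy eg_mul_r.
Qed.

Lemma mulK x y : s x = r y -> (x ** y) ** inv y = x.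
Proof.
by move=> xy; rewrite -eg_mulA ?eg_r_inv// eg_mul_inv -xy eg_mul_s.
Qed.

Lemma mulVKr x y : s x = s y -> (x ** inv y) ** y = x.
Proof.
by move=> xy; rewrite -eg_mulA ?eg_r_inv ?eg_s_inv// eg_inv_mul -xy eg_mul_s.
Qed.

Lemma unit_inv u : units G u -> inv u = u.
Proof.
move=> uu; rewrite -[LHS]eg_mul_s eg_s_inv (unit_r uu).
by rewrite eg_inv_mul (unit_s uu).
Qed.

Lemma inv_mul x y : s x = r y -> inv (x ** y) = inv y ** inv x.
Proof.
move=> xy; have e : s (inv y) = r (inv x) by rewrite eg_s_inv eg_r_inv.
rewrite -[RHS](@mulVK (x ** y)) ?eg_s_mul ?eg_r_mul ?eg_s_inv ?eg_r_inv//.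
have -> : (x ** y) ** (inv y ** inv x) = r x.
  by rewrite eg_mulA ?eg_s_mul ?eg_s_inv ?eg_r_inv// mulK// eg_mul_inv.
by rewrite -[in LHS](eg_mul_s (inv _)) eg_s_inv eg_r_mul.
Qed.

Lemma r_mulV x y : s x = s y -> r (x ** inv y) = r x.
Proof. by move=> xy; rewrite eg_r_mul ?eg_r_inv. Qed.

Lemma s_mulV x y : s x = s y -> s (x ** inv y) = r y.
Proof. by move=> xy; rewrite eg_s_mul ?eg_r_inv ?eg_s_inv. Qed.

Lemma mulV_unit x y : s x = s y -> units G (x ** inv y) -> x = y.
Proof.
move=> xy uxy; rewrite -(mulVKr xy) -[in RHS](eg_mul_r y); congr (_ ** _).
by rewrite -(unit_s uxy) s_mulV.
Qed.

End groupoid_algebra.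

(** * Topology of an etale groupoid *)

(** If no finite family of the given neighbourhoods covered [K], the complements of
    the finite unions would generate a proper filter on [K]; a cluster point of
    this filter contradicts its own neighbourhood. *)
Lemma compact_finite_cover (T : topologicalType) (K : set T) (U : T -> set T) :
  compact K -> (forall x, K x -> nbhs x (U x)) ->
  exists l : seq T, (forall x, x \in l -> K x) /\
    forall y, K y -> exists2 x, x \in l & U x y.
Proof.
move=> cK hU; apply: contrapT => nl.
pose B (l : seq T) := K `\` [set y | exists2 x, x \in l & U x y].
pose D := [set l : seq T | forall x, x \in l -> K x].
have FF : ProperFilter (filter_from D B).
  apply: filter_from_proper; first apply: filter_from_filter.
  - by exists [::].
  - move=> l m lK mK; exists (l ++ m) => [x|y [Ky h]].
      by rewrite mem_cat => /orP[/lK|/mK].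
    by split; (split=> // -[x xl Uxy]; apply: h; exists x => //);
       rewrite mem_cat xl ?orbT.
  move=> l lK; apply/set0P/negP => /eqP B0; apply: nl; exists l; split=> // y Ky.
  apply: contrapT => h; have : B l y by split.
  by rewrite B0.
have FK : filter_from D B K by exists [::] => // y [].
have [x [Kx clx]] := cK _ FF FK.
have FB : filter_from D B (B [:: x]).
  by exists [:: x] => // y; rewrite inE => /eqP ->.
have [y [[Ky nUy] Uy]] := clx _ _ FB (hU x Kx).
by apply: nUy; exists x => //; exact: mem_head.
Qed.

Section local_homeo_theory.
Variables (X : topologicalType) (f : X -> X) (Y : set X).
Hypothesis hf : local_homeo f Y.

Lemma local_homeo_continuous : continuous f.
Proof.
move=> x; have [U [oU Ux _ cU _]] := hf x.
by have := continuous_open_subspace f oU; rewrite propeqE => -[/(_ cU x (mem_set Ux)) ? _].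
Qed.

Lemma local_homeo_open (W : set X) : open Y -> open W -> open (f @` W).
Proof.
move=> oY oW; rewrite openE => _ [x Wx <-].
have [U [oU Ux _ _ h]] := hf x.
have [V oV eV] := h _ (openI oW oU) (@subIsetr _ _ _).
have : (V `&` Y) (f x) by rewrite -eV; exists x.
have sub : V `&` Y `<=` f @` W by rewrite -eV => _ [y [Wy _] <-]; exists y.
by move=> VYx; apply: (filterS sub); apply: open_nbhs_nbhs; split=> //; exact: openI.
Qed.

End local_homeo_theory.

Section groupoid_topology.
Variable G : etale_groupoid.
Implicit Types x y z u : G.
Local Notation r := (@eg_r G).
Local Notation s := (@eg_s G).
Local Notation inv := (@eg_inv G).
Local Notation "x ** y" := (@eg_mul G x y) (at level 40, left associativity).

Lemma r_continuous : continuous r.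
Proof. exact: local_homeo_continuous (@eg_r_local_homeo G). Qed.

Lemma s_continuous : continuous s.
Proof. exact: local_homeo_continuous (@eg_s_local_homeo G). Qed.

(** Near a unit [u] the range map is injective; if [x] and [r x] are both close
    to [u], then [r (r x) = r x] forces [x = r x]. *)
Lemma open_units : open (units G).
Proof.
rewrite openE => u uu.
have [U [oU Uu injU _ _]] := eg_r_local_homeo u.
have nU : nbhs u (U `&` r @^-1` U).
  apply: filterI; first exact: open_nbhs_nbhs.
  have /(_ U) := @r_continuous u; apply.
  by rewrite (unit_r uu); exact: open_nbhs_nbhs.
apply: filterS nU => x [Ux Urx]; exists x => //.
by apply: injU; rewrite ?inE ?eg_rr.
Qed.

Lemma closed_eq_fun (T : topologicalType) (f g : T -> G) :
  continuous f -> continuous g -> closed [set x | f x = g x].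
Proof.
move=> cf cg x clx; apply: (@eg_hausdorff G) => A B Afx Bgx.
have nx : nbhs x (f @^-1` A `&` g @^-1` B).
  by apply: filterI; [exact: cf|exact: cg].
have [y [/= e [Ay By]]] := clx _ nx.
by exists (f y); split=> //; rewrite e.
Qed.

Lemma closed_units : closed (units G).
Proof.
have -> : units G = [set x | r x = x].
  by apply/seteqP; split=> [x /unit_r//|x /= <-]; exact: units_r.
by apply: (@closed_eq_fun _ r id); [exact: r_continuous|move=> x; exact: cvg_id].
Qed.

Lemma open_s (W : set G) : open W -> open (s @` W).
Proof. exact: local_homeo_open (@eg_s_local_homeo G) _ open_units. Qed.

Definition bisection (S : set G) := [/\ open S,
  forall x y, S x -> S y -> s x = s y -> x = y &
  forall x y, S x -> S y -> r x = r y -> x = y].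

Lemma ex_bisection x : exists2 S, bisection S & S x.
Proof.
have [U [oU Ux injU _ _]] := eg_r_local_homeo x.
have [V [oV Vx injV _ _]] := eg_s_local_homeo x.
exists (U `&` V) => //; split; first exact: openI.
- by move=> y z [_ Vy] [_ Vz]; apply: injV; rewrite inE.
- by move=> y z [Uy _] [Uz _]; apply: injU; rewrite inE.
Qed.

Lemma bisection_units : bisection (units G).
Proof.
split; first exact: open_units.
- by move=> x y /unit_s hx /unit_s hy; rewrite hx hy.
- by move=> x y /unit_r hx /unit_r hy; rewrite hx hy.
Qed.

Lemma compact_bisections (K : set G) : compact K ->
  exists l : seq (set G), (forall S, S \in l -> bisection S) /\
    forall x, K x -> exists2 S, S \in l & S x.
Proof.
move=> cK; have /choice[U hU] : forall x, exists S, bisection S /\ S x.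
  by move=> x; have [S] := ex_bisection x; exists S.
have [|l [lK Kl]] := compact_finite_cover (U := U) cK.
  by move=> x _; apply: open_nbhs_nbhs; have [[]] := hU x.
exists (map U l); split=> [S /mapP[x _ ->]|x /Kl[y yl Uyx]].
  by case: (hU x).
by exists (U y) => //; exact: map_f.
Qed.

(** A bisection meets a fibre at most once and finitely many bisections cover a
    compact set; [f] stands for the source or the range map. *)
Lemma finite_fiber (f : G -> G) (K : set G) u :
  (forall S, bisection S -> forall x y, S x -> S y -> f x = f y -> x = y) ->
  compact K -> finite_set (K `&` [set x | f x = u]).
Proof.
move=> finj /compact_bisections[l [lb Kl]].
elim: l K lb Kl => [|S l IH] K lb Kl.
  by rewrite (_ : _ `&` _ = set0)// -subset0 => x [/Kl[]].
apply: (@sub_finite_set _ _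
  ((S `&` [set x | f x = u]) `|` ((K `\` S) `&` [set x | f x = u]))).
  by move=> x [Kx fx]; have [Sx|nSx] := pselect (S x); [left|right].
rewrite finite_setU; split; last first.
  apply: IH => [T Tl|x [Kx nSx]]; first by apply: lb; rewrite inE Tl orbT.
  by have [T] := Kl x Kx; rewrite inE => /orP[/eqP -> //|Tl Tx]; exists T.
have [[x [Sx fx]]|h] := pselect (exists x, S x /\ f x = u).
  apply: (@sub_finite_set _ _ [set x]) => // y [Sy fy] /=.
  by apply: (finj S) => //; [exact/lb/mem_head|rewrite fx fy].
by rewrite (_ : _ `&` _ = set0)// -subset0 => y [Sy fy]; apply: h; exists y.
Qed.

Lemma finite_s_fiber (K : set G) u : compact K -> finite_set (K `&` s_fiber u).
Proof. by apply: finite_fiber => S []. Qed.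

Lemma finite_r_fiber (K : set G) u : compact K -> finite_set (K `&` r_fiber u).
Proof. by apply: finite_fiber => S []. Qed.

(** The inverse of the source map on a bisection [S]; its value is arbitrary off
    the sources of [S]. *)
Definition section_at (S : set G) u : G := xget u [set y | S y /\ s y = u].

Lemma section_atP (S : set G) u : (s @` S) u -> S (section_at S u) /\ s (section_at S u) = u.
Proof. by case=> x Sx sx; rewrite /section_at; case: xgetP => [_ _ //|/(_ x)[]]. Qed.

Lemma section_at_s (S : set G) x : bisection S -> S x -> section_at S (s x) = x.
Proof.
move=> [_ inj _] Sx; have [|Sy sy] := @section_atP S (s x); first by exists x.
exact: inj.
Qed.

Lemma section_at_continuous (S : set G) x : bisection S -> S x ->
  section_at S @ (s x) --> x.
Proof.
move=> bS Sx B; rewrite nbhsE => -[W [oW Wx] WB].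
have oS := let: And3 oS _ _ := bS in oS.
apply: filterS (_ : nbhs (s x) (s @` (W `&` S))).
  by move=> _ [y [Wy Sy] <-] /=; rewrite section_at_s//; exact: WB.
apply: open_nbhs_nbhs; split; first by apply: open_s; exact: openI.
by exists x.
Qed.

Lemma mul_cvg (I : Type) (F : set_system I) (FF : Filter F) (f g : I -> G) x y :
  f @ F --> x -> g @ F --> y -> s x = r y ->
  (\forall i \near F, s (f i) = r (g i)) ->
  (fun i => f i ** g i) @ F --> x ** y.
Proof.
move=> fx gy xy fg.
have /subspace_continuousP cm := @eg_mul_continuous G.
have := cm (x, y) xy => /= {}cm B /cm Bxy.
have cfg : (fun i => (f i, g i)) @ F --> (x, y) by exact: cvg_pair.
have h : \forall p \near (x, y), s p.1 = r p.2 -> B (p.1 ** p.2) by exact: Bxy.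
have {}h : \forall i \near F, s (f i) = r (g i) -> B (f i ** g i) := cfg _ h.
change (\forall i \near F, B (f i ** g i)).
by apply: filterS2 h fg => i hi fgi; exact: hi.
Qed.

Lemma compact_mul (K L : set G) : compact K -> compact L ->
  compact [set z | exists x y, [/\ K x, L y, s x = r y & z = x ** y]].
Proof.
move=> cK cL.
pose D := [set p : G * G | s p.1 = r p.2].
have cD : closed D.
  apply: closed_eq_fun => p.
    by apply: (@continuous_comp _ _ _ fst s); [exact: cvg_fst|exact: s_continuous].
  by apply: (@continuous_comp _ _ _ snd r); [exact: cvg_snd|exact: r_continuous].
have cKL : compact (K `*` L `&` D) by apply: compact_closedI => //; exact: compact_setX.
have -> : [set z | exists x y, [/\ K x, L y, s x = r y & z = x ** y]] =
    (fun p : G * G => p.1 ** p.2) @` (K `*` L `&` D).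
  apply/seteqP; split=> [_ [x [y [Kx Ly xy ->]]]|_ [[x y] [[/= Kx Ly] xy] <-]].
    by exists (x, y).
  by exists x, y.
apply: continuous_compact cKL.
exact: continuous_subspaceW (@subIsetr _ _ _) (@eg_mul_continuous G).
Qed.

End groupoid_topology.

(** * Compactly supported functions *)

Section Cc_theory.
Variable G : etale_groupoid.
Implicit Types (P Q L S : set G).

(** The carrier [R[i]] has no topology of its own: this alias forces continuity to
    refer to the topology of a [numFieldType], as in the definition of C_c. *)
Definition Kcontinuous (K : numFieldType) (T : topologicalType) (f : T -> K) :=
  continuous f.

(** Testing the support through some compact set avoids closures. *)
Lemma CcP (K : numFieldType) P (f : G -> K) :
  Cc P f <-> Kcontinuous f /\
    exists L, [/\ compact L, L `<=` P & forall x, f x != 0 -> L x].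
Proof.
split=> [[cf kf fP]|[cf [L [cL LP fL]]]].
  split=> //; exists (closure [set x | f x != 0]); split=> // x fx.
  exact: subset_closure.
have sub : closure [set x | f x != 0] `<=` L.
  by move=> x /(closureS fL) /(compact_closed (@eg_hausdorff G) cL).
split=> //; last exact: subset_trans LP.
by apply: subclosed_compact sub => //; exact: closed_closure.
Qed.

Lemma Cc_continuous (K : numFieldType) P (f : G -> K) : Cc P f -> Kcontinuous f.
Proof. by case. Qed.

Lemma Cc0 (K : numFieldType) P : Cc P (fun=> 0 : K).
Proof.
apply/CcP; split; first by move=> x; exact: cvg_cst.
by exists set0; split=> //; [exact: compact0|move=> x; rewrite eqxx].
Qed.

Lemma Cc_sub (K : numFieldType) P Q (f : G -> K) :
  P `<=` Q -> Cc P f -> Cc Q f.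
Proof. by move=> PQ [? ? h]; split=> //; exact: subset_trans PQ. Qed.

Lemma CcD (K : numFieldType) P (f g : G -> K) :
  Cc P f -> Cc P g -> Cc P (fun x => f x + g x).
Proof.
move=> /CcP[cf [L [cL LP fL]]] /CcP[cg [M [cM MP gM]]]; apply/CcP; split.
  by move=> x; apply: cvgD; [exact: cf|exact: cg].
exists (L `|` M); split; first exact: compactU.
  by move=> x [/LP|/MP].
move=> x; have [->|f0 _] := eqVneq (f x) 0; last by left; exact: fL.
by rewrite add0r; right; exact: gM.
Qed.

Lemma CcMr (K : numFieldType) P Q (f g : G -> K) : Kcontinuous g ->
  (forall x, g x != 0 -> Q x) -> closed Q -> Cc P f -> Cc (P `&` Q) (fun x => f x * g x).
Proof.
move=> cg gQ cQ /CcP[cf [L [cL LP fL]]]; apply/CcP; split.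
  by move=> x; apply: cvgM; [exact: cf|exact: cg].
exists (L `&` Q); split; first exact: compact_closedI.
  by move=> x [/LP Px Qx].
by move=> x; rewrite mulf_eq0 negb_or => /andP[/fL Lx /gQ Qx].
Qed.

Lemma CcM (K : numFieldType) P (f g : G -> K) : Kcontinuous g ->
  Cc P f -> Cc P (fun x => f x * g x).
Proof.
move=> cg Pf; apply: Cc_sub (@CcMr K P setT f g cg _ _ Pf) => //.
Qed.

Lemma CcZ (K : numFieldType) P (k : K) (f : G -> K) :
  Cc P f -> Cc P (fun x => k * f x).
Proof.
move=> Pf; rewrite (_ : (fun x => _) = (fun x => f x * k)); last first.
  by apply/funext => x; rewrite mulrC.
by apply: CcM => // x; exact: cvg_cst.
Qed.

Lemma CcB (K : numFieldType) P (f g : G -> K) :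
  Cc P f -> Cc P g -> Cc P (fun x => f x - g x).
Proof.
move=> Pf Pg; rewrite (_ : (fun x => _) = (fun x => f x + (-1) * g x)); last first.
  by apply/funext => x; rewrite mulN1r.
by apply: CcD => //; exact: CcZ.
Qed.

Variable R : realType.

Lemma max_continuous (T : topologicalType) (f g : T -> R) :
  continuous f -> continuous g -> continuous (fun x => Num.max (f x) (g x)).
Proof.
move=> cf cg.
have -> : (fun x => Num.max (f x) (g x)) =
    (fun x => (f x + g x + `|f x - g x|) / 2).
  by apply/funext => x; case: (lerP (f x) (g x)) => h; lra.
move=> x; apply: cvgM; last exact: cvg_cst.
apply: cvgD; first by apply: cvgD; [exact: cf|exact: cg].
by apply: cvg_norm; apply: cvgB; [exact: cf|exact: cg].
Qed.

Lemma min_continuous (T : topologicalType) (f g : T -> R) :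
  continuous f -> continuous g -> continuous (fun x => Num.min (f x) (g x)).
Proof.
move=> cf cg.
have -> : (fun x => Num.min (f x) (g x)) =
    (fun x => - Num.max (- f x) (- g x)).
  by apply/funext => x; rewrite oppr_max !opprK.
have cN (h : T -> R) : continuous h -> continuous (fun x => - h x).
  by move=> ch x; apply: cvgN; exact: ch.
by apply: (cN); apply: max_continuous; exact: cN.
Qed.

(** A locally compact Hausdorff space is completely regular, and the separating
    function is cut to vanish outside a compact neighbourhood and to be locally
    constant at the point; being equal to 1 near the point is what makes
    the subtractive splitting in [Cc_ind] terminate. *)
Lemma ex_bump P x : open P -> P x -> exists phi : G -> R,
  [/\ Cc P phi, forall y, 0 <= phi y <= 1 & \forall y \near x, phi y = 1].
Proof.
move=> oP Px.
have [U nU [cU clU]] := @eg_locally_compact G x I.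
rewrite /within /= in nU.
have {}nU : nbhs x U by apply: filterS nU => y; exact.
pose P' := P `&` U^°.
have oP' : open P' by apply: openI => //; exact: open_interior.
have := @locally_compact_completely_regular G R (@eg_locally_compact G)
  (@eg_hausdorff G) x (~` P') (open_closedC oP').
case; first by apply; split.
move=> uT uTP.
have /(@uniform_separatorP _ R)[f [cf f01 fx fP]] :
  uniform_separator [set x] (~` P') by exists uT.
have fx0 : f x = 0 by apply: fx; exists x.
have f1 y : ~ P' y -> f y = 1 by move=> h; apply: fP; exists y.
(* [f] vanishes at [x] and is 1 off [P']: [phi] is 1 where [f <= 1/3] and 0 where
   [f >= 2/3]. *)
pose phi y := Num.min 1 (Num.max 0 (2 - 3 * f y)).
have cphi : continuous phi.
  have c1 : continuous (fun y => 2 - 3 * f y).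
    move=> y; apply: cvgB; first exact: cvg_cst.
    by apply: cvgM; [exact: cvg_cst|exact: cf].
  have c2 : continuous (fun y : G => Num.max 0 (2 - 3 * f y)).
    by apply: max_continuous => // y; exact: cvg_cst.
  by apply: min_continuous => // y; exact: cvg_cst.
exists phi; split.
- apply/CcP; split=> //; exists (U `&` [set y | f y <= 2/3]); split.
  + apply: compact_closedI => //.
    rewrite (_ : [set y | _] = f @^-1` [set z | z <= 2/3])//.
    by apply: closed_comp => // y _; exact: cf.
  + move=> y [Uy fy]; have [[]//|/f1 fy1] := pselect (P' y).
    by move: fy; rewrite /= fy1; lra.
  + move=> y phiy; have fy : f y <= 2/3.
      rewrite leNgt; apply/negP => h; move/eqP : phiy; apply.
      by rewrite /phi max_l ?min_r//; lra.
    split=> //; have [[_ /interior_subset//]|/f1 fy1] := pselect (P' y).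
    by move: fy; rewrite fy1; lra.
- by move=> y; rewrite /phi ge_min lexx /= le_min ler01 le_max lexx.
- have /cvgrPdist_lt/(_ (1/3)) := cf x; rewrite fx0 => h.
  have {}h : \forall y \near x, `|0 - f y| < 1/3 by apply: h; lra.
  apply: filterS h => y; rewrite sub0r normrN ltr_norml => /andP[h1 h2].
  by rewrite /phi min_l// le_max; apply/orP; right; lra.
Qed.

Lemma Cc_max P (phi psi : G -> R) : Cc P phi -> Cc P psi ->
  Cc P (fun x => Num.max (phi x) (psi x)).
Proof.
move=> /CcP[c1 [L1 [k1 s1 p1]]] /CcP[c2 [L2 [k2 s2 p2]]].
apply/CcP; split; first exact: max_continuous.
exists (L1 `|` L2); split; first exact: compactU.
  by move=> x [/s1|/s2].
move=> x; case: (lerP (phi x) (psi x)) => _ h; first by right; exact: p2.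
by left; exact: p1.
Qed.

Lemma real_continuous (T : topologicalType) (phi : T -> R) :
  continuous phi -> Kcontinuous (fun x => (phi x)%:C : R[i]).
Proof.
move=> cphi x; apply/(continuous_nrmP (V := (R[i])^o)) => e e0.
move/cvgrPdist_lt : (cphi x) => /(_ e e0); apply: filterS => y.
by rewrite -rmorphB /= nrm_real.
Qed.

Lemma Cc_real P (phi : G -> R) : Cc P phi -> Cc P (fun x => (phi x)%:C : R[i]).
Proof.
move=> /CcP[c [L [cL LP fL]]]; apply/CcP; split; first exact: real_continuous.
exists L; split=> // x h; apply: fL; apply: contra_neq h => ->; exact: rmorph0.
Qed.

Lemma compact_bump P L : open P -> compact L -> L `<=` P ->
  exists phi : G -> R,
  [/\ Cc P phi, forall y, 0 <= phi y <= 1 & forall y, L y -> phi y = 1].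
Proof.
move=> oP cL LP.
have /choice[U hU] : forall x, exists U : set G, P x -> nbhs x U /\
    exists phi : G -> R,
    [/\ Cc P phi, forall y, 0 <= phi y <= 1 & forall y, U y -> phi y = 1].
  move=> x; have [Px|nPx] := pselect (P x); last by exists setT.
  have [phi [h1 h2 h3]] := ex_bump oP Px.
  by exists [set y | phi y = 1] => _; split=> //; exists phi.
have [x /LP/hU[]//|l [lL Ll]] := compact_finite_cover (U := U) cL.
suff [phi [h1 h2 h3]] : exists phi : G -> R, [/\ Cc P phi,
    forall y, 0 <= phi y <= 1 &
    forall x y, x \in l -> U x y -> phi y = 1].
  by exists phi; split=> // y /Ll[x xl Uxy]; exact: h3 Uxy.
elim: l lL {Ll} => [_|x l IH lL].
  by exists (fun=> 0); split=> //; [exact: Cc0|move=> y; rewrite lexx ler01].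
have [|phi [h1 h2 h3]] := IH; first by move=> y yl; apply: lL; rewrite inE yl orbT.
have [_ [psi [k1 k2 k3]]] := hU x (LP _ (lL x (mem_head _ _))).
exists (fun y => Num.max (phi y) (psi y)); split.
- exact: Cc_max.
- move=> y; have /andP[a b] := h2 y; have /andP[c d] := k2 y.
  by rewrite le_max a /= ge_max b d.
- move=> z y; rewrite inE => /orP[/eqP ->|zl] Uy.
    by rewrite (k3 y Uy) max_r//; have /andP[] := h2 y.
  by rewrite (h3 _ _ zl Uy) max_l//; have /andP[] := k2 y.
Qed.

(** Partitions of unity in the form of an induction principle.  With bump functions
    [phi] equal to 1 near finitely many points covering the support, split
    [f = f phi + f (1 - phi)]: the first term lives in a member of the cover, and
    one bump function fewer is needed for the second. *)
Lemma Cc_ind P (I : Type) (S : I -> set G) (Q : (G -> R[i]) -> Prop) :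
  (forall i, open (S i)) -> (forall x, P x -> exists i, S i x) ->
  Q (fun=> 0) ->
  (forall f g, Cc P f -> Cc P g -> Q f -> Q g -> Q (fun x => f x + g x)) ->
  (forall i f, Cc (P `&` S i) f -> Q f) ->
  forall f, Cc P f -> Q f.
Proof.
move=> oS PS Q0 QD QS f /CcP[cf [L [cL LP fL]]].
have /choice[U hU] : forall x, exists U : set G, P x -> nbhs x U /\
    exists i, exists phi : G -> R,
    [/\ Cc (S i) phi & forall y, U y -> phi y = 1].
  move=> x; have [/PS[i Six]|nPx] := pselect (P x); last by exists setT.
  have [phi [h1 h2 h3]] := ex_bump (oS i) Six.
  by exists [set y | phi y = 1] => _; split=> //; exists i, phi.
have [x /LP/hU[]//|l [lL Ll]] := compact_finite_cover (U := U) cL.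
have {cL}: Cc P f by apply/CcP; split=> //; exists L.
have lP : forall x, x \in l -> P x by move=> x /lL/LP.
have {lL LP fL Ll}: forall y, f y != 0 -> exists2 x, x \in l & U x y.
  by move=> y /fL/Ll.
elim: l f cf lP => [|x l IH] f cf lP fl Pf.
  rewrite (_ : f = fun=> 0)//; apply/funext => y; apply/eqP/negPn/negP.
  by move/fl => [].
have [_ [i [phi [Pphi phi1]]]] := hU x (lP x (mem_head _ _)).
have cphi := real_continuous (Cc_continuous Pphi).
have -> : f = fun y => f y * (phi y)%:C + (f y - f y * (phi y)%:C).
  by apply/funext => y; rewrite addrC subrK.
have P1 : Cc P (fun y => f y * (phi y)%:C) by exact: CcM.
have P2 : Cc P (fun y => f y - f y * (phi y)%:C) by exact: CcB.
apply: QD => //.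
- apply: (QS i); move/CcP : Pphi => [_ [M [cM MS hM]]].
  apply: (@Cc_sub _ (P `&` M)); first by move=> z [Pz /MS].
  apply: CcMr => //; last exact: (compact_closed (@eg_hausdorff G)).
  move=> z hz; apply: hM; apply: contra_neq hz => ->; exact: rmorph0.
apply: (IH _ (Cc_continuous P2) _ _ P2).
- by move=> z zl; apply: lP; rewrite inE zl orbT.
- move=> z fz; have [|w] := fl z.
    by apply: contra_neq fz => ->; rewrite mul0r subrr.
  rewrite inE => /orP[/eqP -> Uz|wl Uz]; last by exists w.
  by move/eqP : fz; rewrite (phi1 z Uz) mulr1 subrr.
Qed.

(** The radial retraction onto 0 of the disc of radius [e]: it moves points by at
    most [e] and turns a function vanishing at infinity into a compactly
    supported one. *)
Definition soft_threshold (e : R) (z : R[i]) : R[i] := z * (1 - e / Num.max (nrm z) e)%:C.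

Lemma soft_threshold_dist e z : 0 < e -> nrm (z - soft_threshold e z) <= e.
Proof.
move=> e0; pose t := e / Num.max (nrm z) e.
rewrite /soft_threshold -[X in nrm (X - _)]mulr1 -mulrBr nrmM.
have -> : 1 - (1 - t)%:C = t%:C :> R[i].
  by rewrite rmorphB rmorph1 opprB addrC subrK.
rewrite nrm_real /t; have m0 : 0 < Num.max (nrm z) e by rewrite lt_max e0 orbT.
have t0 : 0 <= e / Num.max (nrm z) e by apply: divr_ge0; exact: ltW.
rewrite ger0_norm// mulrCA; apply: ler_piMr; first exact: ltW.
by rewrite ler_pdivrMr// mul1r le_max lexx.
Qed.

Lemma soft_threshold_eq0 e z : 0 < e -> nrm z <= e -> soft_threshold e z = 0.
Proof.
by move=> e0 ze; rewrite /soft_threshold max_r// divff ?gt_eqF// subrr rmorph0 mulr0.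
Qed.

Lemma nrm_continuous (T : topologicalType) (f : T -> R[i]) : Kcontinuous f ->
  continuous (fun x => nrm (f x)).
Proof.
move=> cf x; apply/cvgrPdist_lt => e e0.
have /(continuous_nrmP (V := (R[i])^o))/(_ e e0) := cf x.
apply: filterS => y /=; apply: le_lt_trans.
have h1 := nrm_dist_triangle (0 : R[i]) (f x) (f y); have := nrmD (f x - f y) (f y).
rewrite subrK => h2; have := nrmD (f y - f x) (f x); rewrite subrK => h3.
by rewrite nrmBC in h3; rewrite ler_norml; lra.
Qed.

Lemma soft_threshold_Cc P (f : G -> R[i]) e : 0 < e -> Kcontinuous f ->
  compact [set x | e <= nrm (f x)] -> [set x | e <= nrm (f x)] `<=` P ->
  Cc P (fun x => soft_threshold e (f x)).
Proof.
move=> e0 cf kf fP; apply/CcP; split.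
  have cn := nrm_continuous cf.
  move=> x; apply: cvgM; first exact: cf.
  move: x; apply: (@real_continuous _ (fun y => 1 - e / Num.max (nrm (f y)) e)).
  move=> x; apply: cvgB; first exact: cvg_cst.
  apply: cvgM; first exact: cvg_cst.
  apply: cvgV; first by rewrite gt_eqF// lt_max e0 orbT.
  by apply: max_continuous => // y; exact: cvg_cst.
exists [set x | e <= nrm (f x)]; split=> // x /=.
by rewrite leNgt; apply: contraNN => /ltW h; rewrite soft_threshold_eq0.
Qed.

End Cc_theory.

(** * Convolution *)

(** Sums over fibres are finitely supported sums over infinite sets; all of them
    are computed along a list containing the support. *)
Lemma fsum_seq (V : nmodType) (T : choiceType) (D : set T) (l : seq T) (F : T -> V) :
  uniq l -> (forall y, y \in l -> D y) ->
  (forall y, D y -> F y != 0 -> y \in l) ->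
  \sum_(y \in D) F y = \sum_(y <- l) F y.
Proof.
move=> ul lD Dl; rewrite (fsbigE l)//; last first.
  by move=> i Di; apply: contraNeq => /(Dl i Di) ->.
rewrite big_seq_cond [RHS]big_seq_cond; apply: eq_bigl => y.
by rewrite andbT; case: (boolP (y \in l)) => //= /lD Dy; rewrite mem_set.
Qed.

Lemma compact_image (T U : topologicalType) (f : T -> U) (A : set T) :
  continuous f -> compact A -> compact (f @` A).
Proof.
by move=> cf; apply: continuous_compact; exact: continuous_subspaceT.
Qed.

Section convolution_theory.
Variables (R : realType) (G : etale_groupoid).
Implicit Types (f g b : G -> R[i]) (x y z u : G) (S P Q L : set G).
Local Notation r := (@eg_r G).
Local Notation s := (@eg_s G).
Local Notation inv := (@eg_inv G).
Local Notation "x ** y" := (@eg_mul G x y) (at level 40, left associativity).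

Lemma involutionE f x : involution f x = (f (inv x))^*.
Proof. by []. Qed.

Lemma Cc_involution P f : Cc P f -> Cc (inv @^-1` P) (involution f).
Proof.
move=> /CcP[cf [L [cL LP fL]]]; apply/CcP; split.
  move=> x; apply/(continuous_nrmP (V := (R[i])^o)) => e e0.
  have /(continuous_nrmP (V := (R[i])^o))/(_ e e0) h := cf (inv x).
  have h' : \forall y \near x, nrm (f (inv x) - f (inv y)) < e :=
    @eg_inv_continuous G x _ h.
  apply: filterS h' => y /=.
  by rewrite !involutionE -rmorphB /= nrm_conj.
exists (inv @` L); split.
- exact: compact_image (@eg_inv_continuous G) cL.
- by move=> _ [y Ly <-] /=; rewrite inv_invK; exact: LP.
- move=> x; rewrite involutionE conjc_eq0 => /fL Lx.
  by exists (inv x) => //; rewrite inv_invK.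
Qed.

Lemma fiber_list L u : compact L ->
  exists l : seq G, [/\ uniq l, forall y, y \in l -> s y = u &
    forall y, s y = u -> L y -> y \in l].
Proof.
move=> /(finite_s_fiber u) fL; exists (enum_fset (fset_set (L `&` s_fiber u))).
split; first exact: fset_uniq.
  by move=> y /=; rewrite in_fset_set// inE => -[_].
by move=> y sy Ly /=; rewrite in_fset_set// inE.
Qed.

Lemma conv_seq f g x (l : seq G) : uniq l -> (forall y, y \in l -> s y = s x) ->
  (forall y, s y = s x -> f (x ** inv y) != 0 -> g y != 0 -> y \in l) ->
  convolution f g x = \sum_(y <- l) f (x ** inv y) * g y.
Proof.
move=> ul lx xl; apply: fsum_seq => // y sy.
by rewrite mulf_eq0 negb_or => /andP[]; exact: xl.
Qed.

(** At most one point of a source fibre lies in a bisection. *)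
Lemma conv_bisection S f g x y : bisection S -> (forall z, g z != 0 -> S z) ->
  S y -> s y = s x -> convolution f g x = f (x ** inv y) * g y.
Proof.
move=> [_ inj _] gS Sy sy; rewrite (@conv_seq f g x [:: y])//.
- by rewrite big_seq1.
- by move=> z; rewrite inE => /eqP ->.
- move=> z sz _ /gS Sz; rewrite inE; apply/eqP; apply: inj => //.
  by rewrite sz.
Qed.

Lemma conv_neq0 f g x : convolution f g x != 0 ->
  exists y, [/\ s y = s x, f (x ** inv y) != 0 & g y != 0].
Proof.
move=> h; apply: contrapT => ne; move/eqP : h; apply; apply: fsbig1 => y sy.
apply/eqP/negPn/negP; rewrite mulf_eq0 negb_or => /andP[fy gy].
by apply: ne; exists y.
Qed.

Lemma convDr P f g1 g2 : Cc P g1 -> Cc P g2 ->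
  convolution f (fun x => g1 x + g2 x) =
  (fun x => convolution f g1 x + convolution f g2 x).
Proof.
move=> /CcP[_ [L1 [cL1 _ h1]]] /CcP[_ [L2 [cL2 _ h2]]]; apply/funext => x.
have [l [ul lx xl]] := fiber_list (s x) (compactU cL1 cL2).
rewrite !(@conv_seq f _ x l)//.
- by rewrite -big_split; apply: eq_bigr => y _; rewrite mulrDr.
- by move=> y sy _ /h2 ?; apply: xl => //; right.
- by move=> y sy _ /h1 ?; apply: xl => //; left.
- move=> y sy _ gy; apply: xl => //.
  have [g1y|/h1] := eqVneq (g1 y) 0; last by left.
  by right; apply: h2; rewrite g1y add0r in gy.
Qed.

(** Over the sources of [S], convolution by [g] is multiplication and translation
    along the continuous section of [S]; elsewhere it vanishes locally, because
    the sources of the support of [g] form a closed set. *)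
Lemma conv_bisection_continuous S f g : bisection S -> Cc S g ->
  Kcontinuous f -> Kcontinuous (convolution f g).
Proof.
move=> bS Sg cf x; rewrite /continuous_at.
have /CcP[cg [L [cL LS gL]]] := Sg.
have gS z : g z != 0 -> S z by move=> /gL/LS.
have oS := let: And3 oS _ _ := bS in oS.
have [[y Sy sy]|nS] := pselect ((s @` S) (s x)).
  have -> : convolution f g x = f (x ** inv y) * g y.
    exact: conv_bisection bS gS Sy sy.
  have near_eq : \forall z \near x, convolution f g z =
      f (z ** inv (section_at S (s z))) * g (section_at S (s z)).
    apply: (@filterS _ _ _ (s @^-1` (s @` S))).
      by move=> z Sz; have [? ?] := section_atP Sz; apply: (conv_bisection _ bS).
    apply: s_continuous; apply: open_nbhs_nbhs; split; first exact: open_s.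
    by exists y.
  have cs : (fun z => section_at S (s z)) @ x --> y.
    apply: (@cvg_comp _ _ _ s (section_at S) _ (nbhs (s x))); first exact: s_continuous.
    by rewrite -sy; exact: section_at_continuous.
  have ci : (fun z => inv (section_at S (s z))) @ x --> inv y.
    apply: (@cvg_comp _ _ _ (fun z => section_at S (s z)) inv _ (nbhs y)) => //.
    exact: eg_inv_continuous.
  have cm : (fun z => z ** inv (section_at S (s z))) @ x --> x ** inv y.
    apply: mul_cvg => //; first by rewrite eg_r_inv.
    apply: (@filterS _ _ _ (s @^-1` (s @` S))).
      by move=> z Sz; have [_ h] := section_atP Sz; rewrite eg_r_inv h.
    apply: s_continuous; apply: open_nbhs_nbhs; split; first exact: open_s.
    by exists y.
  apply: cvg_trans; first by apply: near_eq_cvg; apply: filterS near_eq => z ->.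
  apply: (@cvgM _ _ (nbhs x)).
    apply: (@cvg_comp _ _ _ (fun z => z ** inv (section_at S (s z))) f _ _ _ cm).
    exact: cf.
  apply: (@cvg_comp _ _ _ (fun z => section_at S (s z)) g _ _ _ cs).
  exact: cg.
have cg0 z : ~ (s @` L) (s z) -> convolution f g z = 0.
  move=> nL; apply/eqP/negPn/negP => /conv_neq0[w [sw _ /gL Lw]].
  by apply: nL; exists w.
have nL : ~ (s @` L) (s x) by move=> [w /LS Sw sw]; apply: nS; exists w.
rewrite (cg0 x nL).
apply: cvg_trans; first last.
  exact: (@cvg_cst (R[i])^o 0 _ (nbhs x)).
apply: near_eq_cvg; apply: (@filterS _ _ _ (s @^-1` (~` (s @` L)))).
  by move=> z /cg0 ->.
apply: s_continuous; apply: open_nbhs_nbhs; split=> //.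
apply: closed_openC; apply: compact_closed; first exact: eg_hausdorff.
exact: compact_image (@s_continuous G) cL.
Qed.

(** For continuity the right factor is cut into pieces supported on bisections;
    the support lies in the product of the supports, which is compact. *)
Lemma Cc_conv P Q T f g : (forall x y, P x -> Q y -> s x = r y -> T (x ** y)) ->
  Cc P f -> Cc Q g -> Cc T (convolution f g).
Proof.
move=> PQT Pf Qg; apply/CcP; split; last first.
  move/CcP : Pf => [_ [L [cL LP fL]]]; move/CcP : Qg => [_ [M [cM MQ gM]]].
  exists [set z | exists x y, [/\ L x, M y, s x = r y & z = x ** y]]; split.
  - exact: compact_mul.
  - by move=> _ [x [y [/LP Px /MQ Qy xy ->]]]; exact: PQT.
  - move=> x /conv_neq0[y [sy fy gy]]; exists (x ** inv y), y; split.
    + exact: fL.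
    + exact: gM.
    + by rewrite s_mulV.
    + by rewrite mulVKr.
have cf := Cc_continuous Pf.
pose I := {S : set G | bisection S}.
apply: (@Cc_ind G R Q I sval (fun g => Kcontinuous (convolution f g))
  _ _ _ _ _ g Qg).
- by case=> S [].
- by move=> x _; have [S bS Sx] := ex_bisection x; exists (exist _ S bS).
- have -> : convolution f (fun=> 0) = fun=> 0.
    by apply/funext => x; apply: fsbig1 => y _; rewrite mulr0.
  by move=> x; exact: cvg_cst.
- move=> g1 g2 Q1 Q2 c1 c2; rewrite (convDr f Q1 Q2) => x.
  by apply: cvgD; [exact: c1|exact: c2].
- move=> [S bS] g1 /= Sg1; apply: conv_bisection_continuous bS _ cf.
  by apply: Cc_sub Sg1 => ? [].
Qed.

Lemma CcT_conv f g : Cc setT f -> Cc setT g -> Cc setT (convolution f g).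
Proof. exact: Cc_conv. Qed.

Lemma CcT P f : Cc P f -> Cc setT f.
Proof. exact: Cc_sub. Qed.

(** The function on the unit space with the same values as [f] along the section
    of [S]; multiplying by it on the right reproduces [f] from a nonvanishing
    function on [S]. *)
Definition push S f u : R[i] := if `[< (s @` S) u >] then f (section_at S u) else 0.

Lemma push_s S f x : bisection S -> S x -> push S f (s x) = f x.
Proof.
move=> bS Sx; rewrite /push; case: asboolP; last by case; exists x.
by rewrite section_at_s.
Qed.

Lemma Cc_push S f : bisection S -> Cc S f -> Cc (units G) (push S f).
Proof.
move=> bS /CcP[cf [L [cL LS fL]]].
have oS := let: And3 oS _ _ := bS in oS.
have csL : compact (s @` L).
  by exact: compact_image (@s_continuous G) cL.
have fL0 v : push S f v != 0 -> (s @` L) v.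
  rewrite /push; case: asboolP => [/section_atP[_ h] /fL Lv|]; last by rewrite eqxx.
  by exists (section_at S v).
apply/CcP; split; last first.
  by exists (s @` L); split=> // _ [y _ <-]; exact: units_s.
move=> u; rewrite /continuous_at; have [[x Sx <-]|nS] := pselect ((s @` S) u).
  rewrite push_s//.
  apply: cvg_trans; last first.
    apply: (@cvg_comp _ _ _ (section_at S) f _ _ _ (section_at_continuous bS Sx)).
    exact: cf.
  apply: near_eq_cvg; apply: (@filterS _ _ _ (s @` S)).
    by move=> v Sv /=; rewrite /push asboolT.
  by apply: open_nbhs_nbhs; split; [exact: open_s|exists x].
have nL : ~ (s @` L) u by move=> [w /LS Sw sw]; apply: nS; exists w.
have -> : push S f u = 0 by apply/eqP/negPn/negP => /fL0.
apply: cvg_trans; last exact: (@cvg_cst (R[i])^o 0 _ (nbhs u)).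
apply: near_eq_cvg; apply: (@filterS _ _ _ (~` (s @` L))).
  by move=> v nv; apply/esym/eqP/negPn/negP => /fL0.
apply: open_nbhs_nbhs; split=> //; apply: closed_openC.
exact: compact_closed (@eg_hausdorff G) csL.
Qed.

Lemma conv_unitsr f b x : (forall z, b z != 0 -> units G z) ->
  convolution f b x = f x * b (s x).
Proof.
move=> bu; rewrite (conv_bisection (S := units G) (y := s x) f (@bisection_units G))//.
- by rewrite unit_inv ?eg_mul_s//; exact: units_s.
- exact: units_s.
- by rewrite eg_ss.
Qed.

End convolution_theory.

(** * Bounds on the matrices of a function *)

Lemma double_sum_le (R : numDomainType) (T : Type) (l : seq T) (F H : T -> T -> R) :
  (forall x y, F x y <= H x y) ->
  \sum_(x <- l) \sum_(y <- l) F x y <= \sum_(x <- l) \sum_(y <- l) H x y.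
Proof. by move=> FH; apply: ler_sum => x _; apply: ler_sum. Qed.

Lemma sum_at_most_one (R : numDomainType) (T : eqType) (l : seq T) (P : pred T) :
  uniq l -> (forall x y, x \in l -> y \in l -> P x -> P y -> x = y) ->
  \sum_(x <- l) (P x)%:R <= 1 :> R.
Proof.
elim: l => [|a l IH] /=; first by rewrite big_nil ler01.
move=> /andP[al ul] h; rewrite big_cons.
have [Pa|nPa] := boolP (P a).
  rewrite big1_seq ?addr0// => x /andP[_ xl].
  case: (boolP (P x)) => // Px; move: al.
  by rewrite (h a x) ?inE ?eqxx ?xl ?orbT.
rewrite add0r; apply: IH => // x y xl yl.
by apply: h; rewrite inE ?xl ?yl orbT.
Qed.

Section operator_bound.
Variables (R : realType) (G : etale_groupoid).
Implicit Types (f g : G -> R[i]) (x y z u : G) (S P Q L : set G) (C : R).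
Local Notation r := (@eg_r G).
Local Notation s := (@eg_s G).
Local Notation inv := (@eg_inv G).
Local Notation "x ** y" := (@eg_mul G x y) (at level 40, left associativity).

(** The matrices [f (x y^-1)] over finite subsets of a source fibre define
    bilinear forms of norm at most [C].  The arithmetic mean of the squared
    norms, equivalent to their geometric mean by scaling, makes the condition
    additive over pieces of the form; one index set for rows and columns
    suffices since vectors may vanish. *)
Definition op_bound f C := forall (X : seq G) (zeta eta : G -> R[i]),
  uniq X -> (forall x y, x \in X -> y \in X -> s x = s y) ->
  nrm (\sum_(x <- X) \sum_(y <- X) zeta x * f (x ** inv y) * eta y) <=
  C / 2 * (\sum_(x <- X) nrm (zeta x) ^+ 2 + \sum_(y <- X) nrm (eta y) ^+ 2).

Lemma op_bound0 C : 0 <= C -> op_bound (fun=> 0) C.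
Proof.
move=> C0 X zeta eta _ _; rewrite big1; last first.
  by move=> x _; rewrite big1// => y _; rewrite mulr0 mul0r.
rewrite nrm0 mulr_ge0 ?divr_ge0// addr_ge0// sumr_ge0// => x _; exact: sqr_ge0.
Qed.

Lemma op_boundD f g C D : op_bound f C -> op_bound g D ->
  op_bound (fun x => f x + g x) (C + D).
Proof.
move=> fC gD X zeta eta uX sX.
have -> : \sum_(x <- X) \sum_(y <- X) zeta x * (f (x ** inv y) + g (x ** inv y)) * eta y
  = \sum_(x <- X) \sum_(y <- X) zeta x * f (x ** inv y) * eta y +
    \sum_(x <- X) \sum_(y <- X) zeta x * g (x ** inv y) * eta y.
  rewrite -big_split; apply: eq_bigr => x _; rewrite -big_split.
  by apply: eq_bigr => y _; rewrite mulrDr mulrDl.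
apply: le_trans (nrmD _ _) _; rewrite mulrDl mulrDl; apply: lerD.
  exact: fC.
exact: gD.
Qed.

Lemma op_bound_le f C D : C <= D -> op_bound f C -> op_bound f D.
Proof.
move=> CD fC X zeta eta uX sX; apply: le_trans (fC X zeta eta uX sX) _.
apply: ler_wpM2r; last by lra.
by apply: addr_ge0; apply: sumr_ge0 => x _; exact: sqr_ge0.
Qed.

(** The value at [x] is the entry in row [x] and column [s x]. *)
Lemma op_bound_point f C x : op_bound f C -> nrm (f x) <= C.
Proof.
move=> fC; have [ux|nux] := pselect (units G x).
  have := fC [:: x] (fun=> 1) (fun=> 1) isT.
  have e : x ** x = x by rewrite -{2}(unit_s ux) eg_mul_s.
  rewrite !big_seq1 mul1r mulr1 nrm1 unit_inv// e => h.
  have := h _; rewrite expr1n => {}h; have : nrm (f x) <= C / 2 * (1 + 1).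
    by apply: h => y z; rewrite !inE => /eqP -> /eqP ->.
  lra.
have xs : x != s x by apply/eqP => e; apply: nux; rewrite e; exact: units_s.
have := fC [:: x; s x] (fun y => (y == x)%:R) (fun y => (y == s x)%:R).
rewrite /= inE xs => /(_ isT) h.
have {}h := h _; move: h.
rewrite !big_cons !big_nil eqxx (negbTE xs) eq_sym (negbTE xs) eqxx.
rewrite !mulr0 !mul0r !addr0 !add0r !mul1r mulr1 nrm0 nrm1 expr0n expr1n /= addr0 add0r.
rewrite unit_inv ?eg_mul_s; last exact: units_s.
move=> h; have : nrm (f x) <= C / 2 * (1 + 1).
  by apply: h => y z; rewrite !inE => /orP[]/eqP -> /orP[]/eqP ->; rewrite ?eg_ss.
lra.
Qed.

Lemma nrm_double_sum f (X : seq G) (zeta eta : G -> R[i]) :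
  nrm (\sum_(x <- X) \sum_(y <- X) zeta x * f (x ** inv y) * eta y) <=
  \sum_(x <- X) \sum_(y <- X) nrm (zeta x) * nrm (f (x ** inv y)) * nrm (eta y).
Proof.
apply: le_trans (nrm_sum _ _ _) _; apply: ler_sum => x _.
apply: le_trans (nrm_sum _ _ _) _; apply: ler_sum => y _.
by rewrite !nrmM.
Qed.

(** Each of the finitely many entries of a finite section may be approximated. *)
Lemma op_bound_limit f C :
  (forall d : R, 0 < d -> exists2 g, op_bound g (C + d) &
     forall z, nrm (f z - g z) <= d) -> op_bound f C.
Proof.
move=> h X zeta eta uX sX.
set N := \sum_(x <- X) _ + _.
set M := \sum_(x <- X) \sum_(y <- X) nrm (zeta x) * nrm (eta y).
have N0 : 0 <= N.
  by apply: addr_ge0; apply: sumr_ge0 => x _; exact: sqr_ge0.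
have M0 : 0 <= M.
  by apply: sumr_ge0 => x _; apply: sumr_ge0 => y _; rewrite mulr_ge0// nrm_ge0.
apply/ler_addgt0Pr => e e0.
(* [N] and [M] weigh the errors on the bound and on the entries; 1 keeps the
   denominator positive. *)
pose d := e / (N / 2 + M + 1).
have D0 : 0 < N / 2 + M + 1 by lra.
have d0 : 0 < d by rewrite divr_gt0.
have [g gb fg] := h d d0.
have -> : \sum_(x <- X) \sum_(y <- X) zeta x * f (x ** inv y) * eta y =
  \sum_(x <- X) \sum_(y <- X) zeta x * g (x ** inv y) * eta y +
  \sum_(x <- X) \sum_(y <- X) zeta x * (f (x ** inv y) - g (x ** inv y)) * eta y.
  rewrite -big_split; apply: eq_bigr => x _; rewrite -big_split.
  by apply: eq_bigr => y _; rewrite /=; ring.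
apply: le_trans (nrmD _ _) _.
have h1 := gb X zeta eta uX sX; rewrite -/N in h1.
have h2 : nrm (\sum_(x <- X) \sum_(y <- X)
    zeta x * (f (x ** inv y) - g (x ** inv y)) * eta y) <= d * M.
  apply: le_trans (nrm_double_sum (fun z => f z - g z) _ _ _) _.
  rewrite /M mulr_sumr; apply: ler_sum => x _; rewrite mulr_sumr.
  apply: ler_sum => y _; rewrite mulrAC mulrC ler_wpM2r// ?mulr_ge0 ?nrm_ge0//.
have : d * (N / 2 + M + 1) = e by rewrite /d divfK// gt_eqF.
nra.
Qed.

(** The Schur test for a matrix with at most one nonzero entry in each row and each
    column. *)
Lemma op_bound_bisection S f C : 0 <= C ->
  (forall x y, S x -> S y -> s x = s y -> x = y) ->
  (forall x y, S x -> S y -> r x = r y -> x = y) ->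
  (forall x, f x != 0 -> S x) -> (forall x, nrm (f x) <= C) -> op_bound f C.
Proof.
move=> C0 sS rS fS fC X zeta eta uX sX.
apply: le_trans (nrm_double_sum _ _ _ _) _.
pose I x y : R := `[< S (x ** inv y) >]%:R.
have I0 x y : 0 <= I x y by exact: ler0n.
have fI x y : nrm (f (x ** inv y)) <= C * I x y.
  rewrite /I; have [->|/fS fx] := eqVneq (f (x ** inv y)) 0.
    by rewrite nrm0 mulr_ge0.
  by rewrite asboolT// mulr1.
apply: (@le_trans _ _ (\sum_(x <- X) \sum_(y <- X)
    C / 2 * (nrm (zeta x) ^+ 2 * I x y + nrm (eta y) ^+ 2 * I x y))).
  apply: double_sum_le => x y.
  have a0 := nrm_ge0 (zeta x); have b0 := nrm_ge0 (eta y).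
  have c0 := nrm_ge0 (f (x ** inv y)).
  have h1 : nrm (zeta x) * nrm (f (x ** inv y)) * nrm (eta y) <=
      nrm (zeta x) * (C * I x y) * nrm (eta y).
    by apply: ler_wpM2r => //; apply: ler_wpM2l.
  apply: le_trans h1 _.
  have : 0 <= I x y * (C * (nrm (zeta x) - nrm (eta y)) ^+ 2).
    by apply: mulr_ge0 => //; apply: mulr_ge0 => //; exact: sqr_ge0.
  rewrite !expr2; lra.
rewrite (_ : \sum_(x <- X) _ = C / 2 * (\sum_(x <- X) nrm (zeta x) ^+ 2 * (\sum_(y <- X) I x y)
   + \sum_(y <- X) nrm (eta y) ^+ 2 * (\sum_(x <- X) I x y))); last first.
  under [X in _ = _ * (_ + X)]eq_bigr do rewrite mulr_sumr.
  rewrite [X in _ = _ * (_ + X)]exchange_big -big_split mulr_sumr.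
  apply: eq_bigr => x _; rewrite mulr_sumr -big_split mulr_sumr.
  by apply: eq_bigr => y _.
apply: ler_wpM2l; first by rewrite divr_ge0.
have sum_le (F J : G -> R) : (forall x, 0 <= F x) ->
    (forall x, x \in X -> J x <= 1) ->
    \sum_(x <- X) F x * J x <= \sum_(x <- X) F x.
  move=> F0 J1; rewrite big_seq [leRHS]big_seq; apply: ler_sum => x xX.
  by apply: ler_piMr => //; exact: J1.
apply: lerD; apply: sum_le => x; try exact: sqr_ge0; move=> xX; rewrite /I.
- apply: (@sum_at_most_one _ _ _ (fun y => `[< S (x ** inv y) >])) => //.
  move=> y z yX zX /asboolP h1 /asboolP h2.
  have exy := sX x y xX yX; have exz := sX x z xX zX.
  have e : x ** inv y = x ** inv z by apply: (rS _ _ h1 h2); rewrite !r_mulV.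
  rewrite -(inv_invK y) -(inv_invK z); congr (inv _).
  rewrite -(@mulVK _ x (inv y)) ?eg_r_inv//.
  by rewrite e mulVK ?eg_r_inv.
- apply: (@sum_at_most_one _ _ _ (fun y => `[< S (y ** inv x) >])) => //.
  move=> y z yX zX /asboolP h1 /asboolP h2.
  have exy := sX y x yX xX; have exz := sX z x zX xX.
  have e : y ** inv x = z ** inv x by apply: (sS _ _ h1 h2); rewrite !s_mulV.
  by rewrite -(mulVKr exy) e mulVKr.
Qed.

(** Cut the function along the successive bisections, into possibly discontinuous
    pieces. *)
Lemma op_bound_cover (l : seq (set G)) f C : 0 <= C ->
  (forall S, S \in l -> bisection S) ->
  (forall x, f x != 0 -> exists2 S, S \in l & S x) ->
  (forall x, nrm (f x) <= C) -> op_bound f ((size l)%:R * C).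
Proof.
move=> C0; elim: l f => [|S l IH] f lb fl fC.
  rewrite mul0r (_ : f = fun=> 0); first exact: op_bound0.
  by apply/funext => x; apply/eqP/negPn/negP => /fl[].
have -> : f = fun x => (if `[< S x >] then f x else 0) +
    (if `[< S x >] then 0 else f x).
  by apply/funext => x; case: ifP => _; rewrite ?addr0 ?add0r.
rewrite /= -nat1r mulrDl mul1r; apply: op_boundD.
  have [_ h1 h2] := lb S (mem_head _ _).
  apply: (op_bound_bisection (S := S)) => // x; case: asboolP => //.
  - by rewrite eqxx.
  - by rewrite nrm0.
apply: IH.
- by move=> T Tl; apply: lb; rewrite inE Tl orbT.
- move=> x; case: asboolP; first by rewrite eqxx.
  move=> nS /fl[T]; rewrite inE => /orP[/eqP -> //|Tl Tx].
  by exists T.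
- by move=> x; case: asboolP => // _; rewrite nrm0.
Qed.

Lemma Cc_bounded P f : Cc P f -> exists2 C : R, 0 <= C & forall x, nrm (f x) <= C.
Proof.
move=> /CcP[cf [L [cL LP fL]]].
have cn := nrm_continuous cf.
have [|l [lL Ll]] := @compact_finite_cover G L (fun x => [set y | nrm (f y) < nrm (f x) + 1]) cL.
  move=> x _; have /cvgrPdist_lt/(_ 1 ltr01) := cn x.
  by apply: filterS => y /=; rewrite ltr_norml; lra.
exists (\sum_(x <- l) (nrm (f x) + 1)).
  by apply: sumr_ge0 => x _; rewrite addr_ge0 ?nrm_ge0.
move=> y; have [->|/fL/Ll[x xl /= fx]] := eqVneq (f y) 0.
  by rewrite nrm0; apply: sumr_ge0 => x _; rewrite addr_ge0 ?nrm_ge0.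
apply: le_trans (ltW fx) _; rewrite (big_rem x)//= lerDl.
by apply: sumr_ge0 => z _; rewrite addr_ge0 ?nrm_ge0.
Qed.

(** In particular the reduced norm of a function of C_c is bounded above. *)
Lemma Cc_op_bound P f : Cc P f -> exists2 C, 0 <= C & op_bound f C.
Proof.
move=> Pf; have [C C0 fC] := Cc_bounded Pf.
move/CcP : Pf => [cf [L [cL LP fL]]].
have [l [lb Ll]] := compact_bisections cL.
exists ((size l)%:R * C); first by rewrite mulr_ge0.
by apply: op_bound_cover => // x /fL/Ll.
Qed.

End operator_bound.

(** * Matrix bounds and the reduced norm *)

Section reduced_norm_theory.
Variables (R : realType) (G : etale_groupoid).
Implicit Types (f g xi : G -> R[i]) (x y z u : G) (S P Q L : set G) (C : R).
Local Notation r := (@eg_r G).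
Local Notation s := (@eg_s G).
Local Notation inv := (@eg_inv G).
Local Notation "x ** y" := (@eg_mul G x y) (at level 40, left associativity).

Lemma l2norm_le u xi C : 0 <= C ->
  (forall l : seq G, uniq l -> (forall x, x \in l -> s x = u) ->
     \sum_(x <- l) nrm (xi x) ^+ 2 <= C ^+ 2) -> (l2norm u xi <= C%:E)%E.
Proof.
move=> C0 h; rewrite /l2norm.
have -> : C%:E = sqrte ((C ^+ 2)%:E) by rewrite /= sqrtr_sqr ger0_norm.
suff e : (\esum_(x in s_fiber u) ((nrm (xi x)) ^+ 2)%:E <= (C ^+ 2)%:E)%E.
  by rewrite lee_sqrt// lee_fin sqr_ge0.
apply: ge_ereal_sup => _ [F [finF Fu] <-].
rewrite fsbig_finite//= sumEFin lee_fin; apply: h; first exact: fset_uniq.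
by move=> x; rewrite in_fset_set// inE => /Fu.
Qed.

Lemma le_l2norm u xi C (l : seq G) : 0 <= C -> (l2norm u xi <= C%:E)%E ->
  uniq l -> (forall x, x \in l -> s x = u) ->
  \sum_(x <- l) nrm (xi x) ^+ 2 <= C ^+ 2.
Proof.
move=> C0 h ul lu; rewrite -lee_fin -sumEFin.
have e0 : (0 <= \esum_(x in s_fiber u) ((nrm (xi x)) ^+ 2)%:E)%E.
  by apply: esum_ge0 => x _; rewrite lee_fin sqr_ge0.
apply: (@le_trans _ _ (\esum_(x in s_fiber u) ((nrm (xi x)) ^+ 2)%:E)%E).
  apply: esum_ge; exists [set` l]; last by rewrite fsbig_seq.
  by split; [exact: finite_seq|exact: lu].
move: h; rewrite /l2norm.
have -> : C%:E = sqrte ((C ^+ 2)%:E) by rewrite /= sqrtr_sqr ger0_norm.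
by rewrite lee_sqrt// lee_fin sqr_ge0.
Qed.

Lemma Ind_seq u f xi x (l : seq G) : uniq l -> (forall y, y \in l -> s y = u) ->
  (forall y, s y = u -> f (x ** inv y) != 0 -> xi y != 0 -> y \in l) ->
  Ind u f xi x = \sum_(y <- l) f (x ** inv y) * xi y.
Proof.
move=> ul lx xl; apply: fsum_seq => // y sy.
by rewrite mulf_eq0 negb_or => /andP[]; exact: xl.
Qed.

(** Used for [k x y] equal to [x y^-1] or to [x y], with [L] compact and [f] the range
    map: [k x y] stays in the range fibre of [x], which meets [L] in finitely many
    points, and [j x] recovers [y] from it. *)
Lemma translate_list (L : set G) (u : G) (k j : G -> G -> G) (D : set G)
    (X : seq G) (f : G -> G) :
  (forall w, finite_set (L `&` [set z | f z = w])) ->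
  (forall x y, x \in X -> D y -> f (k x y) = f x /\ y = j x (k x y)) ->
  (forall x, x \in X -> forall z, L z -> f z = f x -> D (j x z)) ->
  exists l : seq G, [/\ uniq l, forall y, y \in l -> D y &
    forall x y, x \in X -> D y -> L (k x y) -> y \in l].
Proof.
move=> fL kj jD.
pose m x := [seq j x z | z <- enum_fset (fset_set (L `&` [set z | f z = f x]))].
exists (undup (flatten [seq m x | x <- X])); split; first exact: undup_uniq.
  move=> y; rewrite mem_undup => /flattenP[_ /mapP[x xX ->]] /mapP[z].
  by rewrite /= in_fset_set// inE => -[Lz fz] ->; exact: jD.
move=> x y xX Dy Lk; have [h1 h2] := kj x y xX Dy; rewrite mem_undup.
apply/flattenP; exists (m x); first exact: map_f.
by rewrite {1}h2; apply: map_f; rewrite /= in_fset_set// inE.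
Qed.

(** Test the bound on a vector [xi] against the conjugate of a finite part of its
    image, enlarging the index set so that the sums defining [Ind] become
    complete. *)
Lemma op_bound_reduced_norm P f C : Cc P f -> 0 <= C -> op_bound f C ->
  (reduced_norm f <= C%:E)%E.
Proof.
move=> /CcP[_ [L [cL _ fL]]] C0 fC.
apply: ge_ereal_sup => _ [u uu <-]; apply: ge_ereal_sup => _ [xi xi1 <-].
apply: l2norm_le => // l ul lu.
have [Y0 [uY0 Y0u Y0P]] : exists l' : seq G, [/\ uniq l',
    forall y, y \in l' -> s_fiber u y &
    forall x y, x \in l -> s_fiber u y -> L (x ** inv y) -> y \in l'].
  apply: (@translate_list L u (fun x y => x ** inv y) (fun x z => inv z ** x)
    (s_fiber u) l r); first by move=> w; exact: finite_r_fiber.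
    move=> x y xl sy; have xy : s x = s y by rewrite (lu _ xl) sy.
    rewrite r_mulV// inv_mul ?eg_r_inv// inv_invK; split=> //.
    by rewrite mulVKr// ?eg_s_inv ?eg_r_inv.
  move=> x xl z Lz rz; rewrite /s_fiber /= eg_s_mul ?eg_s_inv//; exact: lu.
(* [Y] contains all columns that meet a row of [l], so that [IE] below is exact. *)
pose Y := undup (l ++ Y0).
have uY : uniq Y by exact: undup_uniq.
have Yu y : y \in Y -> s y = u.
  by rewrite mem_undup mem_cat => /orP[/lu|/Y0u].
have lY : {subset l <= Y} by move=> x xl; rewrite mem_undup mem_cat xl.
have IE x : x \in l -> Ind u f xi x = \sum_(y <- Y) f (x ** inv y) * xi y.
  move=> xl; apply: Ind_seq => // y sy /fL Lf _.
  by rewrite mem_undup mem_cat (Y0P x y)// orbT.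
have xiY : \sum_(y <- Y) nrm (xi y) ^+ 2 <= 1.
  have := @le_l2norm u xi 1 Y ler01 xi1 uY Yu; by rewrite expr1n.
pose T := \sum_(x <- l) nrm (Ind u f xi x) ^+ 2; rewrite -/T.
have T0 : 0 <= T by apply: sumr_ge0 => x _; exact: sqr_ge0.
pose zeta x : R[i] := if x \in l then (Ind u f xi x)^* else 0.
have restr (F : G -> R) : \sum_(x <- Y) (if x \in l then F x else 0) = \sum_(x <- l) F x.
  rewrite -big_mkcond -[LHS]big_filter; apply: perm_big; apply: uniq_perm => //.
    exact: filter_uniq.
  by move=> x; rewrite mem_filter; case: (boolP (x \in l)) => // /lY ->.
have zT : \sum_(x <- Y) nrm (zeta x) ^+ 2 = T.
  rewrite /T -(restr (fun x => nrm (Ind u f xi x) ^+ 2)); apply: eq_bigr => x _.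
  by rewrite /zeta; case: ifP => _; rewrite ?nrm_conj// nrm0 expr0n.
(* The factor [C] on [xi] balances the two squared norms in the additive bound. *)
have main : \sum_(x <- Y) \sum_(y <- Y) zeta x * f (x ** inv y) * (C%:C * xi y) =
    (C * T)%:C.
  rewrite /T -(restr (fun x => nrm (Ind u f xi x) ^+ 2)) mulr_sumr rmorph_sum /=.
  apply: eq_bigr => x _; rewrite /zeta; case: ifP => xl; last first.
    by rewrite mulr0 rmorph0; apply: big1 => y _; rewrite !mul0r.
  rewrite rmorphM /= -mul_conj [in X in _ * (_ * X)]IE// !mulr_sumr.
  by apply: eq_bigr => y _; ring.
have := fC Y zeta (fun y => C%:C * xi y) uY.
rewrite main zT nrm_real.
have -> : \sum_(y <- Y) nrm (C%:C * xi y) ^+ 2 = C ^+ 2 * \sum_(y <- Y) nrm (xi y) ^+ 2.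
  rewrite mulr_sumr; apply: eq_bigr => y _.
  by rewrite nrmM nrm_real exprMn real_normK ?num_real.
move=> h; have {}h := h _; have : `|C * T| <= C / 2 * (T + C ^+ 2 * \sum_(y <- Y) nrm (xi y) ^+ 2).
  by apply: h => x y /Yu -> /Yu ->.
rewrite ger0_norm ?mulr_ge0//.
set E := \sum_(y <- Y) _ in xiY *.
have E0 : 0 <= E by apply: sumr_ge0 => x _; exact: sqr_ge0.
have [C00|Cn0] := eqVneq C 0.
  move=> _; rewrite C00 expr0n /=; apply: sumr_le0 => x xl.
  have -> : Ind u f xi x = 0.
    apply: fsbig1 => y _; suff -> : f (x ** inv y) = 0 by rewrite mul0r.
    apply/nrm_eq0/eqP; rewrite eq_le nrm_ge0 andbT -C00.
    exact: op_bound_point fC.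
  by rewrite nrm0 expr0n.
have Cp : 0 < C by rewrite lt_neqAle eq_sym Cn0.
move=> h1; have : C * (T - C ^+ 2 * E) <= 0 by lra.
rewrite pmulr_rle0// subr_le0 => h2; apply: le_trans h2 _.
by rewrite ler_piMr// sqr_ge0.
Qed.

(** Conversely a normalized finitely supported vector has an image of norm at most
    [C], and the Cauchy-Schwarz inequality, in additive form, bounds the form. *)
Lemma reduced_norm_op_bound f C : 0 <= C ->
  (reduced_norm f <= C%:E)%E -> op_bound f C.
Proof.
move=> C0 fC X zeta eta uX sX.
case: X uX sX => [|x0 X'] uX sX; first by rewrite !big_nil nrm0 addr0 mulr0.
set X := x0 :: X' in uX sX *; pose u := s x0.
have Xu x : x \in X -> s x = u by move=> xX; apply: sX => //; exact: mem_head.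
set Z := \sum_(x <- X) nrm (zeta x) ^+ 2; set E := \sum_(x <- X) nrm (eta x) ^+ 2.
have Z0 : 0 <= Z by apply: sumr_ge0 => x _; exact: sqr_ge0.
have E0 : 0 <= E by apply: sumr_ge0 => x _; exact: sqr_ge0.
have [Ez|En] := eqVneq E 0.
  have eta0 x : x \in X -> eta x = 0.
    move=> xX; move/eqP : Ez; rewrite psumr_eq0 => [|y _]; last exact: sqr_ge0.
    by move=> /allP/(_ x xX); rewrite /= sqrf_eq0 => /eqP/nrm_eq0.
  rewrite big_seq big1 => [|x xX]; last first.
    by rewrite big_seq big1// => y yX; rewrite eta0// mulr0.
  by rewrite nrm0 mulr_ge0 ?divr_ge0// addr_ge0.
have Ep : 0 < E by rewrite lt_neqAle eq_sym En.
pose k := (Num.sqrt E)^-1; have k0 : 0 < k by rewrite invr_gt0 sqrtr_gt0.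
have kE : k ^+ 2 * E = 1.
  by rewrite exprVn sqr_sqrtr// mulVf.
pose xi x : R[i] := if x \in X then k%:C * eta x else 0.
have xi1 : (l2norm u xi <= 1%:E)%E.
  apply: l2norm_le => // l ul lu; rewrite expr1n -kE /E mulr_sumr.
  rewrite (bigID (mem X)) /= [X in _ + X]big1 ?addr0; last first.
    by move=> x xX; rewrite /xi (negbTE xX) nrm0 expr0n.
  rewrite -[leLHS]big_filter.
  have -> : \sum_(x <- [seq x <- l | x \in X]) nrm (xi x) ^+ 2 =
      \sum_(x <- X | x \in l) k ^+ 2 * nrm (eta x) ^+ 2.
    rewrite -[RHS]big_filter big_seq.
    under eq_bigr => x.
      rewrite mem_filter => /andP[xX _].
      rewrite /xi xX nrmM nrm_real exprMn real_normK ?num_real//. over.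
    rewrite -big_seq; apply: perm_big; apply: uniq_perm; rewrite ?filter_uniq//.
    by move=> x; rewrite !mem_filter andbC.
  rewrite big_mkcond; apply: ler_sum => x _; case: ifP => // _.
  by rewrite mulr_ge0 ?sqr_ge0.
have IC : (l2norm u (Ind u f xi) <= C%:E)%E.
  apply: le_trans fC; apply: le_trans (ereal_sup_ubound _); last first.
    by exists u => //; exact: units_s.
  by apply: ereal_sup_ubound; exists xi.
have h := @le_l2norm u (Ind u f xi) C X C0 IC uX Xu.
have IE x : Ind u f xi x = \sum_(y <- X) f (x ** inv y) * (k%:C * eta y).
  rewrite (@Ind_seq u f xi x X)//; last first.
    by move=> y _ _; rewrite /xi; case: ifP => //; rewrite eqxx.
  by rewrite big_seq [RHS]big_seq; apply: eq_bigr => y yX; rewrite /xi yX.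
set S := \sum_(x <- X) _ in h.
have S0 : 0 <= S by apply: sumr_ge0 => x _; exact: sqr_ge0.
have e1 : k%:C * (\sum_(x <- X) \sum_(y <- X) zeta x * f (x ** inv y) * eta y) =
    \sum_(x <- X) zeta x * Ind u f xi x.
  rewrite mulr_sumr; apply: eq_bigr => x _; rewrite IE !mulr_sumr.
  by apply: eq_bigr => y _; ring.
have e2 : k * nrm (\sum_(x <- X) \sum_(y <- X) zeta x * f (x ** inv y) * eta y) <=
    \sum_(x <- X) nrm (zeta x) * nrm (Ind u f xi x).
  rewrite -[k in k * _](ger0_norm (ltW k0)) -nrm_real -nrmM e1.
  apply: le_trans (nrm_sum _ _ _) _; apply: ler_sum => x _; by rewrite nrmM.
have e3 : 2 * (C * k) * \sum_(x <- X) nrm (zeta x) * nrm (Ind u f xi x) <=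
    (C * k) ^+ 2 * Z + S.
  rewrite /Z /S !mulr_sumr -big_split; apply: ler_sum => x _ /=.
  have : 0 <= (C * k * nrm (zeta x) - nrm (Ind u f xi x)) ^+ 2 by exact: sqr_ge0.
  rewrite !expr2; lra.
have [C00|Cn0] := eqVneq C 0.
  have I0 x : x \in X -> Ind u f xi x = 0.
    have Sz : S = 0 by apply/eqP; rewrite eq_le S0 andbT; move: h; rewrite C00 expr0n.
    move=> xX; move/eqP : Sz; rewrite psumr_eq0 => [|y _]; last exact: sqr_ge0.
    by move=> /allP/(_ x xX); rewrite /= sqrf_eq0 => /eqP/nrm_eq0.
  rewrite C00 mul0r mul0r.
  rewrite -(pmulr_rle0 _ k0); apply: le_trans e2 _.
  rewrite big_seq; apply: sumr_le0 => x xX; by rewrite I0// nrm0 mulr0.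
have Cp : 0 < C by rewrite lt_neqAle eq_sym Cn0.
set n := nrm _ in e2 *; set W := \sum_(x <- X) nrm (zeta x) * _ in e2 e3.
have e4 : 2 * (C * k) * (k * n) <= (C * k) ^+ 2 * Z + C ^+ 2.
  apply: le_trans (_ : 2 * (C * k) * W <= _).
    by rewrite ler_wpM2l// mulr_ge0// mulr_ge0// ltW.
  by apply: le_trans e3 _; rewrite lerD2l.
have Ck0 : 0 < C * k ^+ 2 by rewrite mulr_gt0// exprn_gt0.
rewrite -(ler_pM2l Ck0).
have -> : C * k ^+ 2 * (C / 2 * (Z + E)) = ((C * k) ^+ 2 * Z + C ^+ 2 * (k ^+ 2 * E)) / 2.
  by rewrite !expr2; field.
rewrite kE mulr1; rewrite !expr2 in e4 *; lra.
Qed.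

End reduced_norm_theory.

(** * Elements of the reduced algebra as functions *)

Section fourier_map.
Variables (R : realType) (G : etale_groupoid) (A : reduced_cstar_algebra R G).
Implicit Types (f g : G -> R[i]) (x y z u : G) (S P Q L : set G) (C : R) (a b c : A).
Local Notation r := (@eg_r G).
Local Notation s := (@eg_s G).
Local Notation inv := (@eg_inv G).
Local Notation "x ** y" := (@eg_mul G x y) (at level 40, left associativity).
Local Notation rc := (rc_in A).

Lemma rc_norm_le P f C : Cc P f -> 0 <= C -> op_bound f C -> nrm (rc f) <= C.
Proof.
move=> Pf C0 fC; rewrite /nrm rc_in_norm//=; last exact: CcT Pf.
have := op_bound_reduced_norm Pf C0 fC.
by case: (reduced_norm f) => //= x; rewrite lee_fin.
Qed.

Lemma rc_op_bound P f : Cc P f -> op_bound f (nrm (rc f)).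
Proof.
move=> Pf; have [C C0 fC] := Cc_op_bound Pf.
have h := op_bound_reduced_norm Pf C0 fC.
apply: reduced_norm_op_bound; first exact: nrm_ge0.
rewrite /nrm rc_in_norm//=; last exact: CcT Pf.
by case: (reduced_norm f) h => //= x; rewrite leNye.
Qed.

Lemma rc_point P f x : Cc P f -> nrm (f x) <= nrm (rc f).
Proof. by move=> /rc_op_bound; exact: op_bound_point. Qed.

Lemma rcB P f g : Cc P f -> Cc P g -> rc (fun x => f x - g x) = rc f - rc g.
Proof.
move=> /CcT Pf /CcT Pg; rewrite -scaleN1r -rc_inZ// -rc_inD//; last exact: CcZ.
by congr (rc _); apply/funext => x; rewrite mulN1r.
Qed.

Lemma rc_dense a (e : R) : 0 < e -> exists2 f, Cc setT f & nrm (a - rc f) < e.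
Proof.
move=> e0; have : closure (rc @` Cc setT) a by rewrite rc_in_dense.
by move=> /closure_nrmP/(_ e e0)[_ [f Pf <-]]; exists f.
Qed.

Lemma Cc_nearP a (e : R) : 0 < e ->
  Cc_near a [set f | Cc setT f /\ nrm (a - rc f) < e].
Proof.
move=> e0; exists e%:C; first by rewrite /= ltcR.
by move=> f [Pf]; rewrite nrmE ltcR.
Qed.

Lemma Cc_near_proper a : ProperFilter (Cc_near a).
Proof.
apply: filter_from_proper; first apply: filter_from_filter.
- by exists 1; exact: ltr01.
- move=> _ _ /positive_complex[d d0 ->] /positive_complex[e e0 ->].
  exists (Num.min d e)%:C; first by rewrite /= ltcR lt_min d0 e0.
  by move=> f [Pf]; rewrite nrmE ltcR lt_min => /andP[h1 h2]; split; split=> //;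
     rewrite nrmE ltcR.
- move=> _ /positive_complex[e e0 ->]; have [f Pf fe] := rc_dense a e0.
  by exists f; split=> //; rewrite nrmE ltcR.
Qed.

(** Evaluation at a point is bounded by the norm on C_c, so that it has a limit along
    the functions approximating [a]. *)
Lemma jmap_cvg a x (e : R) : 0 < e ->
  exists2 f, Cc setT f & nrm (a - rc f) < e /\ nrm (jmap a x - f x) < e.
Proof.
move=> e0; have FF := Cc_near_proper a.
have cv : cvg ((fun f => f x : (R[i])^o) @ Cc_near a).
  apply/cvg_ex; apply: complex_cauchy => d d0.
  have d20 : 0 < d / 2 by rewrite divr_gt0.
  have [g Pg ga] := rc_dense a d20; exists (g x).
  apply: filterS (Cc_nearP a d20) => f [Pf fa].
  have := rc_point x (CcB Pg Pf); rewrite (rcB Pg Pf) => h.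
  apply: le_lt_trans h _; apply: le_lt_trans (nrm_dist_triangle a _ _) _.
  by rewrite nrmBC [d]splitr; exact: ltrD.
have := cv => /cvg_nrmP/(_ e e0) h.
have [f [[Pf fa] fx]] := @filter_ex _ _ FF _ (filterI (Cc_nearP a e0) h).
by exists f.
Qed.

Lemma jmap_dist P a f x : Cc P f -> nrm (jmap a x - f x) <= nrm (a - rc f).
Proof.
move=> /CcT Pf; apply/ler_addgt0Pr => e e0.
have e20 : 0 < e / 2 by rewrite divr_gt0.
have [g Pg [ga gx]] := jmap_cvg a x e20.
apply: le_trans (nrm_dist_triangle (g x) _ _) _.
have := rc_point x (CcB Pg Pf); rewrite (rcB Pg Pf) => h1.
have h2 := nrm_dist_triangle a (rc g) (rc f); rewrite [nrm (rc g - a)]nrmBC in h2.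
lra.
Qed.

Lemma jmap_rc P f : Cc P f -> jmap (rc f) = f.
Proof.
move=> Pf; apply/funext => x; apply/eqP; rewrite -subr_eq0; apply/eqP/nrm_eq0.
apply/eqP; rewrite eq_le nrm_ge0 andbT.
by apply: le_trans (jmap_dist _ _ Pf) _; rewrite subrr nrm0.
Qed.

Lemma eq_of_nrm (V : normedZmodType R[i]) (v w : V) :
  (forall e : R, 0 < e -> nrm (v - w) <= e) -> v = w.
Proof.
move=> h; apply/eqP; rewrite -subr_eq0; apply/eqP/nrm_eq0/eqP.
rewrite eq_le nrm_ge0 andbT; apply/ler_addgt0Pr => e e0; rewrite add0r; exact: h.
Qed.

Lemma jmapD a b x : jmap (a + b) x = jmap a x + jmap b x.
Proof.
apply: eq_of_nrm => e e0; have e40 : 0 < e / 4 by rewrite divr_gt0.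
have [f Pf fa] := rc_dense a e40; have [g Pg gb] := rc_dense b e40.
have h1 := jmap_dist a x Pf; have h2 := jmap_dist b x Pg.
have h3 := jmap_dist (a + b) x (CcD Pf Pg).
have e1 : a + b - (rc f + rc g) = (a - rc f) + (b - rc g) by rewrite opprD addrACA.
rewrite rc_inD// e1 in h3.
have h4 := nrmD (a - rc f) (b - rc g).
have h5 := nrm_dist_triangle (f x + g x) (jmap (a + b) x) (jmap a x + jmap b x).
have h6 := nrmD (f x - jmap a x) (g x - jmap b x).
have e2 : f x + g x - (jmap a x + jmap b x) = (f x - jmap a x) + (g x - jmap b x).
  by rewrite opprD addrACA.
rewrite e2 in h5; rewrite [nrm (f x - _)]nrmBC [nrm (g x - _)]nrmBC in h6.
lra.
Qed.

Lemma jmapZ (k : R[i]) a x : jmap (k *: a) x = k * jmap a x.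
Proof.
apply: eq_of_nrm => e e0; pose d := e / (2 * (nrm k + 1)).
have k0 := nrm_ge0 k.
have d0 : 0 < d by rewrite divr_gt0//; lra.
have [f Pf fa] := rc_dense a d0.
have h1 := jmap_dist a x Pf.
have h3 := jmap_dist (k *: a) x (CcZ k Pf).
rewrite rc_inZ// -scalerBr nrmZ in h3.
have h5 := nrm_dist_triangle (k * f x) (jmap (k *: a) x) (k * jmap a x).
have h6 : nrm (k * f x - k * jmap a x) = nrm k * nrm (jmap a x - f x).
  by rewrite -mulrBr nrmM nrmBC.
have h7 : nrm k * nrm (a - rc f) <= nrm k * d by rewrite ler_wpM2l// ltW.
have h8 : nrm k * nrm (jmap a x - f x) <= nrm k * d.
  by rewrite ler_wpM2l//; lra.
have : d * (2 * (nrm k + 1)) = e by rewrite divfK// gt_eqF//; lra.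
lra.
Qed.

Lemma jmapN a x : jmap (- a) x = - jmap a x.
Proof. by rewrite -scaleN1r jmapZ mulN1r. Qed.

Lemma jmapB a b x : jmap (a - b) x = jmap a x - jmap b x.
Proof. by rewrite jmapD jmapN. Qed.

Lemma jmap0 x : jmap (0 : A) x = 0.
Proof. by rewrite -[0](scale0r (0 : A)) jmapZ mul0r. Qed.

(** The norm of [a] is the best bound for the matrices of [jmap a]: this lemma and
    [norm_le_op_bound] transfer the description of the norm from C_c to its
    completion. *)
Lemma jmap_op_bound a : op_bound (jmap a) (nrm a).
Proof.
apply: op_bound_limit => d d0; have [f Pf fa] := rc_dense a d0.
exists f; last by move=> x; apply: le_trans (jmap_dist a x Pf) (ltW fa).
apply: op_bound_le (rc_op_bound Pf).
have := nrm_dist_triangle a (rc f) 0; rewrite !subr0 nrmBC; lra.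
Qed.

(** If [f] of C_c is close to [a], the matrix bound of [f] exceeds that of [jmap a] by
    at most the norm of [a - f]. *)
Lemma norm_le_op_bound a C : 0 <= C -> op_bound (jmap a) C -> nrm a <= C.
Proof.
move=> C0 aC; apply/ler_addgt0Pr => e e0.
have e20 : 0 < e / 2 by rewrite divr_gt0.
have [f Pf fa] := rc_dense a e20.
have fC : op_bound f (C + nrm (a - rc f)).
  have := op_boundD aC (jmap_op_bound (rc f - a)).
  rewrite nrmBC [X in op_bound X](_ : _ = f)//; apply/funext => x.
  by rewrite jmapB (jmap_rc Pf) addrC subrK.
have h := rc_norm_le Pf (addr_ge0 C0 (nrm_ge0 _)) fC.
have := nrm_dist_triangle (rc f) a 0; rewrite !subr0; lra.
Qed.

(** If [jmap a] vanishes, so do all the matrices that compute the norm of [a]. *)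
Lemma jmap_inj a b : (forall x, jmap a x = jmap b x) -> a = b.
Proof.
move=> ab; apply/eqP; rewrite -subr_eq0; apply/eqP/nrm_eq0/eqP.
rewrite eq_le nrm_ge0 andbT; apply: norm_le_op_bound => //.
rewrite (_ : jmap _ = fun=> 0); first exact: op_bound0.
by apply/funext => x; rewrite jmapB ab subrr.
Qed.

Lemma jmap_le a x : nrm (jmap a x) <= nrm a.
Proof. exact: op_bound_point (jmap_op_bound a). Qed.

Lemma jmap_continuous a : Kcontinuous (jmap a).
Proof.
move=> x; apply/(continuous_nrmP (V := (R[i])^o)) => e e0.
have e30 : 0 < e / 3 by rewrite divr_gt0.
have [f Pf fa] := rc_dense a e30.
have cf := Cc_continuous Pf.
have /(continuous_nrmP (V := (R[i])^o))/(_ _ e30) := cf x.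
apply: filterS => y fxy.
have h1 := jmap_dist a x Pf; have h2 := jmap_dist a y Pf.
have h3 := nrm_dist_triangle (f x) (jmap a x) (jmap a y).
have h4 := nrm_dist_triangle (f y) (f x) (jmap a y).
rewrite [nrm (f y - _)]nrmBC in h4; lra.
Qed.

Lemma closed_nrm_ge f (e : R) : Kcontinuous f -> closed [set x | e <= nrm (f x)].
Proof.
move=> /nrm_continuous cf.
rewrite (_ : [set x | _] = (fun x => nrm (f x)) @^-1` [set t | e <= t])//.
by apply: closed_comp => // x _; exact: cf.
Qed.

Lemma jmap_vanish a (e : R) : 0 < e -> compact [set x | e <= nrm (jmap a x)].
Proof.
move=> e0; have [f Pf fa] := rc_dense a e0.
have /CcP[_ [L [cL _ fL]]] := Pf.
apply: subclosed_compact cL _; first exact/closed_nrm_ge/jmap_continuous.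
move=> x /= ax; apply: fL; apply/eqP => fx.
by have := jmap_dist a x Pf; rewrite fx subr0; lra.
Qed.

Lemma jmap_C0 a : C0 (jmap a).
Proof.
split; first exact: jmap_continuous.
move=> _ /positive_complex[e e0 ->]; rewrite (_ : [set x | _] = [set x | e <= nrm (jmap a x)]).
  exact: jmap_vanish.
by apply/seteqP; split=> x /=; rewrite nrmE lecR.
Qed.

Lemma nrm_cmul a b : nrm (cmul a b) <= nrm a * nrm b.
Proof. by rewrite -lecR rmorphM /= -!nrmE cmul_norm. Qed.

Lemma nrm_cstar_mul a : nrm (cmul (cstar a) a) = nrm a ^+ 2.
Proof. by apply: (@complexI R); rewrite rmorphXn /= -!nrmE cstar_norm. Qed.

(** The C*-identity gives [|a|^2 <= |a^*| |a|]. *)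
Lemma nrm_cstar a : nrm (cstar a) = nrm a.
Proof.
suff le b : nrm b <= nrm (cstar b).
  by apply/eqP; rewrite eq_le le -{2}(cstarK a) le.
have := nrm_cmul (cstar b) b; rewrite nrm_cstar_mul expr2.
have [->|b0] := eqVneq (nrm b) 0; first by move=> _; exact: nrm_ge0.
by rewrite ler_pM2r// lt_neqAle eq_sym b0 nrm_ge0.
Qed.

Lemma cstarN a : cstar (- a) = - cstar a.
Proof. by rewrite -scaleN1r cstarZ rmorphN1 scaleN1r. Qed.

Lemma cstarB a b : cstar (a - b) = cstar a - cstar b.
Proof. by rewrite cstarD cstarN. Qed.

Lemma cmulNl a b : cmul (- a) b = - cmul a b.
Proof. by rewrite -scaleN1r cmulZl scaleN1r. Qed.

Lemma cmulNr a b : cmul a (- b) = - cmul a b.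
Proof. by rewrite -scaleN1r cmulZr scaleN1r. Qed.

Lemma cmulBl a b c : cmul (a - b) c = cmul a c - cmul b c.
Proof. by rewrite cmulDl cmulNl. Qed.

Lemma cmulBr a b c : cmul a (b - c) = cmul a b - cmul a c.
Proof. by rewrite cmulDr cmulNr. Qed.

Lemma nrm_cmulB a b a' b' : nrm (cmul a b - cmul a' b') <=
  nrm (a - a') * nrm b + nrm a' * nrm (b - b').
Proof.
have -> : cmul a b - cmul a' b' = cmul (a - a') b + cmul a' (b - b').
  by rewrite cmulBl cmulBr addrA subrK.
by apply: le_trans (nrmD _ _) _; apply: lerD; exact: nrm_cmul.
Qed.

Lemma jmap_star a x : jmap (cstar a) x = (jmap a (inv x))^*.
Proof.
apply: eq_of_nrm => e e0; have e20 : 0 < e / 2 by rewrite divr_gt0.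
have [f Pf fa] := rc_dense a e20.
have Pf' : Cc setT (involution f) by exact: Cc_involution Pf.
have h1 := jmap_dist a (inv x) Pf.
have := jmap_dist (cstar a) x Pf'; rewrite rc_in_star// -cstarB nrm_cstar => h2.
have h3 := nrm_dist_triangle (involution f x) (jmap (cstar a) x) (jmap a (inv x))^*.
rewrite [X in _ <= _ + X]nrmBC involutionE -rmorphB /= nrm_conj in h3.
rewrite involutionE in h2; lra.
Qed.

End fourier_map.

(** * Subalgebras attached to open sets *)

(** Used to extend identities from C_c to its completion. *)
Lemma eq_on_closure (R : realType) (V : pseudoMetricNormedZmodType R[i])
    (W : normedZmodType R[i]) (M : set V) (phi psi : V -> W) (K : R) :
  (forall a b, nrm (phi a - phi b) <= K * nrm (a - b)) ->
  (forall a b, nrm (psi a - psi b) <= K * nrm (a - b)) ->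
  (forall a, M a -> phi a = psi a) -> forall a, closure M a -> phi a = psi a.
Proof.
move=> lphi lpsi e a /closure_nrmP Ma; apply: eq_of_nrm => d d0.
pose K' := `|K| + 1; have K'0 : 0 < K' by rewrite ltr_wpDl.
have KK : K <= K' by rewrite (le_trans (ler_norm _))// lerDl.
have d'0 : 0 < d / (2 * K') by rewrite divr_gt0// mulr_gt0.
have [b Mb ab] := Ma _ d'0.
have h1 := lphi a b; have h2 := lpsi a b.
have h3 := nrm_dist_triangle (phi b) (phi a) (psi a).
rewrite [X in _ <= _ + X]nrmBC (e _ Mb) in h3; rewrite (e _ Mb) in h1.
have h4 : K * nrm (a - b) <= K' * nrm (a - b) by rewrite ler_wpM2r// nrm_ge0.
have h5 : K' * nrm (a - b) <= K' * (d / (2 * K')) by rewrite ler_pM2l// ltW.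
have : K' * (d / (2 * K')) = d / 2 by field; rewrite gt_eqF.
lra.
Qed.

Lemma closure_cstar_subalgebra (R : realType) (G : etale_groupoid) (B : reduced_cstar_algebra R G)
    (N : set B) : N 0 ->
  (forall a b, N a -> N b -> N (a + b)) ->
  (forall (k : R[i]) a, N a -> N (k *: a)) ->
  (forall a b, N a -> N b -> N (cmul a b)) ->
  (forall a, N a -> N (cstar a)) -> cstar_subalgebra (closure N).
Proof.
move=> N0 ND NZ NM NS.
have half (e : R) : 0 < e -> 0 < e / 2 by move=> e0; rewrite divr_gt0.
split; first split.
- exact: closed_closure.
- exact: subset_closure.
- move=> a b /closure_nrmP ca /closure_nrmP cb; apply/closure_nrmP => e e0.
  have [a' Na aa] := ca _ (half _ e0); have [b' Nb bb] := cb _ (half _ e0).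
  exists (a' + b'); first exact: ND.
  by rewrite opprD addrACA [e]splitr (le_lt_trans (nrmD _ _))// ltrD.
- move=> k a /closure_nrmP ca; apply/closure_nrmP => e e0.
  have k0 : 0 < nrm k + 1 by rewrite ltr_wpDl// nrm_ge0.
  have [a' Na aa] := ca (e / (nrm k + 1)) (divr_gt0 e0 k0).
  exists (k *: a'); first exact: NZ.
  rewrite -scalerBr nrmZ.
  have h : (nrm k + 1) * nrm (a - a') < e by rewrite mulrC -ltr_pdivlMr.
  by have := nrm_ge0 (a - a'); lra.
- move=> a b /closure_nrmP ca /closure_nrmP cb; apply/closure_nrmP => e e0.
  have a0 := nrm_ge0 a; have b0 := nrm_ge0 b.
  have Np : 0 < 2 * (nrm a + nrm b + 1) by lra.
  pose d := Num.min 1 (e / (2 * (nrm a + nrm b + 1))).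
  have d0 : 0 < d by rewrite lt_min ltr01 divr_gt0.
  have d1 : d <= 1 by rewrite ge_min lexx.
  have d3 : d * (2 * (nrm a + nrm b + 1)) <= e.
    by rewrite -ler_pdivlMr// ge_min lexx orbT.
  have [a' Na aa] := ca _ d0; have [b' Nb bb] := cb _ d0.
  exists (cmul a' b'); first exact: NM.
  apply: le_lt_trans (nrm_cmulB _ _ _ _) _.
  have h := nrm_dist_triangle a a' 0; rewrite !subr0 nrmBC in h.
  have h1 : nrm (a - a') * nrm b <= d * nrm b by rewrite ler_wpM2r// ltW.
  have h2 : nrm a' * nrm (b - b') <= (nrm a + d) * d.
    by apply: ler_pM; rewrite ?nrm_ge0//; lra.
  have h3 : (nrm a + d) * d <= (nrm a + 1) * d by rewrite ler_wpM2r//; lra.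
  lra.
- move=> a /closure_nrmP ca; apply/closure_nrmP => e e0.
  have [a' Na aa] := ca _ e0; exists (cstar a'); first exact: NS.
  by rewrite -cstarB nrm_cstar.
Qed.

Section subalgebras.
Variables (R : realType) (G : etale_groupoid) (A : reduced_cstar_algebra R G).
Implicit Types (f g : G -> R[i]) (x y z u : G) (S P Q L H : set G) (C : R) (a b c : A).
Implicit Types M D : set A.
Local Notation r := (@eg_r G).
Local Notation s := (@eg_s G).
Local Notation inv := (@eg_inv G).
Local Notation "x ** y" := (@eg_mul G x y) (at level 40, left associativity).
Local Notation rc := (rc_in A).

Lemma rc_Cr P f : Cc P f -> Cr A P (rc f).
Proof. by move=> Pf; apply: subset_closure; exists f. Qed.

Lemma CrT a : Cr A setT a.
Proof. by rewrite /Cr rc_in_dense. Qed.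

Lemma closed_Aset P : closed (Aset A P).
Proof.
move=> a /closure_nrmP ca x nPx; apply: eq_of_nrm => e e0.
have [b /(_ x nPx) bx ab] := ca e e0.
by rewrite subr0 -[jmap a x]subr0 -bx -jmapB (le_trans (jmap_le _ _))// ltW.
Qed.

Lemma Cc_out (K : numFieldType) P (f : G -> K) x : Cc P f -> ~ P x -> f x = 0.
Proof.
by move=> /CcP[_ [L [_ LP fL]]] nP; apply/eqP/negPn/negP => /fL/LP.
Qed.

Lemma Cc_supp (K : numFieldType) P (f : G -> K) x : Cc P f -> f x != 0 -> P x.
Proof. by move=> Pf; apply: contra_neqP => /(Cc_out Pf). Qed.

Lemma rc_Aset P f : Cc P f -> Aset A P (rc f).
Proof. by move=> Pf x nP; rewrite (jmap_rc A Pf) (Cc_out Pf). Qed.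

Lemma Cr_sub_Aset P : Cr A P `<=` Aset A P.
Proof.
move=> a Pa; apply: closed_Aset; apply: closureS Pa => _ [f Pf <-].
exact: rc_Aset.
Qed.

(** The matrix of [jmap a] has at most one nonzero entry in each row and column. *)
Lemma nrm_bisection S a C : bisection S -> Aset A S a -> 0 <= C ->
  (forall x, nrm (jmap a x) <= C) -> nrm a <= C.
Proof.
move=> [_ h1 h2] Sa C0 aC; apply: norm_le_op_bound => //.
apply: op_bound_bisection C0 h1 h2 _ aC => x; apply: contra_neqP; exact: Sa.
Qed.

Lemma soft_threshold_jmap_Cc P a (e : R) : 0 < e -> (forall x, ~ P x -> nrm (jmap a x) < e) ->
  Cc P (fun x => soft_threshold e (jmap a x)).
Proof.
move=> e0 aP; apply: soft_threshold_Cc => //; first exact: jmap_continuous.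
  exact: jmap_vanish.
by move=> x /= ex; apply: contrapT => /aP; lra.
Qed.

(** Soft thresholds of [jmap a] are in C_c(S) and converge uniformly to [jmap a],
    hence in norm. *)
Lemma Aset_bisection S : bisection S -> Aset A S = Cr A S.
Proof.
move=> bS; apply/seteqP; split; last exact: Cr_sub_Aset.
move=> a Sa; apply/closure_nrmP => e e0; have e20 : 0 < e / 2 by rewrite divr_gt0.
have Sf : Cc S (fun x => soft_threshold (e / 2) (jmap a x)).
  by apply: soft_threshold_jmap_Cc => // x nS; rewrite Sa// nrm0.
exists (rc (fun x => soft_threshold (e / 2) (jmap a x))); first by eexists; first exact: Sf.
suff : nrm (a - rc (fun x => soft_threshold (e / 2) (jmap a x))) <= e / 2 by lra.
apply: (nrm_bisection bS); [|exact: ltW|].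
  by move=> x nS; rewrite jmapB (jmap_rc A Sf) Sa// /soft_threshold mul0r subr0.
by move=> x; rewrite jmapB (jmap_rc A Sf); exact: soft_threshold_dist.
Qed.

Lemma C0_unitsE : C0_units A = Aset A (units G).
Proof.
apply/seteqP; split=> [a []//|a ha]; split=> //; exact: jmap_C0.
Qed.

(** The unit space is a bisection, and so the diagonal has two descriptions:
    as a set of functions and as a closure. *)
Lemma C0_unitsCr : C0_units A = Cr A (units G).
Proof. by rewrite C0_unitsE; apply: Aset_bisection; exact: bisection_units. Qed.

(** The formula holds on C_c and both sides are Lipschitz in each factor. *)
Lemma jmap_mulr a b x : C0_units A b ->
  jmap (cmul a b) x = jmap a x * jmap b (s x).
Proof.
rewrite C0_unitsCr => ub.
have step g : Cc (units G) g ->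
    jmap (cmul a (rc g)) x = jmap a x * jmap (rc g) (s x).
  move=> ug; apply: (@eq_on_closure R A (R[i]) (rc @` Cc setT) (fun a => jmap (cmul a (rc g)) x)
    (fun a => jmap a x * jmap (rc g) (s x)) (nrm (rc g))); last exact: CrT.
  - move=> {ub}a c; rewrite -jmapB -cmulBl (le_trans (jmap_le _ _))// mulrC.
    exact: nrm_cmul.
  - move=> {ub}a c; rewrite -mulrBl -jmapB nrmM mulrC.
    by apply: ler_pM; rewrite ?nrm_ge0// jmap_le.
  - move=> _ [f Pf <-]; rewrite -rc_inM//; last exact: CcT ug.
    rewrite !(@jmap_rc _ _ A setT)//; [|exact: CcT ug|exact: CcT_conv Pf (CcT ug)].
    by rewrite conv_unitsr// => z; exact: Cc_supp ug.
apply: (@eq_on_closure R A (R[i]) (rc @` Cc (units G)) (fun b => jmap (cmul a b) x)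
    (fun b => jmap a x * jmap b (s x)) (nrm a)) => //.
- by move=> {ub}b c; rewrite -jmapB -cmulBr (le_trans (jmap_le _ _))// nrm_cmul.
- move=> {ub}b c; rewrite -mulrBr -jmapB nrmM.
  by apply: ler_pM; rewrite ?nrm_ge0// jmap_le.
- by move=> _ [g ug <-]; exact: step.
Qed.

Lemma C0_units_star a : C0_units A a -> C0_units A (cstar a).
Proof.
rewrite C0_unitsE => ua x nx; rewrite jmap_star ua ?rmorph0// => ux; apply: nx.
by rewrite -(inv_invK x) (unit_inv ux).
Qed.

Lemma jmap_mull a b x : C0_units A b ->
  jmap (cmul b a) x = jmap b (r x) * jmap a x.
Proof.
move=> ub; rewrite -(cstarK (cmul b a)) cstarM jmap_star jmap_mulr.
  rewrite eg_s_inv !jmap_star rmorphM /= !conjCK inv_invK mulrC.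
  by rewrite unit_inv//; exact: units_r.
exact: C0_units_star.
Qed.

Lemma cstar_subalgebra_Cr H : subgroupoid H -> cstar_subalgebra (Cr A H).
Proof.
move=> [HM HV]; apply: closure_cstar_subalgebra.
- exists (fun=> 0); first exact: Cc0.
  by apply: jmap_inj => x; rewrite (jmap_rc A (Cc0 _ setT)) jmap0.
- move=> _ _ [f Pf <-] [g Pg <-]; exists (fun x => f x + g x); first exact: CcD.
  by rewrite rc_inD//; [exact: CcT Pf|exact: CcT Pg].
- move=> k _ [f Pf <-]; exists (fun x => k * f x); first exact: CcZ.
  by rewrite rc_inZ//; exact: CcT Pf.
- move=> _ _ [f Pf <-] [g Pg <-]; exists (convolution f g).
    by apply: (Cc_conv _ Pf Pg).
  by rewrite rc_inM//; [exact: CcT Pf|exact: CcT Pg].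
- move=> _ [f Pf <-]; exists (involution f).
    by apply: Cc_sub (Cc_involution Pf) => x /= /HV; rewrite inv_invK.
  by rewrite rc_in_star//; exact: CcT Pf.
Qed.

Lemma subgroupoid_units : open_wide_subgroupoid (units G).
Proof.
split=> //; first exact: open_units; split.
  move=> x y ux uy; rewrite (unit_s ux) (unit_r uy) => xy.
  by rewrite -xy -{2}(unit_s ux) eg_mul_s.
by move=> x ux; rewrite unit_inv.
Qed.

Lemma cstar_subalgebra_C0_units : cstar_subalgebra (C0_units A).
Proof.
by rewrite C0_unitsCr; apply: cstar_subalgebra_Cr; case: subgroupoid_units.
Qed.

Lemma abelian_C0_units : abelian_cstar_subalgebra (C0_units A).
Proof.
split; first exact: cstar_subalgebra_C0_units.
move=> a b ua ub; apply: jmap_inj => x; rewrite !jmap_mulr//.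
have [ux|nx] := pselect (units G x); first by rewrite unit_s// mulrC.
by move: ua ub; rewrite C0_unitsE => ua ub; rewrite (ua x nx) (ub x nx) !mul0r.
Qed.

Lemma ex_Cc P x : open P -> P x -> exists2 f : G -> R[i], Cc P f & f x = 1.
Proof.
move=> oP Px; have [phi [Pphi _ phi1]] := ex_bump R oP Px.
exists (fun y => (phi y)%:C); first exact: Cc_real.
by rewrite (nbhs_singleton phi1).
Qed.

Lemma spectrum_Cr H : open H -> spectrum (Cr A H) = H.
Proof.
move=> oH; apply/seteqP; split=> x.
  by move=> [a /Cr_sub_Aset Ha]; apply: contra_neqP; exact: Ha.
move=> Hx; have [f Hf fx] := ex_Cc oH Hx; exists (rc f); first exact: rc_Cr.
by rewrite (jmap_rc A Hf) fx oner_eq0.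
Qed.

Lemma open_jmap a : open [set x | jmap a x != 0].
Proof.
have n0 x : (jmap a x != 0) = (0 < nrm (jmap a x)).
  apply/idP/idP => h.
    rewrite lt_neqAle nrm_ge0 andbT eq_sym; apply: contra_neq h; exact: nrm_eq0.
  by apply/eqP => e; rewrite e nrm0 ltxx in h.
rewrite openE => x /=; rewrite n0 => ax.
have cn := nrm_continuous (@jmap_continuous _ _ A a).
have /cvgrPdist_lt/(_ _ ax) := cn x.
by apply: filterS => y /=; rewrite n0 ltr_norml; lra.
Qed.

Lemma intermediate_diagonal_bimodule M : cstar_subalgebra M -> C0_units A `<=` M ->
  diagonal_bimodule M.
Proof.
by move=> [hM MM _] uM; split=> // a b Ma /uM Mb; split; exact: MM.
Qed.

Lemma Cr_mono (P Q : set G) : P `<=` Q -> Cr A P `<=` Cr A Q.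
Proof.
by move=> PQ; apply: closureS => _ [f Pf <-]; exists f => //; exact: Cc_sub Pf.
Qed.

(** By partitions of unity, a closed subspace containing the functions supported
    in the members of an open cover of [P] contains all of C_c(P). *)
Lemma Cr_sub_cover (I : Type) (S : I -> set G) P (D : set A) :
  closed_subspace D -> (forall i, open (S i)) ->
  (forall x, P x -> exists i, S i x) ->
  (forall i f, Cc (P `&` S i) f -> D (rc f)) -> Cr A P `<=` D.
Proof.
move=> [cD D0 DD _] oS PS h a Pa; apply: cD; apply: closureS Pa => _ [f Pf <-].
apply: (@Cc_ind G R P I S (fun f => D (rc f)) oS PS _ _ h f Pf).
  rewrite (_ : rc _ = 0)//; apply: jmap_inj => x.
  by rewrite (jmap_rc A (Cc0 _ setT)) jmap0.
move=> f1 f2 /CcT P1 /CcT P2 D1 D2; rewrite rc_inD//; exact: DD.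
Qed.

End subalgebras.

(** * Schur multipliers and amenability *)

(** The left-hand side is twice the minimum of [a] and [b]. *)
Lemma two_min_le_sqrt (R : rcfType) (a b : R) : 0 <= a -> 0 <= b ->
  a + b - `|b - a| <= 2 * (Num.sqrt a * Num.sqrt b).
Proof.
move=> a0 b0; have [ab|/ltW ba] := lerP a b.
  have h : Num.sqrt a * Num.sqrt a <= Num.sqrt a * Num.sqrt b.
    by apply: ler_wpM2l; rewrite ?sqrtr_ge0// ler_wsqrtr.
  by rewrite -expr2 sqr_sqrtr// in h; lra.
have h : Num.sqrt b * Num.sqrt b <= Num.sqrt a * Num.sqrt b.
  by apply: ler_wpM2r; rewrite ?sqrtr_ge0// ler_wsqrtr.
by rewrite -expr2 sqr_sqrtr// in h; lra.
Qed.

Section schur.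
Variables (R : realType) (G : etale_groupoid).
Implicit Types (f : G -> R[i]) (x y z u : G) (C : R).
Local Notation r := (@eg_r G).
Local Notation s := (@eg_s G).
Local Notation inv := (@eg_inv G).
Local Notation "x ** y" := (@eg_mul G x y) (at level 40, left associativity).

Lemma sum_translate x (Z : seq G) (F : G -> R) : uniq Z ->
  (forall z, z \in Z -> r z = s x) ->
  (forall z, r z = s x -> F (x ** z) != 0 -> z \in Z) ->
  \sum_(w \in r_fiber (r x)) F w = \sum_(z <- Z) F (x ** z).
Proof.
move=> uZ Zx FZ; rewrite (@fsum_seq _ _ _ [seq x ** z | z <- Z]); first by rewrite big_map.
- rewrite map_inj_in_uniq// => z w zZ wZ e.
  by rewrite -(@mulVK _ x z) ?Zx// e mulVK// Zx.
- by move=> _ /mapP[z zZ ->]; rewrite /r_fiber /= eg_r_mul// Zx.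
- move=> w rw Fw; apply/mapP; exists (inv x ** w); last by rewrite mulKV.
  apply: FZ; last by rewrite mulKV.
  by rewrite eg_r_mul ?eg_r_inv ?eg_s_inv.
Qed.

Variable g : G -> R.
Hypotheses (Cg : Cc setT g) (g0 : forall x, 0 <= g x).
Hypothesis g1 : forall u, units G u -> \sum_(w \in r_fiber u) g w <= 1.

Definition schur_root x : R[i] := (Num.sqrt (g x))%:C.

(** The positive type function attached to the function [g] of an approximate
    invariant mean. *)
Definition schur_multiplier : G -> R[i] :=
  convolution schur_root (involution schur_root).
Local Notation h := schur_multiplier.

Lemma Cc_schur_root : Cc setT schur_root.
Proof.
move/CcP : Cg => [cg [L [cL _ gL]]]; apply: Cc_real; apply/CcP; split.
  move=> x; apply: (@cvg_comp _ _ _ g Num.sqrt _ (nbhs (g x))); first exact: cg.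
  exact: sqrt_continuous.
exists L; split=> // x; rewrite sqrtr_eq0 -ltNge => gx; apply: gL.
by rewrite gt_eqF.
Qed.

Lemma Cc_schur : Cc setT h.
Proof.
apply: CcT_conv; first exact: Cc_schur_root.
exact: CcT (Cc_involution Cc_schur_root).
Qed.

(** Over a source fibre the multiplier factors through vectors indexed by the range
    fibre of [u], whose squared norms are sums of [g] over range fibres. *)
Lemma schur_matrix u (X : seq G) : (forall x, x \in X -> s x = u) ->
  exists Z : seq G, [/\ uniq Z, forall z, z \in Z -> r z = u,
    forall x z, x \in X -> r z = u -> g (x ** z) != 0 -> z \in Z &
    forall x y, x \in X -> y \in X -> h (x ** inv y) =
      (\sum_(z <- Z) Num.sqrt (g (x ** z)) * Num.sqrt (g (y ** z)))%:C].
Proof.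
move=> Xu; move/CcP : Cg => [_ [L [cL _ gL]]].
have [Z [uZ Zu ZP]] : exists l' : seq G, [/\ uniq l',
    forall z, z \in l' -> r_fiber u z &
    forall x z, x \in X -> r_fiber u z -> L (x ** z) -> z \in l'].
  apply: (@translate_list G L u (fun x z => x ** z) (fun x w => inv x ** w)
    (r_fiber u) X r); first by move=> w; exact: finite_r_fiber.
    by move=> x z xX rz; rewrite mulVK ?Xu// eg_r_mul ?Xu.
  by move=> x xX w Lw rw; rewrite /r_fiber /= eg_r_mul ?eg_r_inv ?eg_s_inv// Xu.
have gZ x z : x \in X -> r z = u -> g (x ** z) != 0 -> z \in Z.
  by move=> xX rz gxz; apply: (ZP x) => //; exact: gL.
exists Z; split=> // x y xX yX; have xy : s x = s y by rewrite !Xu.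
rewrite /h (@conv_seq _ _ _ _ _ [seq inv (y ** z) | z <- Z]).
- rewrite big_map rmorph_sum big_seq [RHS]big_seq; apply: eq_bigr => z zZ.
  have yz : s y = r z by rewrite Zu// Xu.
  rewrite involutionE !inv_invK rmorphM /=.
  have -> : x ** inv y ** (y ** z) = x ** z.
    by rewrite eg_mulA ?s_mulV ?eg_r_mul// mulVKr.
  by congr (_ * _); rewrite /schur_root; exact: conjc_real.
- rewrite map_inj_in_uniq// => z w zZ wZ /(congr1 inv); rewrite !inv_invK => e.
  by rewrite -(@mulVK _ y z) ?Zu ?Xu// e mulVK// Zu// Xu.
- move=> _ /mapP[z zZ ->]; rewrite eg_s_inv s_mulV//.
  by rewrite eg_r_mul// Zu// Xu.
- move=> w; rewrite s_mulV// => sw _; rewrite involutionE => hw.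
  have yw : r (inv w) = r y by rewrite eg_r_inv.
  apply/mapP; exists (inv y ** inv w); last by rewrite mulKV// inv_invK.
  apply: (gZ y) => //; first by rewrite eg_r_mul ?eg_r_inv ?eg_s_inv// Xu.
  rewrite mulKV//; apply: contra_neq hw => gw.
  by rewrite /schur_root gw sqrtr0 !rmorph0.
Qed.

(** Multiplying the matrix of [f] entrywise by the multiplier amounts to summing over
    [z] the form of [f] applied to the vectors multiplied by the root of
    [g (x z)]; the squared norms of these vectors add up to at most the original
    ones since the sums of [g] are at most 1. *)
Lemma schur_op_bound f C : 0 <= C -> op_bound f C ->
  op_bound (fun x => h x * f x) C.
Proof.
move=> C0 fC X zeta eta uX sX.
case: X uX sX => [|x0 X'] uX sX; first by rewrite !big_nil nrm0 addr0 mulr0.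
set X := x0 :: X' in uX sX *; pose u := s x0.
have Xu x : x \in X -> s x = u by move=> xX; apply: sX => //; exact: mem_head.
have [Z [uZ Zu ZP hZ]] := schur_matrix Xu.
pose q x z := Num.sqrt (g (x ** z)).
have gle x : x \in X -> \sum_(z <- Z) q x z ^+ 2 <= 1.
  move=> xX; under eq_bigr do rewrite sqr_sqrtr//.
  rewrite -(@sum_translate x Z g)//.
  - exact/g1/units_r.
  - by move=> z /Zu ->; rewrite Xu.
  - by move=> z; rewrite Xu// => rz; exact: ZP.
have -> : \sum_(x <- X) \sum_(y <- X) zeta x * (h (x ** inv y) * f (x ** inv y)) * eta y =
    \sum_(z <- Z) \sum_(x <- X) \sum_(y <- X)
      (zeta x * (q x z)%:C) * f (x ** inv y) * ((q y z)%:C * eta y).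
  rewrite [RHS]exchange_big big_seq [RHS]big_seq; apply: eq_bigr => x xX.
  rewrite [RHS]exchange_big big_seq [RHS]big_seq; apply: eq_bigr => y yX.
  rewrite hZ// rmorph_sum mulr_suml mulr_sumr mulr_suml; apply: eq_bigr => z _.
  rewrite rmorphM /= /q; ring.
apply: le_trans (nrm_sum _ _ _) _.
apply: (@le_trans _ _ (\sum_(z <- Z) C / 2 *
    (\sum_(x <- X) nrm (zeta x * (q x z)%:C) ^+ 2 +
     \sum_(y <- X) nrm ((q y z)%:C * eta y) ^+ 2))).
  by apply: ler_sum => z _; exact: (fC X (fun x => zeta x * (q x z)%:C)
    (fun y => (q y z)%:C * eta y)).
rewrite -mulr_sumr ler_wpM2l ?divr_ge0// big_split.
have le1 (w : G -> R[i]) : \sum_(z <- Z) \sum_(x <- X) nrm (w x) ^+ 2 * q x z ^+ 2 <=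
    \sum_(x <- X) nrm (w x) ^+ 2.
  rewrite exchange_big big_seq [leRHS]big_seq; apply: ler_sum => x xX.
  by rewrite -mulr_sumr; apply: ler_piMr; [exact: sqr_ge0|exact: gle].
apply: lerD.
  apply: le_trans (le1 zeta); apply: ler_sum => z _; apply: ler_sum => x _.
  by rewrite nrmM nrm_real exprMn real_normK ?num_real.
apply: le_trans (le1 eta); apply: ler_sum => z _; apply: ler_sum => x _.
by rewrite nrmM nrm_real exprMn real_normK ?num_real// mulrC.
Qed.

Lemma schur_value x : exists Z : seq G, [/\ uniq Z, forall z, z \in Z -> r z = s x,
    forall z, r z = s x -> g (x ** z) != 0 \/ g z != 0 -> z \in Z &
    h x = (\sum_(z <- Z) Num.sqrt (g (x ** z)) * Num.sqrt (g z))%:C].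
Proof.
have Xu y : y \in [:: x; s x] -> s y = s x.
  by rewrite !inE => /orP[]/eqP ->; rewrite ?eg_ss.
have [Z [uZ Zu ZP hZ]] := schur_matrix Xu.
have sz z : r z = s x -> s x ** z = z by move=> <-; rewrite eg_mul_r.
exists Z; split=> //.
  move=> z rz [gz|gz]; first by apply: (ZP x) => //; rewrite inE eqxx.
  by apply: (ZP (s x)); rewrite ?sz// !inE eqxx orbT.
have := hZ x (s x); rewrite !inE !eqxx orbT => /(_ isT isT).
rewrite unit_inv ?eg_mul_s; last exact: units_s.
move=> ->; congr (_%:C); rewrite big_seq [RHS]big_seq; apply: eq_bigr => z /Zu rz.
by rewrite sz.
Qed.

(** The value at [x] is the inner product of two vectors of squared norm at most 1,
    namely the roots of [g] and of its translate by [x]; it is close to 1 when both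
    norms are and when the translate is close to [g]. *)
Lemma schur_bounds x :
  nrm (h x) <= 1 /\
  forall e : R, 1 - \sum_(w \in r_fiber (r x)) g w < e ->
    1 - \sum_(w \in r_fiber (s x)) g w < e ->
    \sum_(w \in r_fiber (r x)) `|g (inv x ** w) - g w| < e ->
    nrm (1 - h x) <= 2 * e.
Proof.
have [Z [uZ Zx ZP ->]] := schur_value x.
have sz z : z \in Z -> s x ** z = z by move=> /Zx <-; rewrite eg_mul_r.
have S1 : \sum_(w \in r_fiber (r x)) g w = \sum_(z <- Z) g (x ** z).
  by apply: sum_translate => // z rz gz; apply: ZP => //; left.
have S2 : \sum_(w \in r_fiber (s x)) g w = \sum_(z <- Z) g z.
  have -> : s x = r (s x) by rewrite eg_rs.
  rewrite (@sum_translate (s x) Z)// ?eg_ss//.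
    by rewrite big_seq [RHS]big_seq; apply: eq_bigr => z /sz ->.
  by move=> z rz; rewrite -{1}rz eg_mul_r => gz; apply: ZP => //; right.
have S3 : \sum_(w \in r_fiber (r x)) `|g (inv x ** w) - g w| =
    \sum_(z <- Z) `|g z - g (x ** z)|.
  rewrite (@sum_translate x Z (fun w => `|g (inv x ** w) - g w|))//.
    by rewrite big_seq [RHS]big_seq; apply: eq_bigr => z /Zx rz; rewrite mulVK.
  move=> z rz; rewrite mulVK// normr_eq0 subr_eq0 => gz; apply: ZP => //.
  have [gxz|gxz] := eqVneq (g (x ** z)) 0; last by left.
  by right; rewrite gxz in gz.
rewrite S1 S2 S3.
set T := \sum_(z <- Z) Num.sqrt _ * _.
have T0 : 0 <= T by apply: sumr_ge0 => z _; rewrite mulr_ge0 ?sqrtr_ge0.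
have up : 2 * T <= \sum_(z <- Z) g (x ** z) + \sum_(z <- Z) g z.
  rewrite /T mulr_sumr -big_split; apply: ler_sum => z _ /=.
  rewrite -{2}(sqr_sqrtr (g0 (x ** z))) -{2}(sqr_sqrtr (g0 z)).
  have := sqr_ge0 (Num.sqrt (g (x ** z)) - Num.sqrt (g z)); rewrite !expr2; lra.
have low : \sum_(z <- Z) g (x ** z) + \sum_(z <- Z) g z -
    \sum_(z <- Z) `|g z - g (x ** z)| <= 2 * T.
  rewrite /T mulr_sumr -big_split -sumrB; apply: ler_sum => z _ /=.
  exact: two_min_le_sqrt.
have b1 := g1 (units_r x); rewrite S1 in b1.
have b2 := g1 (units_s x); rewrite S2 in b2.
split; first by rewrite nrm_real ger0_norm//; lra.
move=> e h1 h2 h3; rewrite -[1]/(1%:C) -rmorphB /= nrm_real ler_norml; lra.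
Qed.

End schur.

Section amenable_synthesis.
Variables (R : realType) (G : etale_groupoid) (A : reduced_cstar_algebra R G).
Implicit Types (f : G -> R[i]) (x y z u : G) (C : R) (P : set G) (a : A).
Local Notation r := (@eg_r G).
Local Notation s := (@eg_s G).
Local Notation rc := (rc_in A).

Lemma Cc_cover P f : Cc P f -> exists2 n : nat, (0 < n)%N &
  forall (k : G -> R[i]) C, 0 <= C -> (forall x, k x != 0 -> f x != 0) ->
  (forall x, nrm (k x) <= C) -> op_bound k (n%:R * C).
Proof.
move=> /CcP[_ [L [cL _ fL]]]; have [l [lb Ll]] := compact_bisections cL.
exists (size l).+1 => // k C C0 kf kC.
have kb : op_bound k ((size l)%:R * C).
  by apply: op_bound_cover => // x /kf/fL/Ll.
by apply: op_bound_le kb; rewrite ler_wpM2r// ler_nat.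
Qed.

(** Approximate [a] first by [f] in C_c, then [f] by [h f] for a multiplier [h]
    close to 1 on the support of [f].  As [h] is compactly supported and
    does not increase norms, [h f] can be compared with [h k], where [k] is the soft
    threshold of [jmap a], which lies in C_c(P): a uniform estimate is enough for
    [h (a - k)]. *)
Theorem amenable_Aset P : amenable G R -> open P -> Aset A P = Cr A P.
Proof.
move=> amG oP; apply/seteqP; split; last exact: Cr_sub_Aset.
move=> a Pa; apply/closure_nrmP => e e0.
pose d := e / 5; have d0 : 0 < d by rewrite divr_gt0.
have [f Pf fa] := rc_dense a d0.
have [B B0 fB] := Cc_bounded Pf.
have [m m0 fm] := Cc_cover Pf.
have /CcP[cf [L [cL _ fL]]] := Pf.
(* [schur_bounds] needs the mass of [g] to be close to 1 at both ends of [x]. *)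
pose K := L `|` (r @` L `|` s @` L).
have cK : compact K.
  apply: compactU => //; apply: compactU.
    exact: compact_image (@r_continuous G) cL.
  exact: compact_image (@s_continuous G) cL.
pose t := d / (2 * (m%:R * (B + 1))).
have mB0 : 0 < 2 * (m%:R * (B + 1)).
  by rewrite !mulr_gt0// ?ltr0n//; lra.
have t0 : 0 < t by rewrite divr_gt0.
have [g [Pg g0 g1 gK gt]] := amG K t cK t0.
pose h := schur_multiplier g.
have Ph : Cc setT h by exact: Cc_schur.
have ch := Cc_continuous Ph.
have h1 x : nrm (h x) <= 1 by have [] := schur_bounds Pg g0 g1 x.
have hL x : L x -> nrm (1 - h x) <= 2 * t.
  move=> Lx; have [_] := schur_bounds Pg g0 g1 x; apply.
  - by apply: gK; [exact: units_r|right; left; exists x].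
  - by apply: gK; [exact: units_s|right; right; exists x].
  - by apply: gt; left.
have Phf : Cc setT (fun x => h x * f x) by under eq_fun do rewrite mulrC; exact: CcM.
have b1 : nrm (rc f - rc (fun x => h x * f x)) <= d.
  rewrite -(rcB A Pf Phf); apply: (rc_norm_le A (CcB Pf Phf)); first exact: ltW.
  have := fm (fun x => f x - h x * f x) (B * (2 * t)).
  have Bt0 : 0 <= B * (2 * t) by rewrite mulr_ge0//; lra.
  move=> fmb; apply: (op_bound_le _ (fmb _ _ _)).
  - have : t * (2 * (m%:R * (B + 1))) = d by rewrite divfK// gt_eqF.
    have : 0 <= t * m%:R by rewrite mulr_ge0// ltW.
    lra.
  - exact: Bt0.
  - by move=> x; apply: contra_neq => ->; rewrite mulr0 subrr.
  - move=> x; rewrite -{1}[f x]mul1r -mulrBl nrmM mulrC.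
    have [->|/fL Lx] := eqVneq (f x) 0; first by rewrite nrm0 mul0r.
    by apply: ler_pM; rewrite ?nrm_ge0//; exact: hL.
(* [n] bounds the ratio of the norm to the supremum norm on the support of [h], and
   is fixed before the threshold [e']. *)
have [n n0 hn] := Cc_cover Ph.
pose e' := d / n%:R; have e'0 : 0 < e' by rewrite divr_gt0// ltr0n.
pose k x := soft_threshold e' (jmap a x).
have Pk : Cc P k by apply: soft_threshold_jmap_Cc => // x nP; rewrite Pa// nrm0.
have Phk : Cc P (fun x => h x * k x) by under eq_fun do rewrite mulrC; exact: CcM.
exists (rc (fun x => h x * k x)); first by exists (fun x => h x * k x).
have b2 : nrm (rc (fun x => h x * f x) - rc (fun x => h x * k x)) <= d + d.
  rewrite -(rcB A Phf (CcT Phk)).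
  apply: (rc_norm_le A (CcB Phf (CcT Phk))); first by lra.
  have -> : (fun x => h x * f x - h x * k x) =
      (fun x => h x * jmap (rc f - a) x + h x * (jmap a x - k x)).
    by apply/funext => x; rewrite jmapB (jmap_rc A Pf); ring.
  apply: op_boundD.
    apply: (schur_op_bound Pg g0 g1); first exact: ltW.
    have rfa : nrm (rc f - a) <= d by rewrite nrmBC ltW.
    exact: (op_bound_le rfa (jmap_op_bound (rc f - a))).
  have := hn (fun x => h x * (jmap a x - k x)) e' (ltW e'0).
  have -> : n%:R * e' = d by rewrite mulrC divfK// pnatr_eq0 -lt0n.
  apply.
    by move=> x; apply: contra_neq => ->; rewrite mul0r.
  move=> x; rewrite nrmM -[leRHS]mul1r.
  by apply: ler_pM; rewrite ?nrm_ge0//; exact: soft_threshold_dist.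
have t1 := nrm_dist_triangle (rc f) a (rc (fun x => h x * k x)).
have t2 := nrm_dist_triangle (rc (fun x => h x * f x)) (rc f) (rc (fun x => h x * k x)).
by apply: le_lt_trans t1 _; rewrite /d in fa b1 b2; lra.
Qed.

End amenable_synthesis.

(** * Normalizers of the diagonal *)

Section normalizers.
Variables (R : realType) (G : etale_groupoid) (A : reduced_cstar_algebra R G).
Implicit Types (f : G -> R[i]) (x y z u : G) (C : R) (P H S : set G) (a b n : A).
Implicit Types M : set A.
Local Notation r := (@eg_r G).
Local Notation s := (@eg_s G).
Local Notation inv := (@eg_inv G).
Local Notation "x ** y" := (@eg_mul G x y) (at level 40, left associativity).
Local Notation rc := (rc_in A).

Lemma finite_closed (D : set G) : finite_set D -> closed D.
Proof.
by move=> /finite_compact cD; apply: compact_closed; first exact: eg_hausdorff.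
Qed.

(** Otherwise [x y^-1] is not a unit, and [n b n^*] vanishes there for each [b] in
    the diagonal.  Approximate [n] by [f] in C_c and choose [b] equal to 1 at the
    common source [u] and to 0 at the other sources of the finitely many points
    of the support of [f] in the range fibre of [y].  As [u] has trivial isotropy,
    the sum computing [f b f^*] at [x y^-1] reduces to [f x] times the conjugate
    of [f y]. *)
Lemma normalizer_free_fibre n x y :
  (forall b, C0_units A b -> C0_units A (cmul (cmul n b) (cstar n))) ->
  s_fiber (s x) `&` r_fiber (s x) = [set s x] ->
  jmap n x != 0 -> jmap n y != 0 -> s x = s y -> x = y.
Proof.
move=> nN free nx ny xy; apply: contrapT => xny.
pose u := s x; pose N := nrm n; have N0 : 0 <= N by exact: nrm_ge0.
have nu : ~ units G (x ** inv y) by move=> /(mulV_unit xy).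
(* The constant collects the errors made in replacing [n] by [f] in the product and
   in the two values; any constant independent of [e] would do. *)
have small (e : R) : 0 < e -> e <= 1 ->
    nrm (jmap n x) * nrm (jmap n y) <= e * (4 * N + 4).
  move=> e0 e1; have [f Pf fn] := rc_dense n e0.
  have /CcP[cf [L [cL _ fL]]] := Pf.
  (* The finitely many sources where [b] has to vanish. *)
  pose D := s @` ((L `&` [set w | r w = r y]) `\` [set w | s w = u]).
  have oP : open (units G `\` D).
    rewrite setDE; apply: openI; first exact: open_units.
    apply: closed_openC; apply: finite_closed; apply: finite_image.
    by apply: finite_setD; exact: finite_r_fiber.
  have Pu : (units G `\` D) u by split; [exact: units_s|case=> w [_ nw] /nw].
  have [phi [Pphi phi01 phi1]] := ex_bump R oP Pu.
  have {}phi1 : phi u = 1 by exact: nbhs_singleton phi1.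
  pose p z : R[i] := (phi z)%:C.
  have Pp : Cc (units G) p by apply: Cc_real; apply: Cc_sub Pphi => z [].
  have pu z : p z != 0 -> units G z by exact: Cc_supp Pp.
  have ub : C0_units A (rc p) by rewrite C0_unitsCr; exact: rc_Cr.
  have b1 : nrm (rc p) <= 1.
    apply: (@nrm_bisection R G A (units G)) => //; first exact: bisection_units.
      exact: rc_Aset.
    move=> z; rewrite (jmap_rc A Pp) nrm_real.
    by have /andP[h1 h2] := phi01 z; rewrite ger0_norm.
  have Pf' : Cc setT (involution f) := CcT (Cc_involution Pf).
  have Pfp : Cc setT (convolution f p) := CcT_conv Pf (CcT Pp).
  have Pfpf := CcT_conv Pfp Pf'.
  have val : convolution (convolution f p) (involution f) (x ** inv y) =
      f x * (f y)^*.
    rewrite (@conv_seq _ _ _ _ _ [:: inv y])//.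
    - rewrite big_seq1 involutionE inv_invK conv_unitsr//.
      by rewrite mulVKr// /p -/u phi1 mulr1.
    - by move=> z; rewrite inE => /eqP ->; rewrite eg_s_inv s_mulV.
    - move=> w; rewrite s_mulV// => sw.
      rewrite conv_unitsr// mulf_eq0 negb_or => /andP[_ pw].
      rewrite involutionE fmorph_eq0 => fw; rewrite inE; apply/eqP.
      have sw' : s (x ** inv y ** inv w) = s (inv w).
        by rewrite eg_s_mul// s_mulV// eg_r_inv sw.
      have Pw : (units G `\` D) (s (inv w)).
        by rewrite -sw'; apply: Cc_supp Pphi _; apply: contra_neq pw => h;
           rewrite /p h rmorph0.
      have swu : s (inv w) = u.
        apply: contrapT => h; case: Pw => _; apply; exists (inv w) => //.
        by split=> //; split; [exact: fL|rewrite /= eg_r_inv sw].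
      have rw : r (inv w) = r y by rewrite eg_r_inv sw.
      have iso : (s_fiber u `&` r_fiber u) (inv y ** inv w).
        have sr : s (inv y) = r (inv w) by rewrite eg_s_inv rw.
        by split; rewrite /s_fiber /r_fiber /= ?eg_s_mul ?eg_r_mul// eg_r_inv.
      move: iso; rewrite free => /= iso.
      by rewrite -(inv_invK w) -(mulKV (esym rw)) iso xy eg_mul_s.
  have := nN _ ub; rewrite C0_unitsE => /(_ _ nu) j0.
  have := jmap_le (cmul (cmul n (rc p)) (cstar n) -
    rc (convolution (convolution f p) (involution f))) (x ** inv y).
  rewrite jmapB (jmap_rc A Pfpf) val j0 sub0r nrmN nrmM nrm_conj.
  rewrite (rc_inM A Pfp Pf') (rc_inM A Pf (CcT Pp)) (rc_in_star A Pf) => h1.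
  have h2 := nrm_cmulB (cmul n (rc p)) (cstar n) (cmul (rc f) (rc p)) (cstar (rc f)).
  rewrite -cstarB !nrm_cstar in h2.
  have h3 : nrm (cmul n (rc p) - cmul (rc f) (rc p)) <= e.
    rewrite -cmulBl; apply: le_trans (nrm_cmul _ _) _; rewrite -[leRHS]mulr1.
    by apply: ler_pM; rewrite ?nrm_ge0// ltW.
  have hf : nrm (rc f) <= N + e.
    have := nrm_dist_triangle n (rc f) 0; rewrite !subr0 nrmBC /N; lra.
  have h4 : nrm (cmul (rc f) (rc p)) <= N + e.
    apply: le_trans (nrm_cmul _ _) _; rewrite -[leRHS]mulr1.
    by apply: ler_pM; rewrite ?nrm_ge0.
  have h5 : nrm (cmul n (rc p) - cmul (rc f) (rc p)) * nrm n <= e * N.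
    by rewrite ler_wpM2r.
  have h6 : nrm (cmul (rc f) (rc p)) * nrm (n - rc f) <= (N + e) * e.
    by apply: ler_pM; rewrite ?nrm_ge0// ltW.
  have fx := jmap_dist n x Pf; have fy := jmap_dist n y Pf.
  have tx := nrm_dist_triangle (f x) (jmap n x) 0; have ty := nrm_dist_triangle (f y) (jmap n y) 0.
  rewrite !subr0 in tx ty.
  have px := rc_point A x Pf; have py := rc_point A y Pf.
  have nx0 := nrm_ge0 (f x); have ny0 := nrm_ge0 (f y).
  have h7 : nrm (jmap n x) * nrm (jmap n y) <= (nrm (f x) + e) * (nrm (f y) + e).
    by apply: ler_pM; rewrite ?nrm_ge0//; lra.
  have h8 : e * nrm (f x) <= e * (N + e) by rewrite ler_pM2l//; lra.
  have h9 : e * nrm (f y) <= e * (N + e) by rewrite ler_pM2l//; lra.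
  have h10 : e * e <= e by rewrite -[leRHS]mulr1 ler_pM2l.
  nra.
have pos : 0 < nrm (jmap n x) * nrm (jmap n y).
  by apply: mulr_gt0; rewrite lt_neqAle nrm_ge0 andbT eq_sym;
    [apply: contra_neq nx|apply: contra_neq ny]; exact: nrm_eq0.
set t := nrm (jmap n x) * nrm (jmap n y) in small pos.
pose e := Num.min 1 (t / (2 * (4 * N + 4))).
have D0 : 0 < 2 * (4 * N + 4) by lra.
have e0 : 0 < e by rewrite lt_min ltr01 divr_gt0.
have e1 : e <= 1 by rewrite ge_min lexx.
have := small e e0 e1.
have : e * (2 * (4 * N + 4)) <= t by rewrite -ler_pdivlMr// ge_min lexx orbT.
lra.
Qed.

(** Disjoint neighbourhoods of [x] and [y] in the support of [n] have sources that
    meet in an open set of units, hence in a unit with trivial isotropy. *)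
Lemma normalizer_source_inj n x y : topologically_principal G ->
  (forall b, C0_units A b -> C0_units A (cmul (cmul n b) (cstar n))) ->
  jmap n x != 0 -> jmap n y != 0 -> s x = s y -> x = y.
Proof.
move=> tp nN nx ny xy; apply/eqP/negPn/negP => xny.
have := @eg_hausdorff G; rewrite open_hausdorff => /(_ x y xny).
move=> [[U V] /= [xU yV] [oU oV UV]]; rewrite !inE in xU yV.
pose T := [set z | jmap n z != 0]; have oT : open T by exact: open_jmap.
pose W := s @` (U `&` T) `&` s @` (V `&` T).
have oW : open W by apply: openI; apply: open_s; exact: openI.
have Wx : W (s x) by split; [exists x|exists y].
have [u [[uu free] [[x' [Ux' Tx'] sx'] [y' [Vy' Ty'] sy']]]] :=
  tp (s x) (units_s x) W (open_nbhs_nbhs (conj oW Wx)).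
have e : x' = y'.
  by apply: (@normalizer_free_fibre n) => //; rewrite ?sx' ?sy'.
by move/eqP/seteqP : UV => [h _]; apply: (h x'); split=> //; rewrite e.
Qed.

Lemma normalizer_bisection M n : topologically_principal G ->
  normalizer M (C0_units A) n -> bisection [set x | jmap n x != 0].
Proof.
move=> tp [_ nN]; split; first exact: open_jmap.
- by move=> x y nx ny; apply: (normalizer_source_inj tp _ nx ny) => b ub;
    have [] := nN b ub.
- move=> x y nx ny rxy; rewrite -(inv_invK x) -(inv_invK y); congr (inv _).
  have nz z : jmap n z != 0 -> jmap (cstar n) (inv z) != 0.
    by rewrite jmap_star inv_invK fmorph_eq0.
  apply: (normalizer_source_inj tp _ (nz _ nx) (nz _ ny)); last by rewrite !eg_s_inv.
  by move=> b ub; rewrite cstarK; have [] := nN b ub.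
Qed.

Lemma Cc_div S f (k : G -> R[i]) : Kcontinuous k -> (forall x, S x -> k x != 0) ->
  Cc S f -> Cc S (fun x => f x / k x).
Proof.
move=> ck k0 /CcP[cf [L [cL LS fL]]]; apply/CcP; split; last first.
  by exists L; split=> // x; rewrite mulf_eq0 negb_or => /andP[/fL].
move=> x; have [kx|kx] := eqVneq (k x) 0; last first.
  by apply: cvgM; [exact: cf|apply: cvgV => //; exact: ck].
have nL : ~ L x by move=> /LS/k0; rewrite kx eqxx.
have f0 z : ~ L z -> f z / k z = 0.
  move=> nLz; suff -> : f z = 0 by rewrite mul0r.
  by apply/eqP/negPn/negP => /fL.
rewrite /continuous_at (f0 x nL).
apply: cvg_trans; last exact: (@cvg_cst (R[i])^o 0 _ (nbhs x)).
apply: near_eq_cvg; apply: (@filterS _ _ _ (~` L)); first by move=> z /f0 ->.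
apply: open_nbhs_nbhs; split=> //; apply: closed_openC.
exact: compact_closed (@eg_hausdorff G) cL.
Qed.

(** Take for [b] the quotient of [f] by [jmap n], transported to the sources of the
    support of [n].  The equality is exact, because elements of the algebra are
    determined by their functions. *)
Lemma factor_bisection n f : bisection [set x | jmap n x != 0] ->
  Cc [set x | jmap n x != 0] f ->
  exists2 b, C0_units A b & rc f = cmul n b.
Proof.
set S := [set x | _] => bS Sf.
have Sk : Cc S (fun x => f x / jmap n x).
  by apply: Cc_div Sf => //; exact: jmap_continuous.
have Pp := Cc_push bS Sk.
have ub : C0_units A (rc (push S (fun x => f x / jmap n x))).
  by rewrite C0_unitsCr; exact: rc_Cr.
exists (rc (push S (fun x => f x / jmap n x))) => //.
apply: jmap_inj => x; rewrite jmap_mulr// (jmap_rc A Sf) (jmap_rc A Pp).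
have [nx|nx] := eqVneq (jmap n x) 0.
  by rewrite nx mul0r (Cc_out Sf)// /S /= nx eqxx.
by rewrite push_s// mulrC divfK.
Qed.

Section intermediate.
Variable M : set A.
Hypotheses (hM : cstar_subalgebra M) (uM : C0_units A `<=` M).
Local Notation N := (normalizer M (C0_units A)).

Lemma normalizer_C0_units b : C0_units A b -> N b.
Proof.
move=> ub; have [_ BM BS] := cstar_subalgebra_C0_units A.
split; first exact: uM.
move=> c uc; have us := BS _ ub.
by split; [exact: (BM _ _ (BM _ _ ub uc) us)|exact: (BM _ _ (BM _ _ us uc) ub)].
Qed.

Lemma normalizerM n m : N n -> N m -> N (cmul n m).
Proof.
have [_ MM MS] := hM.
move=> [Mn nN] [Mm mN]; split; first exact: MM.
move=> b ub; have [h1 h2] := mN b ub; have [h3 h4] := nN b ub.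
rewrite cstarM; split.
  by have [h _] := nN _ h1; rewrite !cmulA in h *.
by have [_ h] := mN _ h4; rewrite !cmulA in h *.
Qed.

Lemma normalizer_star n : N n -> N (cstar n).
Proof.
have [_ MM MS] := hM.
move=> [Mn nN]; split; first exact: MS.
by move=> b /nN[h1 h2]; rewrite cstarK.
Qed.

Definition normalizer_groupoid : set G :=
  [set x | exists2 n, N n & jmap n x != 0].

Local Notation H := normalizer_groupoid.
Hypothesis tp : topologically_principal G.

Lemma Cc_support_normalizer n f : N n -> Cc [set x | jmap n x != 0] f -> N (rc f).
Proof.
move=> Nn Sf; have [b ub ->] := factor_bisection (normalizer_bisection tp Nn) Sf.
by apply: normalizerM => //; exact: normalizer_C0_units.
Qed.

(** At a product of points of two bisections the convolution of functions of C_c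
    supported on them has a single term; normalizers of this kind therefore
    suffice to see that the supports are closed under products. *)
Lemma open_wide_normalizer_groupoid : open_wide_subgroupoid H.
Proof.
split; [|split|].
- rewrite (_ : H = \bigcup_(n in N) [set x | jmap n x != 0]).
    by apply: bigcup_open => n _; exact: open_jmap.
  by apply/seteqP; split=> x [n]; exists n.
- move=> x y [n Nn nx] [m Nm my] xy.
  have [f Pf fx] := @ex_Cc R G _ x (open_jmap n) nx.
  have [g Pg gy] := @ex_Cc R G _ y (open_jmap m) my.
  exists (cmul (rc f) (rc g)).
    by apply: normalizerM; [exact: Cc_support_normalizer Nn Pf|exact: Cc_support_normalizer Nm Pg].
  have Pf' := CcT Pf; have Pg' := CcT Pg.
  rewrite -rc_inM// (jmap_rc A (CcT_conv Pf' Pg')).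
  rewrite (conv_bisection (y := y) _ (normalizer_bisection tp Nm))//.
  + by rewrite mulK// fx gy mulr1 oner_eq0.
  + by move=> z; exact: Cc_supp Pg.
  + by rewrite eg_s_mul.
- move=> x [n Nn nx]; exists (cstar n); first exact: normalizer_star.
  by rewrite jmap_star inv_invK fmorph_eq0.
- move=> u uu; have [f Pf fu] := @ex_Cc R G _ u (@open_units G) uu.
  exists (rc f); last by rewrite (jmap_rc A Pf) fu oner_eq0.
  by apply: normalizer_C0_units; rewrite C0_unitsCr; exact: rc_Cr.
Qed.

Lemma Cr_normalizer_groupoid_sub : Cr A H `<=` M.
Proof.
have [hM1 _ _] := hM.
apply: (@Cr_sub_cover R G A {n | N n} (fun i => [set x | jmap (sval i) x != 0])) => //.
- by move=> i; exact: open_jmap.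
- by move=> x [n Nn nx]; exists (exist _ n Nn).
- move=> [n Nn] f Pf; have [] := Cc_support_normalizer Nn (f := f) => //.
  by apply: Cc_sub Pf => x [].
Qed.

(** Each normalizer vanishes off a bisection contained in [H], hence is in C_r(H),
    which is a C*-algebra; so is everything that normalizers generate. *)
Lemma cartan_eq_Cr : generated_cstar N = M -> M = Cr A H.
Proof.
move=> gN; apply/seteqP; split; last exact: Cr_normalizer_groupoid_sub.
have [oH sH _] := open_wide_normalizer_groupoid.
rewrite -{1}gN => a; apply; first exact: cstar_subalgebra_Cr.
move=> n Nn; apply: (@Cr_mono R G A [set x | jmap n x != 0]); first by move=> x; exists n.
rewrite -Aset_bisection; last exact: normalizer_bisection tp Nn.
by move=> x /= /negP/negPn/eqP.
Qed.

End intermediate.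
End normalizers.

(** * The diagonal and the conditional expectation *)

Section diagonal.
Variables (R : realType) (G : etale_groupoid) (A : reduced_cstar_algebra R G).
Implicit Types (f g : G -> R[i]) (x y z u : G) (P H S : set G) (a b : A).
Implicit Types M : set A.
Local Notation r := (@eg_r G).
Local Notation s := (@eg_s G).
Local Notation inv := (@eg_inv G).
Local Notation "x ** y" := (@eg_mul G x y) (at level 40, left associativity).
Local Notation rc := (rc_in A).
Local Notation B := (C0_units A).

Lemma jmap_C0_out b x : B b -> ~ units G x -> jmap b x = 0.
Proof. by rewrite C0_unitsE; apply. Qed.

Lemma rc_units f : Cc (units G) f -> B (rc f).
Proof. by move=> uf; rewrite C0_unitsCr; exact: rc_Cr. Qed.

(** Every C_0 function on the unit space comes from the diagonal: its soft thresholds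
    form a Cauchy sequence since the norm of the diagonal is the supremum norm. *)
Lemma C0_units_surj f : Kcontinuous f -> (forall x, ~ units G x -> f x = 0) ->
  (forall e : R, 0 < e -> compact [set x | e <= nrm (f x)]) ->
  exists2 b, B b & jmap b = f.
Proof.
move=> cf f0 kf.
have ucut (e : R) : 0 < e -> Cc (units G) (fun x => soft_threshold e (f x)).
  move=> e0; apply: soft_threshold_Cc => //; first exact: kf.
  by move=> x /= ex; apply: contrapT => /f0 fx; rewrite fx nrm0 in ex; lra.
pose v (n : nat) := rc (fun x => soft_threshold (n.+1%:R^-1) (f x)).
have n0 (n : nat) : 0 < n.+1%:R^-1 :> R by rewrite invr_gt0 ltr0n.
have Bv n : B (v n) by apply: rc_units; exact: ucut.
have vf n x : nrm (f x - jmap (v n) x) <= n.+1%:R^-1.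
  by rewrite /v (jmap_rc A (ucut _ (n0 n))); exact: soft_threshold_dist.
have vv n m : nrm (v n - v m) <= n.+1%:R^-1 + m.+1%:R^-1.
  have [_ _ BD BZ] := let: And3 h _ _ := cstar_subalgebra_C0_units A in h.
  have Bnm : B (v n - v m).
    by apply: BD; [exact: Bv|rewrite -scaleN1r; apply: BZ; exact: Bv].
  apply: (@nrm_bisection R G A (units G)); first exact: bisection_units.
  - by rewrite -C0_unitsE.
  - by rewrite addr_ge0// ltW.
  - move=> x; rewrite jmapB; apply: le_trans (nrm_dist_triangle (f x) _ _) _.
    by apply: lerD; rewrite ?vf// nrmBC vf.
have small (e : R) : 0 < e -> exists N : nat, forall n, (N <= n)%N -> n.+1%:R^-1 < e.
  move=> e0; have [N _ hN] := near_infty_natSinv_lt (PosNum e0).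
  by exists N => n Nn; exact: hN.
have : cvg (v @ \oo).
  apply: cauchy_cvg; apply: cauchy_exP => _ /positive_complex[e e0 ->].
  have e20 : 0 < e / 2 by rewrite divr_gt0.
  have [N hN] := small _ e20; exists (v N); exists N => // n /= Nn.
  rewrite -ball_normE /= nrmE ltcR; apply: le_lt_trans (vv _ _) _.
  by rewrite [e]splitr ltrD// hN.
move=> /cvg_ex[/= b vb]; exists b.
  have [cB _ _ _] := let: And3 h _ _ := cstar_subalgebra_C0_units A in h.
  apply: (closed_nrmP cB) => e e0; move/cvg_nrmP : vb => /(_ e e0)[N _ hN].
  by exists (v N); [exact: Bv|exact: (hN N (leqnn N))].
apply/funext => x; apply: eq_of_nrm => e e0.
have e20 : 0 < e / 2 by rewrite divr_gt0.
move/cvg_nrmP : vb => /(_ _ e20)[N1 _ hN1]; have [N2 hN2] := small _ e20.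
pose n := maxn N1 N2; have h1 := hN1 n (leq_maxl _ _); have h2 := hN2 n (leq_maxr _ _).
have h3 := vf n x; have h4 := jmap_le (b - v n) x; rewrite jmapB in h4.
have h5 := nrm_dist_triangle (jmap (v n) x) (jmap b x) (f x); rewrite [X in _ <= _ + X]nrmBC in h5.
have {}h1 : nrm (b - v n) < e / 2 := h1.
move: h2 h3; set q := _^-1 => h2 h3; lra.
Qed.

(** The square root of a nonnegative C_0 function is a C_0 function. *)
Lemma C0_cpositive b : B b -> (forall x, 0 <= jmap b x) -> cpositive b.
Proof.
move=> ub b0; pose q x : R := complex.Re (jmap b x).
have bq x : jmap b x = (q x)%:C by rewrite /q RRe_real// ger0_real.
have q0 x : 0 <= q x by rewrite -ler0c -bq.
have nq x : nrm (jmap b x) = q x by rewrite bq nrm_real ger0_norm.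
have [c uc jc] : exists2 c, B c & jmap c = (fun x => (Num.sqrt (q x))%:C).
  apply: C0_units_surj.
  - have cn := nrm_continuous (@jmap_continuous _ _ A b).
    apply: real_continuous => x.
    apply: (@cvg_comp _ _ _ q Num.sqrt _ (nbhs (q x))); last exact: sqrt_continuous.
    rewrite (_ : q = (fun x => nrm (jmap b x))); first exact: cn.
    by apply/funext => y; rewrite nq.
  - by move=> x nu; rewrite /q (jmap_C0_out ub nu) sqrtr0.
  - move=> e e0; rewrite (_ : [set x | _] = [set x | e ^+ 2 <= nrm (jmap b x)]).
      by apply: jmap_vanish; rewrite exprn_gt0.
    apply/seteqP; split=> x /=; rewrite nq nrm_real ger0_norm ?sqrtr_ge0//.
      by rewrite -(ler_sqr (ltW e0)) ?nnegrE ?sqrtr_ge0// sqr_sqrtr.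
    by rewrite -[e <= _](ler_sqr (ltW e0)) ?nnegrE ?sqrtr_ge0// sqr_sqrtr.
exists c; apply: jmap_inj => x; rewrite jmap_mulr// jmap_star jc.
have [ux|nu] := pselect (units G x); last first.
  rewrite (jmap_C0_out ub nu) [X in X^*](_ : _ = 0) ?rmorph0 ?mul0r//.
  rewrite -[LHS](congr1 (fun k => k (inv x)) jc) (jmap_C0_out uc)// => ui.
  by apply: nu; rewrite -(inv_invK x) (unit_inv ui).
rewrite (unit_inv ux) (unit_s ux) mul_conj nrm_real ger0_norm ?sqrtr_ge0//.
by rewrite sqr_sqrtr.
Qed.

End diagonal.

(** A limit of real numbers is real, and limits preserve inequalities. *)
Lemma le_complex_limit (R : realType) (z : R[i]) (t : R) :
  (forall e : R, 0 < e -> exists2 t' : R, t - e <= t' & nrm (z - t'%:C) <= e) ->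
  t%:C <= z.
Proof.
move=> h; rewrite lecE; apply/andP; split.
  rewrite -normr_le0; apply/ler_addgt0Pr => e e0; rewrite add0r.
  have [t' _ zt] := h e e0.
  have := Im_le_nrm (z - t'%:C); case: z {h} zt => p q /=; rewrite subr0; lra.
apply/ler_addgt0Pr => e e0.
have e20 : 0 < e / 2 by rewrite divr_gt0.
have [t' tt zt] := h _ e20.
have := Re_le_nrm (z - t'%:C); case: z {h} zt => p q /= zt; rewrite ler_norml; lra.
Qed.

Section expectation.
Variables (R : realType) (G : etale_groupoid) (A : reduced_cstar_algebra R G).
Implicit Types (f g : G -> R[i]) (x y z u : G) (P H S : set G) (a b : A).
Implicit Types M : set A.
Local Notation r := (@eg_r G).
Local Notation s := (@eg_s G).
Local Notation inv := (@eg_inv G).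
Local Notation "x ** y" := (@eg_mul G x y) (at level 40, left associativity).
Local Notation rc := (rc_in A).
Local Notation B := (C0_units A).

Definition expectation a : A := xget 0 [set b | B b /\
  jmap b = fun x => if `[< units G x >] then jmap a x else 0].

(** The unit space is open and closed, so that the restriction of [jmap a] to it is
    again a C_0 function. *)
Lemma expectationP a : B (expectation a) /\
  jmap (expectation a) = fun x => if `[< units G x >] then jmap a x else 0.
Proof.
rewrite /expectation; case: xgetP => [b _ //|/= ne].
pose f x := if `[< units G x >] then jmap a x else 0.
have fu x : units G x -> f x = jmap a x by move=> ux; rewrite /f asboolT.
have fn x : ~ units G x -> f x = 0 by move=> nx; rewrite /f asboolF.
have [| | |b ub jb] := @C0_units_surj R G A f; last by case: (ne b).
- move=> x; have [ux|nx] := pselect (units G x).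
    rewrite /continuous_at fu//.
    apply: cvg_trans; last exact: (@jmap_continuous _ _ A a).
    apply: near_eq_cvg; apply: (@filterS _ _ _ (units G)); first by move=> y /fu ->.
    by apply: open_nbhs_nbhs; split=> //; exact: open_units.
  rewrite /continuous_at fn//.
  apply: cvg_trans; last exact: (@cvg_cst (R[i])^o 0 _ (nbhs x)).
  apply: near_eq_cvg; apply: (@filterS _ _ _ (~` units G)); first by move=> y /fn ->.
  by apply: open_nbhs_nbhs; split=> //; apply: closed_openC; exact: closed_units.
- exact: fn.
- move=> e e0.
  rewrite (_ : [set x | _] = [set x | e <= nrm (jmap a x)] `&` units G).
    by apply: compact_closedI; [exact: jmap_vanish|exact: closed_units].
  apply/seteqP; split=> x /=.
    have [ux|nx] := pselect (units G x); first by rewrite fu.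
    by rewrite fn// nrm0; lra.
  by move=> [h ux]; rewrite fu.
Qed.

Lemma expectation_B a : B (expectation a).
Proof. by case: (expectationP a). Qed.

Lemma jmap_expectation a x : units G x -> jmap (expectation a) x = jmap a x.
Proof. by move=> ux; case: (expectationP a) => _ ->; rewrite asboolT. Qed.

Lemma eq_units a b : B a -> B b -> (forall u, units G u -> jmap a u = jmap b u) ->
  a = b.
Proof.
move=> ua ub ab; apply: jmap_inj => x.
have [ux|nx] := pselect (units G x); first exact: ab.
by rewrite !jmap_C0_out.
Qed.

(** On units [a^* a] is the sum of the squares of the values of [jmap a] over the
    source fibre, of which the term at [x] is one.  Being a lower bound, it passes to
    limits of functions of C_c; it gives both positivity and faithfulness of the
    conditional expectation. *)
Lemma jmap_star_mul a x : (nrm (jmap a x) ^+ 2)%:C <= jmap (cmul (cstar a) a) (s x).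
Proof.
apply: le_complex_limit => e e0.
pose N := nrm a; have N0 : 0 <= N by exact: nrm_ge0.
pose d := Num.min 1 (e / (2 * (2 * N + 2))).
have D0 : 0 < 2 * (2 * N + 2) by lra.
have d0 : 0 < d by rewrite lt_min ltr01 divr_gt0.
have d1 : d <= 1 by rewrite ge_min lexx.
have d3 : d * (2 * (2 * N + 2)) <= e by rewrite -ler_pdivlMr// ge_min lexx orbT.
have [f Pf fa] := rc_dense a d0.
have Pf' : Cc setT (involution f) := CcT (Cc_involution Pf).
have /CcP[_ [L [cL _ fL]]] := Pf.
have [l0 [ul0 l0x l0P]] := fiber_list (s x) (compactU cL (@compact_set1 _ x)).
have xl : x \in l0 by apply: l0P => //; right.
have val : convolution (involution f) f (s x) = (\sum_(y <- l0) nrm (f y) ^+ 2)%:C.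
  rewrite (@conv_seq _ _ _ _ _ l0)//; last first.
  - by move=> y; rewrite eg_ss => sy _ /fL Ly; apply: l0P => //; left.
  - by move=> y /l0x ->; rewrite eg_ss.
  rewrite rmorph_sum big_seq [RHS]big_seq; apply: eq_bigr => y yl.
  rewrite involutionE inv_mul ?eg_r_inv ?eg_ss ?(l0x y)// inv_invK.
  by rewrite unit_inv; [rewrite -(l0x y)// eg_mul_s mul_conj|exact: units_s].
have fax := jmap_dist a x Pf.
have ax0 := nrm_ge0 (jmap a x); have fx0 := nrm_ge0 (f x).
have aN : nrm (jmap a x) <= N by exact: jmap_le.
have fN : nrm (jmap a x) <= nrm (f x) + d.
  by have := nrm_dist_triangle (f x) (jmap a x) 0; rewrite !subr0; lra.
exists (\sum_(y <- l0) nrm (f y) ^+ 2).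
  have : nrm (f x) ^+ 2 <= \sum_(y <- l0) nrm (f y) ^+ 2.
    rewrite (big_rem x)//= lerDl; apply: sumr_ge0 => y _; exact: sqr_ge0.
  have : nrm (jmap a x) * nrm (jmap a x) <= nrm (jmap a x) * (nrm (f x) + d).
    by rewrite ler_wpM2l.
  have : nrm (jmap a x) * d <= N * d by rewrite ler_wpM2r// ltW.
  have : nrm (f x) * nrm (jmap a x) <= nrm (f x) * (nrm (f x) + d).
    by rewrite ler_wpM2l.
  have : nrm (f x) * d <= (N + 1) * d.
    apply: ler_wpM2r; first exact: ltW.
    by have := nrm_dist_triangle (jmap a x) (f x) 0; rewrite !subr0 nrmBC; lra.
  rewrite !expr2; lra.
have := jmap_dist (cmul (cstar a) a) (s x) (CcT_conv Pf' Pf).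
rewrite val (rc_inM A Pf' Pf) (rc_in_star A Pf) => h1.
have h2 := nrm_cmulB (cstar a) a (cstar (rc f)) (rc f).
rewrite -cstarB !nrm_cstar in h2.
have hf : nrm (rc f) <= N + 1.
  have := nrm_dist_triangle a (rc f) 0; rewrite !subr0 nrmBC /N; lra.
have h3 : nrm (a - rc f) * nrm a <= d * N by rewrite ler_wpM2r// ltW.
have h4 : nrm (rc f) * nrm (a - rc f) <= (N + 1) * d.
  by apply: ler_pM; rewrite ?nrm_ge0// ltW.
lra.
Qed.

Lemma expectation_faithful M : cstar_subalgebra M -> B `<=` M ->
  faithful_conditional_expectation M B expectation.
Proof.
move=> [_ MM MS] uM.
have [[_ B0 BD BZ] BM BS] := cstar_subalgebra_C0_units A.
have st a x : 0 <= jmap (cmul (cstar a) a) (s x).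
  apply: le_trans (jmap_star_mul a x); rewrite ler0c; exact: sqr_ge0.
split; [split| | | |].
- by move=> a _; exact: expectation_B.
- move=> a b _ _; apply: eq_units; first exact: expectation_B.
    by apply: BD; exact: expectation_B.
  by move=> u uu; rewrite jmapD !jmap_expectation// jmapD.
- move=> k a _; apply: eq_units; first exact: expectation_B.
    by apply: BZ; exact: expectation_B.
  by move=> u uu; rewrite jmapZ !jmap_expectation// jmapZ.
- move=> b ub; apply: eq_units => //; first exact: expectation_B.
  by move=> u uu; rewrite jmap_expectation.
- move=> a _; split.
    rewrite !nrmE lecR; apply: (@nrm_bisection R G A (units G)).
    + exact: bisection_units.
    + by rewrite -C0_unitsE; exact: expectation_B.
    + exact: nrm_ge0.
    + move=> x; have [ux|nx] := pselect (units G x).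
        by rewrite jmap_expectation// jmap_le.
      by rewrite jmap_C0_out ?nrm0 ?nrm_ge0//; exact: expectation_B.
  apply: C0_cpositive; first exact: expectation_B.
  move=> x; have [ux|nx] := pselect (units G x).
    by rewrite jmap_expectation// -(unit_s ux); exact: st.
  by rewrite jmap_C0_out//; exact: expectation_B.
- move=> a b _ ub; split; apply: eq_units.
  + exact: expectation_B.
  + by apply: BM => //; exact: expectation_B.
  + move=> u uu; rewrite jmap_expectation// !jmap_mulr//.
    by rewrite unit_s// jmap_expectation.
  + exact: expectation_B.
  + by apply: BM => //; exact: expectation_B.
  + move=> u uu; rewrite jmap_expectation// !jmap_mull//.
    by rewrite jmap_expectation.
- move=> a _ Ea; apply: jmap_inj => x; rewrite jmap0; apply: nrm_eq0.
  have := jmap_star_mul a x; rewrite -(jmap_expectation _ (units_s x)).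
  rewrite Ea jmap0 -[X in _ <= X]/(0%:C) lecR => h.
  by apply/eqP; rewrite -sqrf_eq0 eq_le h sqr_ge0.
Qed.

(** The net consists of the compactly supported functions with values in the unit
    interval, ordered pointwise and directed by maxima.  Those equal to 1 on the
    sources and ranges of the support of [f] fix [f] on both sides. *)
Lemma C0_units_approximate_unit M : B `<=` M -> contains_approximate_unit M B.
Proof.
move=> uM.
pose Q (phi : G -> R) := Cc (units G) phi /\ forall x, 0 <= phi x <= 1.
pose I := {phi | Q phi}.
pose e (i : I) : A := rc (fun x => (sval i x)%:C).
pose le (i j : I) := forall x, sval i x <= sval j x.
have uCc (i : I) : Cc (units G) (fun x => (sval i x)%:C : R[i]).
  by apply: Cc_real; case: i => phi [].
have ue i : B (e i) by exact: rc_units.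
have je i : jmap (e i) = (fun x => (sval i x)%:C) by exact: jmap_rc (uCc i).
have i01 (i : I) x : 0 <= sval i x <= 1 by case: i => phi [].
have e1 i : nrm (e i) <= 1.
  apply: (@nrm_bisection R G A (units G)) => //; first exact: bisection_units.
    by rewrite -C0_unitsE.
  by move=> x; rewrite je nrm_real; have /andP[h1 h2] := i01 i x; rewrite ger0_norm.
have [[_ _ BD BZ] _ _] := cstar_subalgebra_C0_units A.
exists I, le, e; split=> //; split.
- split.
  + apply: inhabits; exists (fun=> 0); split; first exact: Cc0.
    by move=> x; rewrite lexx ler01.
  + by move=> i x.
  + by move=> i j k ij jk x; exact: le_trans (ij x) (jk x).
  + move=> i j.
    have Pij : Cc (units G) (fun x => Num.max (sval i x) (sval j x)).
      by case: i j => phi [Pphi b1] [psi [Ppsi b2]]; exact: Cc_max.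
    have b01 x : 0 <= Num.max (sval i x) (sval j x) <= 1.
      have /andP[h1 h2] := i01 i x; have /andP[h3 h4] := i01 j x.
      by rewrite le_max h1 /= ge_max h2 h4.
    exists (exist Q _ (conj Pij b01)) => x /=; first by rewrite le_max lexx.
    by rewrite le_max lexx orbT.
- move=> i; split; [exact/uM/ue| |by rewrite nrmE lecR].
  apply: C0_cpositive => // x; rewrite je ler0c; by have /andP[] := i01 i x.
- move=> i j ij; apply: C0_cpositive.
    by apply: BD => //; rewrite -scaleN1r; exact: BZ.
  by move=> x; rewrite jmapB !je -rmorphB /= ler0c subr_ge0.
- move=> a _ _ /positive_complex[d d0 ->].
  have d30 : 0 < d / 3 by rewrite divr_gt0.
  have [f Pf fa] := rc_dense a d30.
  have /CcP[_ [L [cL _ fL]]] := Pf.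
  have cK : compact (r @` L `|` s @` L).
    apply: compactU; first exact: compact_image (@r_continuous G) cL.
    exact: compact_image (@s_continuous G) cL.
  have [phi [Pphi phi01 phi1]] : exists phi : G -> R, [/\ Cc (units G) phi,
      forall y, 0 <= phi y <= 1 & forall y, (r @` L `|` s @` L) y -> phi y = 1].
    apply: compact_bump => //; first exact: open_units.
    by move=> x [[y _ <-]|[y _ <-]]; [exact: units_r|exact: units_s].
  exists (exist Q phi (conj Pphi phi01)) => i phii.
  have i1 x : (r @` L `|` s @` L) x -> sval i x = 1.
    move=> Kx; apply/eqP; rewrite eq_le; have /andP[_ ->] := i01 i x.
    by rewrite -(phi1 x Kx); exact: phii.
  have ef : cmul (e i) (rc f) = rc f.
    apply: jmap_inj => x; rewrite jmap_mull// je (jmap_rc A Pf).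
    have [->|/fL Lx] := eqVneq (f x) 0; first by rewrite mulr0.
    by rewrite i1 ?mul1r//; left; exists x.
  have fe : cmul (rc f) (e i) = rc f.
    apply: jmap_inj => x; rewrite jmap_mulr// je (jmap_rc A Pf).
    have [->|/fL Lx] := eqVneq (f x) 0; first by rewrite mul0r.
    by rewrite i1 ?mulr1//; right; exists x.
  have fa0 := nrm_ge0 (a - rc f).
  rewrite !nrmE !ltcR; split.
    apply: le_lt_trans (nrm_dist_triangle (rc f) _ _) _.
    rewrite -{1}ef -cmulBr [X in _ + X]nrmBC.
    have : nrm (cmul (e i) (a - rc f)) <= 1 * nrm (a - rc f).
      by apply: le_trans (nrm_cmul _ _) _; apply: ler_wpM2r.
    lra.
  apply: le_lt_trans (nrm_dist_triangle (rc f) _ _) _.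
  rewrite -{1}fe -cmulBl [X in _ + X]nrmBC.
  have : nrm (cmul (a - rc f) (e i)) <= nrm (a - rc f) * 1.
    by apply: le_trans (nrm_cmul _ _) _; apply: ler_wpM2l.
  lra.
Qed.

End expectation.

(** * Cartan subalgebras and open wide subgroupoids *)

Section cartan.
Variables (R : realType) (G : etale_groupoid) (A : reduced_cstar_algebra R G).
Implicit Types (f g : G -> R[i]) (x y z u : G) (P H S : set G) (a b : A).
Implicit Types M : set A.
Local Notation r := (@eg_r G).
Local Notation s := (@eg_s G).
Local Notation inv := (@eg_inv G).
Local Notation "x ** y" := (@eg_mul G x y) (at level 40, left associativity).
Local Notation rc := (rc_in A).
Local Notation B := (C0_units A).

Hypothesis tp : topologically_principal G.

(** Commuting with functions separating [s x] from [r x] confines the support of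
    [jmap a] to the isotropy.  The support being open, a point of it that is not a
    unit would lead, by density of the units with trivial isotropy, to another
    such point over a unit with trivial isotropy. *)
Lemma commutant_C0_units a : (forall b, B b -> cmul a b = cmul b a) -> B a.
Proof.
move=> ab; rewrite C0_unitsE.
have iso x : jmap a x != 0 -> s x = r x.
  move=> ax; apply/eqP/negPn/negP => sr.
  have oP : open (units G `\ r x).
    rewrite setDE; apply: openI; first exact: open_units.
    apply: closed_openC; apply: finite_closed; exact: finite_set1.
  have Px : (units G `\ r x) (s x) by split; [exact: units_s|apply/eqP].
  have [p Pp p1] := @ex_Cc R G _ _ oP Px.
  have up : B (rc p) by apply: rc_units; apply: Cc_sub Pp => z [].
  have := congr1 (fun c => jmap c x) (ab _ up).
  rewrite jmap_mulr// jmap_mull// (jmap_rc A Pp) p1 mulr1.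
  rewrite (Cc_out Pp (x := r x)); last by case=> _; apply.
  by rewrite mul0r; apply/eqP.
move=> x nx; apply/eqP/negPn/negP => ax.
pose W := [set z | jmap a z != 0] `\` units G.
have oW : open W.
  rewrite /W setDE; apply: openI; first exact: open_jmap.
  apply: closed_openC; exact: closed_units.
have Wx : (s @` W) (s x) by exists x.
have [u [[uu free] [y [ay ny] sy]]] :=
  tp (units_s x) (open_nbhs_nbhs (conj (open_s oW) Wx)).
apply: ny; have : (s_fiber u `&` r_fiber u) y.
  by split=> //; rewrite /r_fiber /= -(iso y ay).
by rewrite free => ->.
Qed.

Lemma maximal_abelian_C0_units M : B `<=` M -> maximal_abelian M B.
Proof.
move=> uM; split=> //; first exact: abelian_C0_units.
move=> D [_ Dab] BD _; apply/seteqP; split=> // a Da.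
by apply: commutant_C0_units => b ub; apply: Dab => //; exact: BD.
Qed.

(** In [f b f^*] at [x] a nonzero term at [y] needs [x y^-1] and [y^-1] in [S], with
    the same source: they are equal and [x] is a unit. *)
Lemma bisection_conj S f b : bisection S -> Cc S f -> B b ->
  B (cmul (cmul (rc f) b) (cstar (rc f))).
Proof.
move=> [_ sS rS] Sf; rewrite {1}C0_unitsCr C0_unitsE => ub x nx.
pose K := nrm (rc f) * nrm (rc f).
(* By density it is enough to treat [b] in C_c of the unit space, where products
   are convolutions. *)
apply: (@eq_on_closure R A (R[i]) (rc @` Cc (units G))
  (fun b => jmap (cmul (cmul (rc f) b) (cstar (rc f))) x) (fun=> 0) K) ub.
- move=> a c; rewrite -jmapB -cmulBl -cmulBr; apply: le_trans (jmap_le _ _) _.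
  apply: le_trans (nrm_cmul _ _) _; rewrite nrm_cstar /K mulrAC.
  by apply: ler_wpM2r; [exact: nrm_ge0|exact: nrm_cmul].
- by move=> a c; rewrite subrr nrm0 !mulr_ge0 ?nrm_ge0.
- move=> _ [p up <-]; have Pf := CcT Sf; have Pp := CcT up.
  have Pf' : Cc setT (involution f) := CcT (Cc_involution Pf).
  have Pfp := CcT_conv Pf Pp.
  rewrite -(rc_inM A Pf Pp) -(rc_in_star A Pf) -(rc_inM A Pfp Pf').
  rewrite (jmap_rc A (CcT_conv Pfp Pf')).
  apply/eqP/negPn/negP => /conv_neq0[y [sy]].
  rewrite conv_unitsr; last by move=> z; exact: Cc_supp up.
  rewrite mulf_eq0 negb_or involutionE fmorph_eq0 => /andP[fxy _] fy; apply: nx.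
  have e : x ** inv y = inv y.
    apply: sS; [exact: Cc_supp fxy|exact: Cc_supp fy|].
    by rewrite s_mulV// eg_s_inv.
  have -> : x = inv y ** y by rewrite -e mulVKr.
  by rewrite eg_inv_mul; exact: units_s.
Qed.

Lemma bisection_inv S : bisection S -> bisection (inv @^-1` S).
Proof.
move=> [oS sS rS]; split.
- by apply: open_comp => // x _; exact: eg_inv_continuous.
- move=> x y Sx Sy xy; rewrite -(inv_invK x) -(inv_invK y); congr (inv _).
  by apply: rS => //; rewrite !eg_r_inv.
- move=> x y Sx Sy xy; rewrite -(inv_invK x) -(inv_invK y); congr (inv _).
  by apply: sS => //; rewrite !eg_s_inv.
Qed.

Lemma bisection_normalizer M S f : bisection S -> Cc S f -> M (rc f) ->
  normalizer M B (rc f).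
Proof.
move=> bS Sf Mf; split=> // b ub; split; first exact: bisection_conj Sf ub.
have := bisection_conj (bisection_inv bS) (Cc_involution Sf) ub.
by rewrite (rc_in_star A (CcT Sf)) cstarK.
Qed.

Lemma C0_units_sub_Cr H : units G `<=` H -> B `<=` Cr A H.
Proof. by move=> uH; rewrite C0_unitsCr; exact: Cr_mono. Qed.

Theorem cartan_Cr H : open_wide_subgroupoid H -> cartan_subalgebra (Cr A H) B.
Proof.
move=> [oH sH uH]; have hM := cstar_subalgebra_Cr A sH.
have BH := C0_units_sub_Cr uH.
split.
- by split; [exact: abelian_C0_units|].
- exact: C0_units_approximate_unit.
- exact: maximal_abelian_C0_units.
- apply/seteqP; split=> a.
    by apply; [exact: hM|move=> n []].
  move=> Ha D [hD _ _] ND.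
  apply: (@Cr_sub_cover R G A {S | bisection S} sval H D) Ha => //.
  + by case=> S [].
  + by move=> x _; have [S bS Sx] := ex_bisection x; exists (exist _ S bS).
  + move=> [S bS] f Pf; apply: ND; apply: (bisection_normalizer bS).
      by apply: Cc_sub Pf => x [].
    by apply: rc_Cr; apply: Cc_sub Pf => x [].
- by exists (@expectation R G A); exact: expectation_faithful.
Qed.

Theorem cartan_groupoid M : cstar_subalgebra M -> cartan_subalgebra M B ->
  exists2 H, open_wide_subgroupoid H & M = Cr A H.
Proof.
move=> hM [[_ uM] _ _ gN _]; exists (normalizer_groupoid M).
  exact: open_wide_normalizer_groupoid.
exact: cartan_eq_Cr.
Qed.

Lemma Cr_spectrum H M : open_wide_subgroupoid H -> M = Cr A H -> H = spectrum M.
Proof. by move=> [oH _ _] ->; rewrite spectrum_Cr. Qed.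

End cartan.

Theorem proposition3p24 (R : realType) (G : etale_groupoid)
    (A : reduced_cstar_algebra R G)
    (Gprincipal : topologically_principal G) (Gamenable : amenable G R) :
  (forall M : set A, cstar_subalgebra M -> C0_units A `<=` M ->
     (cartan_subalgebra M (C0_units A) <->
        exists! H : set G, open_wide_subgroupoid H /\ M = Cr A H) /\
     (cartan_subalgebra M (C0_units A) ->
        [/\ forall H : set G,
              open_wide_subgroupoid H -> M = Cr A H -> H = spectrum M,
            diagonal_bimodule M & spectral M])) /\
  set_bij [set H : set G | open_wide_subgroupoid H]
          [set M : set A |
             cstar_subalgebra M /\ cartan_subalgebra M (C0_units A)]
          (fun H => Aset A H).
Proof.
have AsetE (H : set G) : open_wide_subgroupoid H -> Aset A H = Cr A H.
  by case=> oH _ _; exact: amenable_Aset.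
split=> [M hM uM|].
  split; first split.
  - move=> /(cartan_groupoid Gprincipal hM)[H wH MH]; exists H; split=> //.
    by move=> H' [wH' MH']; rewrite (Cr_spectrum wH MH) (Cr_spectrum wH' MH').
  - by move=> [H [[wH ->] _]]; exact: cartan_Cr.
  - move=> cM; split; first by move=> H; exact: Cr_spectrum.
      exact: intermediate_diagonal_bimodule.
    have [H wH MH] := cartan_groupoid Gprincipal hM cM.
    by rewrite /spectral -(Cr_spectrum wH MH) AsetE.
split.
- move=> H wH /=; rewrite AsetE//; split; last exact: cartan_Cr.
  by apply: cstar_subalgebra_Cr; case: wH.
- move=> H H'; rewrite !inE /= => wH wH' HH'.
  rewrite (Cr_spectrum wH (AsetE _ wH)) (Cr_spectrum wH' (AsetE _ wH')).
  by rewrite HH'.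
- move=> M [hM cM]; have [H wH MH] := cartan_groupoid Gprincipal hM cM.
  by exists H => //=; rewrite AsetE.
Qed.
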